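(* Let $S$ be a discrete valuation ring, $G$ a finite subgroup of $\mathrm{Aut}(S)$, $R=S^G$, and assume that the residue field extension $\bar S/\bar R$ is separable. Let $f\in Z^2(G,S^* )$ and $T=S^f*G$. Then $T$ is hereditary if and only if $\bar S^{\bar f}G_I$ is semisimple and isomorphic to a commutative twisted group algebra $F^{\alpha_0}C_{e_0}\simeq F[x]/\langle x^{e_0}-\alpha_0\rangle$, where $F=\bar S^{\bar f}P$ is a purely inseparable field extension of $\bar S$ and $C_{e_0}$ is a cyclic group of order $e_0$, which is prime to $p$. In particular, in this case $G_I$ is abelian of the form $G_I=P\times C_{e_0}$.
   Context: $M_S$ is the maximal ideal of $S$, $\bar S=S/M_S$, $\bar R=R/(M_S\cap R)$, and $p=\mathrm{char}(\bar S)$. For $f\in Z^2(G,S^* )$, the crossed product $S^f*G=\bigoplus_{g\in G}SU_g$ is the free left $S$-module on symbols $U_g$ with multiplication $sU_g\,tU_h=s\,g(t)f(g,h)U_{gh}$ for $s,t\in S$, $g,h\in G$. Let $\bar f\in Z^2(G,\bar S^* )$ be the image of $f$; then $T/M_ST\cong\bar S^{\bar f}*G$, the crossed product over $\bar S$ defined by the same formula, whose basis elements are still denoted $U_g$. The inertia subgroup $G_I\lhd G$ is the kernel of the induced action of $G$ on $\bar S$; for a subgroup $H\le G_I$, $\bar S^{\bar f}H=\bigoplus_{h\in H}\bar SU_h$ is the sub-crossed product graded by $H$ (a twisted group algebra). $P$ is a $p$-Sylow subgroup of $G_I$ (trivial if $p=0$, in which case the condition ''prime to $p$'' is vacuous).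 Under the residual separability assumption, $P$ is normal in $G_I$ and $G_I=P\rtimes C_{e_0}$, where $C_{e_0}=\langle\sigma_0\rangle$ is cyclic of order $e_0$ prime to $p$; set $\alpha_0:=U_{\sigma_0}^{e_0}\in\bar S^*$. $F^{\alpha_0}C_{e_0}$ denotes the twisted group algebra of $C_{e_0}$ over $F$ generated over $F$ by a central element $U_{\sigma_0}$ with $U_{\sigma_0}^{e_0}=\alpha_0$. The 2-cocycles are normalized. *)

(* Defs.v *)
From HB Require Import structures.
From mathcomp Require Import all_boot all_algebra all_fingroup all_solvable.
From mathcomp Require Import all_field boolp.

Set Implicit Arguments.
Unset Strict Implicit.
Unset Printing Implicit Defensive.

Import GRing.Theory.
Local Open Scope ring_scope.
Local Open Scope quotient_scope.

Section RingNotions.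
Variable A : nzRingType.

Definition left_ideal (I : A -> Prop) : Prop :=
  [/\ I 0, forall x y, I x -> I y -> I (x + y) & forall a x, I x -> I (a * x)].

Definition semisimple_ring : Prop :=
  forall I : A -> Prop, left_ideal I ->
  exists J : A -> Prop,
    [/\ left_ideal J,
        forall x, I x -> J x -> x = 0
      & forall x, exists y z, [/\ I y, J z & x = y + z]].

Definition projective (P : lmodType A) : Prop :=
  forall (M N : lmodType A) (g : {linear M -> N}) (h : {linear P -> N}),
    (forall y, exists x, g x = y) ->
  exists h' : {linear P -> M}, forall x, g (h' x) = h x.

(* Up to isomorphism, the left ideals of A are the modules that embed into    *)
(* the left regular module A^o.                                               *)
Definition left_hereditary : Prop :=
  forall (I : lmodType A) (i : {linear I -> A^o}), injective i -> projective I.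

End RingNotions.

(* The right ideals of A are the left ideals of the converse ring A^c.        *)
Definition hereditary (A : nzRingType) : Prop :=
  left_hereditary A /\ left_hereditary A^c.

(* A local principal ideal domain that is not a field; for a ring in which    *)
(* non-units are closed under addition, they form the unique maximal ideal.   *)
HB.mixin Record isDVR S of GRing.IntegralDomain S := {
  dvr_principal : forall I : S -> Prop, left_ideal I ->
    exists a, forall x, I x <-> exists b, x = b * a;
  dvr_local : forall x y : S, x \isn't a GRing.unit ->
    y \isn't a GRing.unit -> x + y \isn't a GRing.unit;
  dvr_nonfield : exists2 x : S, x != 0 & x \isn't a GRing.unit
}.

#[short(type="dvrType")]
HB.structure Definition DVR := {S of isDVR S & GRing.IntegralDomain S}.

Section ResidueField.
Variable S : dvrType.

Definition maxideal : {pred S} := [pred x | x \isn't a GRing.unit].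

Lemma maxideal_closed : idealr_closed maxideal.
Proof.
split; rewrite ?inE ?unitr0 ?unitr1 //.
move=> a x y; rewrite !inE => xN yN; apply: dvr_local => //.
by rewrite unitrM negb_and xN orbT.
Qed.

HB.instance Definition _ := isIdealr.Build S maxideal maxideal_closed.

Local Notation quotS := {ideal_quot (maxideal : idealr S)}.

Definition residue : Type := quotS.
HB.instance Definition _ := GRing.ComNzRing.on residue.

Definition res (x : S) : residue := \pi_quotS x.
Definition res_repr (u : residue) : S := generic_quotient.repr (u : quotS).

Lemma res_reprK : cancel res_repr res. Proof. exact: reprK. Qed.

Fact res_is_zmod_morphism : zmod_morphism res.
Proof. by move=> x y; rewrite /res (rmorphB \pi_quotS). Qed.
Fact res_is_monoid_morphism : monoid_morphism res.
Proof.
by split=> [|x y]; rewrite /res ?(rmorph1 \pi_quotS) ?(rmorphM \pi_quotS).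
Qed.
HB.instance Definition _ := GRing.isZmodMorphism.Build S residue res
  res_is_zmod_morphism.
HB.instance Definition _ := GRing.isMonoidMorphism.Build S residue res
  res_is_monoid_morphism.

Lemma res_eq x y : (res x == res y) = (x - y \in maxideal).
Proof. by rewrite Quotient.idealrBE. Qed.

Lemma res_eq0 x : (res x == 0) = (x \isn't a GRing.unit).
Proof. by rewrite -(rmorph0 res) res_eq subr0. Qed.

Definition resV (u : residue) : residue :=
  if u == 0 then 0 else res (res_repr u)^-1.

Fact mul_resV u : u != 0 -> resV u * u = 1.
Proof.
move=> u0; rewrite /resV (negPf u0) -{2}[u]res_reprK -rmorphM mulVr ?rmorph1 //.
by rewrite -[_ \is a _]negbK -res_eq0 res_reprK.
Qed.
Fact resV0 : resV 0 = 0. Proof. by rewrite /resV eqxx. Qed.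

HB.instance Definition _ :=
  GRing.ComNzRing_isField.Build residue mul_resV resV0.

End ResidueField.

Record ring_action (gT : finGroupType) (A : nzRingType) := RingAction {
  ract :> gT -> {rmorphism A -> A};
  ract1 : ract 1%g =1 id;
  ractM : forall g h x, ract (g * h)%g x = ract g (ract h x)
}.

(* A faithful action of gT on A is an isomorphism of gT with a finite         *)
(* subgroup of Aut(A).                                                        *)
Definition faithful_action gT A (a : ring_action gT A) : Prop :=
  forall g, a g =1 id -> g = 1%g.

Record cocycle2 gT (A : comUnitRingType) (a : ring_action gT A) := Cocycle2 {
  coc :> gT -> gT -> A;
  coc_unit : forall g h, coc g h \is a GRing.unit;
  coc1g : forall g, coc 1%g g = 1;
  cocg1 : forall g, coc g 1%g = 1;
  cocA : forall g h k,
    coc g h * coc (g * h)%g k = a g (coc h k) * coc g (h * k)%g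
}.

Section CrossedProduct.
Variables (gT : finGroupType) (A : comUnitRingType) (a : ring_action gT A).

(* The element x of the crossed product stands for \sum_g x g * U_g.          *)
Definition crossed (f : cocycle2 a) : Type := {ffun gT -> A}.

Variable f : cocycle2 a.

HB.instance Definition _ := GRing.Zmodule.on (crossed f).

(* s * U_g *)
Definition crU (s : A) (g : gT) : crossed f :=
  [ffun k => if k == g then s else 0].

Definition cr_mul (x y : crossed f) : crossed f :=
  [ffun k => \sum_g x g * a g (y (g^-1 * k)%g) * f g (g^-1 * k)%g].

Fact cr_mulA : associative cr_mul.
Proof.
move=> x y z; apply/ffunP => k; rewrite !ffunE.
under [RHS]eq_bigr => h _ do rewrite ffunE !mulr_suml.
rewrite exchange_big /=; apply: eq_bigr => g _.
rewrite ffunE rmorph_sum mulr_sumr mulr_suml.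
rewrite [RHS](reindex_inj (mulgI g)); apply: eq_bigr => h _ /=.
rewrite mulKg invMg -!mulgA !rmorphM -ractM.
have := cocA f g h (h^-1 * (g^-1 * k))%g; rewrite mulKVg => E.
rewrite -!mulrA; do 2!congr (_ * _).
rewrite [RHS]mulrCA; congr (_ * _); exact: esym.
Qed.

Fact cr_mul1 : left_id (crU 1 1) cr_mul.
Proof.
move=> x; apply/ffunP => k; rewrite ffunE (bigD1 1%g) //= big1.
  by rewrite ffunE eqxx ract1 invg1 !mul1g coc1g addr0 mulr1 mul1r.
by move=> g /negPf g1; rewrite ffunE g1 !mul0r.
Qed.

Fact cr_mulr1 : right_id (crU 1 1) cr_mul.
Proof.
move=> x; apply/ffunP => k; rewrite ffunE (bigD1 k) //= big1.
  by rewrite mulVg ffunE eqxx rmorph1 cocg1 addr0 !mulr1.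
move=> g gk; rewrite ffunE -eq_mulVg1.
by rewrite (negPf gk) rmorph0 mulr0 mul0r.
Qed.

Fact cr_mulDl : left_distributive cr_mul +%R.
Proof.
move=> x y z; apply/ffunP => k; rewrite !ffunE -big_split.
by apply: eq_bigr => g _; rewrite ffunE !mulrDl.
Qed.

Fact cr_mulDr : right_distributive cr_mul +%R.
Proof.
move=> x y z; apply/ffunP => k; rewrite !ffunE -big_split.
by apply: eq_bigr => g _; rewrite ffunE rmorphD mulrDr mulrDl.
Qed.

Fact cr_1neq0 : crU 1 1 != 0.
Proof.
by apply/eqP => /ffunP/(_ 1%g); rewrite !ffunE eqxx; apply/eqP; rewrite oner_eq0.
Qed.

HB.instance Definition _ := GRing.Zmodule_isNzRing.Build (crossed f)
  cr_mulA cr_mul1 cr_mulr1 cr_mulDl cr_mulDr cr_1neq0.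

Lemma crUM s t g h : crU s g * crU t h = crU (s * a g t * f g h) (g * h).
Proof.
apply/ffunP => k; rewrite ffunE (bigD1 g) //= big1 => [|i /negPf ig].
  rewrite !ffunE eqxx addr0 -(inj_eq (mulgI g)) mulKVg.
  by case: eqP => [->|_]; rewrite ?mulKg // rmorph0 mulr0 mul0r.
by rewrite ffunE ig !mul0r.
Qed.

Lemma cr_sumU (x : crossed f) : x = \sum_g crU (x g) g.
Proof.
apply/ffunP => k; rewrite sum_ffunE (bigD1 k) //= big1 ?ffunE ?eqxx ?addr0 //.
by move=> g /negPf gk; rewrite ffunE eq_sym gk.
Qed.

Variable H : {group gT}.

Definition graded_by : {pred crossed f} :=
  [pred x : crossed f | [forall g, (x g != 0) ==> (g \in H)]].

Lemma graded_byP (x : crossed f) :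
  reflect (forall g, g \notin H -> x g = 0) (x \in graded_by).
Proof.
apply: (iffP forallP) => xH g; last by apply/implyP; apply: contraNT => /xH ->.
by move=> gH; apply/eqP; apply: contraNT gH => /(implyP (xH g)).
Qed.

Fact graded_by_closed : subring_closed graded_by.
Proof.
split=> [|x y /graded_byP xH /graded_byP yH|x y /graded_byP xH /graded_byP yH].
- apply/graded_byP => g gH; rewrite ffunE; case: eqP => // g1.
  by rewrite g1 group1 in gH.
- by apply/graded_byP => g gH; rewrite !ffunE xH ?yH ?subr0.
apply/graded_byP => k kH; rewrite ffunE big1 // => g _.
have [gH|/xH->] := boolP (g \in H); last by rewrite !mul0r.
by rewrite yH ?rmorph0 ?mulr0 ?mul0r // groupMl ?groupV.
Qed.

HB.instance Definition _ := GRing.isSubringClosed.Build (crossed f) graded_by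
  graded_by_closed.

Record subcrossed := SubCrossed {
  crval :> crossed f;
  _ : crval \in graded_by
}.

HB.instance Definition _ := [isSub for crval].
HB.instance Definition _ := [Choice of subcrossed by <:].
HB.instance Definition _ := [SubChoice_isSubNzRing of subcrossed by <:].

End CrossedProduct.

Section TwistedCyclic.
Variable A : comUnitRingType.

Definition trivial_action (gT : finGroupType) : ring_action gT A :=
  @RingAction gT A (fun=> idfun) (frefl _) (fun _ _ _ => erefl).

Variables (n : nat) (alpha : A) (alphaU : alpha \is a GRing.unit).

(* The cocycle on the (additively written) cyclic group 'I_n.+1 for which     *)
(* U_1 ^+ n.+1 = alpha.                                                       *)
Definition cyclic_coc (i j : 'I_n.+1) : A :=
  if (i + j < n.+1)%N then 1 else alpha.

Fact cyclic_cocE i j : cyclic_coc i j = alpha ^+ ((i + j) %/ n.+1).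
Proof.
rewrite /cyclic_coc; case: ltnP => [lt_ij | le_ij]; first by rewrite divn_small.
suff ->: ((i + j) %/ n.+1 = 1)%N by [].
apply/eqP; rewrite eqn_leq -ltnS ltn_divLR // leq_divRL // mul1n le_ij andbT.
by rewrite mul2n -addnn -addnS leq_add // ltnW.
Qed.

Fact cyclic_coc_unit i j : cyclic_coc i j \is a GRing.unit.
Proof. by rewrite cyclic_cocE unitrX. Qed.

Fact cyclic_coc1g i : cyclic_coc 1%g i = 1.
Proof. by rewrite /cyclic_coc add0n ltn_ord. Qed.

Fact cyclic_cocg1 i : cyclic_coc i 1%g = 1.
Proof. by rewrite /cyclic_coc addn0 ltn_ord. Qed.

Fact cyclic_cocA i j k :
  cyclic_coc i j * cyclic_coc (i * j)%g k =
  trivial_action 'I_n.+1 i (cyclic_coc j k) * cyclic_coc i (j * k)%g.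
Proof.
rewrite /= !cyclic_cocE -!exprD; congr (_ ^+ _) => /=.
have carry p q : (p %/ n.+1 + (p %% n.+1 + q) %/ n.+1 = (p + q) %/ n.+1)%N.
  by rewrite {3}(divn_eq p n.+1) -addnA divnMDl.
rewrite carry [(i + _)%N in RHS]addnC carry; congr (_ %/ _)%N.
by rewrite [RHS]addnC addnA.
Qed.

Definition cyclic_cocycle : cocycle2 (trivial_action 'I_n.+1) :=
  Cocycle2 cyclic_coc_unit cyclic_coc1g cyclic_cocg1 cyclic_cocA.

Lemma cyclic_crU_exp : (0 < n)%N ->
  crU cyclic_cocycle 1 (inZp 1) ^+ n.+1 = crU _ alpha 1%g.
Proof.
move=> n_gt0.
have U_exp m : (m < n.+1)%N ->
    crU cyclic_cocycle 1 (inZp 1) ^+ m = crU cyclic_cocycle 1 (inZp m).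
  elim: m => [_|m IHm lt_m].
    by rewrite expr0; congr (crU _ _ _); apply: val_inj; rewrite /= mod0n.
  rewrite exprSr IHm ?(ltnW lt_m) // crUM /= !mul1r /cyclic_coc /=.
  have n1 : (1 < n.+1)%N by apply: leq_trans lt_m.
  rewrite (modn_small n1) (modn_small (ltnW lt_m)) addn1 lt_m.
  congr (crU _ _ _); apply: val_inj => /=.
  by rewrite (modn_small n1) (modn_small (ltnW lt_m)) addn1.
rewrite exprSr U_exp // crUM /= !mul1r /cyclic_coc /=.
rewrite (modn_small (ltnSn n)) (@modn_small 1) // addn1 ltnn.
congr (crU _ _ _); apply: val_inj => /=.
by rewrite (modn_small (ltnSn n)) (@modn_small 1) // addn1 modnn.
Qed.

End TwistedCyclic.

Section Reduction.
Variables (S : dvrType) (gT : finGroupType) (a : ring_action gT S).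

Definition res_act_fun g (u : residue S) : residue S := res (a g (res_repr u)).

Lemma ract_unit g x : (a g x \is a GRing.unit) = (x \is a GRing.unit).
Proof.
apply/idP/idP => [|xU]; last exact: rmorph_unit.
by move/(rmorph_unit (a g^-1%g)); rewrite -ractM mulVg ract1.
Qed.

Lemma res_act_funE g x : res_act_fun g (res x) = res (a g x).
Proof.
apply/eqP; rewrite res_eq -rmorphB inE ract_unit.
by have := eqxx (res x); rewrite -{1}[res x]res_reprK res_eq.
Qed.

Fact res_act_is_zmod_morphism g : zmod_morphism (res_act_fun g).
Proof.
move=> u v; rewrite -[u]res_reprK -[v]res_reprK -rmorphB !res_act_funE.
by rewrite !rmorphB.
Qed.

Fact res_act_is_monoid_morphism g : monoid_morphism (res_act_fun g).
Proof.
split=> [|u v]; first by rewrite -(rmorph1 (@res S)) res_act_funE !rmorph1.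
rewrite -[u]res_reprK -[v]res_reprK -rmorphM !res_act_funE.
by rewrite !rmorphM.
Qed.

HB.instance Definition _ g := GRing.isZmodMorphism.Build
  (residue S) (residue S) (res_act_fun g) (res_act_is_zmod_morphism g).
HB.instance Definition _ g := GRing.isMonoidMorphism.Build
  (residue S) (residue S) (res_act_fun g) (res_act_is_monoid_morphism g).

Fact res_act1 : res_act_fun 1%g =1 id.
Proof. by move=> u; rewrite -[u]res_reprK res_act_funE ract1. Qed.

Fact res_actM g h u : res_act_fun (g * h)%g u = res_act_fun g (res_act_fun h u).
Proof. by rewrite -[u]res_reprK !res_act_funE ractM. Qed.

Definition res_action : ring_action gT (residue S) :=
  @RingAction gT (residue S) res_act_fun res_act1 res_actM.

Variable f : cocycle2 a.

Definition res_coc g h : residue S := res (f g h).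

Fact res_coc_unit g h : res_coc g h \is a GRing.unit.
Proof. by rewrite unitfE res_eq0 negbK coc_unit. Qed.
Fact res_coc1g g : res_coc 1%g g = 1.
Proof. by rewrite /res_coc coc1g rmorph1. Qed.
Fact res_cocg1 g : res_coc g 1%g = 1.
Proof. by rewrite /res_coc cocg1 rmorph1. Qed.
Fact res_cocA g h k : res_coc g h * res_coc (g * h)%g k =
  res_action g (res_coc h k) * res_coc g (h * k)%g.
Proof. by rewrite /= res_act_funE -!rmorphM cocA. Qed.

Definition res_cocycle : cocycle2 res_action :=
  Cocycle2 res_coc_unit res_coc1g res_cocg1 res_cocA.

Definition inertia_set : {set gT} := [set g | `[< res_action g =1 id >]].

Fact inertia_group_set : group_set inertia_set.
Proof.
apply/group_setP; split; first by rewrite inE; apply/asboolP/ract1.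
move=> g h; rewrite !inE => /asboolP ag /asboolP ah.
by apply/asboolP => u; rewrite ractM ah ag.
Qed.

Definition inertia : {group gT} := group inertia_group_set.

(* The image in residue S of the fixed ring R; as the kernel of R -> residue  *)
(* S is the intersection of R with maxideal S, this is the residue field of R.*)
Definition res_fixed (u : residue S) : Prop :=
  exists2 r : S, (forall g, a g r = r) & res r = u.

Definition res_fixed_poly (q : {poly residue S}) : Prop :=
  forall i, res_fixed q`_i.

Definition is_min_poly (u : residue S) (q : {poly residue S}) : Prop :=
  [/\ res_fixed_poly q, q \is monic, root q u
    & forall q', res_fixed_poly q' -> q' != 0 -> root q' u ->
        (size q <= size q')%N].

Definition residually_separable : Prop :=
  forall u, exists2 q, is_min_poly u q & separable_poly q.

End Reduction.

Notation res_crossed f H := (subcrossed (res_cocycle f) H).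

(* F^alpha C for C cyclic of order e > 0, with distinguished generator        *)
(* inZp 1 : 'I_e.-1.+1.  When e = 1 one has U_(inZp 1) = U_1 = 1.             *)
Notation cyclic_twist e alphaU := (@cyclic_cocycle _ e.-1 _ alphaU).

(* Main.v *)
(** Let [pi] be a uniformizer of [S] and [k] its residue field; [pi] is a
    normal element of [T], and [T/(pi)] is the reduced crossed product.

    Sufficiency. If the inertial algebra is semisimple then so is [T/(pi)]:
    average projections over [G/G_I], using an element of [k] of nonzero trace.
    If [pi L' <= L <= L'] are left ideals of [T] with [L'] projective, lift a
    complement of [L/pi L'] in [L'/pi L'] to [L''] with [L + L'' = L'] and [L
    cap L'' = pi L']; the surjection from [L (+) L''] to [L'] splits, so [L] is
    projective. A left ideal containing a power of [pi] is thus projective, and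
    averaging over the faithful group [G] shows that each left ideal is a
    direct summand of such a left ideal. Right ideals are left ideals of the
    opposite ring, which is again a crossed product.

    Necessity. For [q = #|P|] the map sending [sum x_g U_g] to [sum x_g^q
    prod_h f(g,h)] is a ring morphism from the twisted group algebra of [P] to
    [k], because [f^q] is a coboundary; its kernel is nilpotent. Let [J] be the
    corresponding ideal of the crossed product [T_P] of [P]. As [T] is
    hereditary, [J] is projective, so that either [J = J^2] modulo [pi], whence
    [J = (pi)], or [J = T_P w] and [pi = t w^m] with [t] a unit. In the latter
    case [w] satisfies a monic equation of degree [q] over [S^P], given by the
    characteristic polynomial of right multiplication by [w]. By residual
    separability [S^P] has residue field [k], which forces [S] to be totally
    ramified over [S^P] of index [q]; the [w]-adic valuations of elements of
    [S^P] are therefore multiples of [q m], and the equation gives [q m <= q],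
    that is [J = (pi)] again. Thus the twisted group algebra of [P] embeds in
    [k] by a map that is [s -> s^q] on scalars, and so it is a purely
    inseparable field [F] over [k]. Conjugation by [U_sigma0] fixes [F], and
    the inertial algebra is [F[x]/(x^e - alpha0)] with [x^e - alpha0]
    separable. *)

From HB Require Import structures.
Require Import Defs.
From mathcomp Require Import all_boot all_algebra all_fingroup all_solvable.
From mathcomp Require Import all_field.
From mathcomp Require Import mxrepresentation mxabelem.
From mathcomp Require boolp classical_sets generic_quotient.

Set Implicit Arguments.
Unset Strict Implicit.
Unset Printing Implicit Defensive.

Import GRing.Theory.
Local Open Scope ring_scope.

(** * Complements and lifting for left ideals *)

Section Complement.
Variables (B : nzRingType) (K : B -> Prop).
Hypothesis ss_modK : forall I : B -> Prop, left_ideal I ->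
  (forall x, K x -> I x) ->
  exists J : B -> Prop, [/\ left_ideal J, forall x, I x -> J x -> K x
    & forall x, exists y z, [/\ I y, J z & x = y + z]].
Variables (V : zmodType) (act : B -> V -> V).
Hypothesis actDr : forall a u v, act a (u + v) = act a u + act a v.
Hypothesis actDl : forall a b v, act (a + b) v = act a v + act b v.
Hypothesis act1 : forall v, act 1 v = v.
Hypothesis actM : forall a b v, act (a * b) v = act a (act b v).

Definition act_closed (L : V -> Prop) : Prop :=
  [/\ L 0, forall x y, L x -> L y -> L (x + y) & forall a x,
    L x -> L (act a x)].

Lemma act_closedB L x y : act_closed L -> L x -> L y -> L (x - y).
Proof.
move=> [L0 LD LZ] Lx Ly; apply: LD => //.
have act0 v : act 0 v = 0 by apply: (addrI (act 0 v)); rewrite -actDl !addr0.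
suff -> : - y = act (- 1) y by apply: LZ.
by apply: (addIr y); rewrite addNr -{2}[y]act1 -actDl addNr act0.
Qed.

(** Zorn's lemma gives [M] maximal among the submodules between [C] and [L'] that meet [L] inside
    [C]. For [w] in [L'] outside [L + M], let [J] be a complement modulo [K] of the ideal of all [a]
    with [a w] in [L + M]. Then [M + J w] is admissible, maximality puts [J w] in [M], and
    [1 = i + j] returns [w] to [L + M]. *)
Lemma act_closed_complement (C L L' : V -> Prop) :
  act_closed C -> act_closed L -> act_closed L' ->
  (forall x, C x -> L x) -> (forall x, L x -> L' x) ->
  (forall a v, K a -> L' v -> C (act a v)) ->
  exists M : V -> Prop, [/\ act_closed M, forall x, C x -> M x,
    forall x, M x -> L' x, forall x, L x -> M x -> C x
    & forall x, L' x -> exists y z, [/\ L y, M z & x = y + z]].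
Proof.
move=> Cc Lc L'c CL LL' KC.
have [C0 CD CZ] := Cc; have [L0 LD LZ] := Lc; have [L'0 L'D L'Z] := L'c.
pose good (M : V -> Prop) := [/\ act_closed M, forall x, C x -> M x,
  forall x, M x -> L' x & forall x, L x -> M x -> C x].
(* [C] is adjoined to [X] because the empty chain has empty union. *)
pose P : classical_sets.set (classical_sets.set V) :=
  fun X => good (fun x => C x \/ X x).
have [|A [Agood Amax]] := @classical_sets.Zorn_bigcup V P.
  move=> F FP Ftot; split.
  - split; first by left.
    + move=> x y [Cx|[X FX Xx]] [Cy|[Y FY Yy]].
      * by left; apply: CD.
      * have [[_ D _] _ _ _] := FP _ FY.
        by case: (D x y (or_introl Cx) (or_intror Yy)); [left|right; exists Y].
      * have [[_ D _] _ _ _] := FP _ FX.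
        by case: (D x y (or_intror Xx) (or_introl Cy)); [left|right; exists X].
      case: (Ftot _ _ FX FY) => sXY.
        have [[_ D _] _ _ _] := FP _ FY.
        by case: (D x y (or_intror (sXY _ Xx)) (or_intror Yy));
          [left|right; exists Y].
      have [[_ D _] _ _ _] := FP _ FX.
      by case: (D x y (or_intror Xx) (or_intror (sXY _ Yy)));
        [left|right; exists X].
    + move=> a x [Cx|[X FX Xx]]; first by left; apply: CZ.
      have [[_ _ D] _ _ _] := FP _ FX.
      by case: (D a x (or_intror Xx)); [left|right; exists X].
  - by left.
  - move=> x [/CL/LL'//|[X FX Xx]]; have [_ _ D _] := FP _ FX.
    by apply: D; right.
  - move=> x Lx [//|[X FX Xx]]; have [_ _ _ D] := FP _ FX.
    by apply: D => //; right.
have [Mc CM ML' LM] := Agood; have [M0 MD MZ] := Mc.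
move: Mc CM ML' LM M0 MD MZ; set M := (fun x => C x \/ A x).
move=> Mc CM ML' LM M0 MD MZ.
exists M; split=> // w L'w; apply: boolp.contrapT => nw.
pose S x := exists y z, [/\ L y, M z & x = y + z].
have SD x y : S x -> S y -> S (x + y).
  move=> [u [v [Lu Mv ->]]] [u' [v' [Lu' Mv' ->]]].
  by exists (u + u'), (v + v'); rewrite addrACA; split; [exact: LD|exact: MD|].
have SZ a x : S x -> S (act a x).
  move=> [u [v [Lu Mv ->]]]; exists (act a u), (act a v).
  by rewrite actDr; split; [exact: LZ|exact: MZ|].
have S0 : S 0 by exists 0, 0; rewrite addr0.
have act0 v : act 0 v = 0 by apply: (addrI (act 0 v)); rewrite -actDl !addr0.
have [||J [[J0 JD JZ] IJ sIJ]] := @ss_modK (fun a => S (act a w)).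
- split; first by rewrite act0.
    by move=> x y Sx Sy; rewrite actDl; apply: SD.
  by move=> a x Sx; rewrite actM; apply: SZ.
- by move=> a Ka; exists 0, (act a w); rewrite add0r; split=> //; left;
    apply: KC.
pose M' x := exists m j, [/\ M m, J j & x = m + act j w].
have MM' x : M x -> M' x by move=> Mx; exists x, 0; rewrite act0 addr0.
apply: (Amax M').
  split=> [x Ax|sM'A]; first by apply: MM'; right.
  have [i [j [Si Jj e1]]] := sIJ 1; apply: nw.
  have [u [v [Lu Mv eu]]] := Si.
  have Mj : M (act j w).
    by right; apply: sM'A; exists 0, j; rewrite add0r.
  exists u, (v + act j w); split=> //; first exact: MD.
  by rewrite addrA -eu -actDl -e1 act1.
have M'C : classical_sets.subset (fun x => C x \/ M' x) M'.
  by move=> x [/CM/MM'|].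
have M'c : act_closed M'.
  split; first exact: MM'.
    move=> _ _ [m [j [Mm Jj ->]]] [m' [j' [Mm' Jj' ->]]].
    by exists (m + m'), (j + j'); rewrite addrACA actDl; split;
      [exact: MD|exact: JD|].
  move=> a _ [m [j [Mm Jj ->]]]; exists (act a m), (a * j).
  by rewrite actDr actM; split; [exact: MZ|exact: JZ|].
split.
- split; first by left.
    by move=> x y /M'C Mx /M'C My; right; case: M'c => _ D _; apply: D.
  by move=> a x /M'C Mx; right; case: M'c => _ _; apply.
- by left.
- move=> x /M'C[m [j [Mm Jj ->]]]; apply: L'D; first exact: ML'.
  exact: L'Z.
(* For [x = m + j w] in [L], the multiplier [j] lies both in the ideal and in [J], hence in [K], so
   [j w] is in [C]. *)
- move=> x Lx /M'C[m [j [Mm Jj ex]]].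
  have Ij : S (act j w).
    exists x, (- m); split=> //; last by rewrite ex addrAC subrr add0r.
    by rewrite -sub0r; apply: act_closedB.
  have Cj : C (act j w) by apply: KC => //; apply: IJ.
  apply: LM => //; rewrite ex; apply: MD => //; exact: CM.
Qed.

End Complement.

Section Lifting.

Definition semilinear_on (A B : nzRingType) (tau : A -> B) (M : lmodType B)
    (L : A -> Prop) (h : A -> M) : Prop :=
  forall a x y, L x -> L y -> h (a * x + y) = tau a *: h x + h y.

(* Projectivity of a left ideal L, without bundling L as a module: the maps   *)
(* are semilinear so that the property can be transported along ring          *)
(* isomorphisms, such as conjugation by a normal element.                     *)
Definition lifts (A : nzRingType) (L : A -> Prop) : Prop :=
  forall (B : nzRingType) (tau : {rmorphism A -> B}) (M N : lmodType B)
    (g : {linear M -> N}) (M0 : M -> Prop) (h : A -> N),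
  M0 0 -> (forall b x y, M0 x -> M0 y -> M0 (b *: x + y)) ->
  semilinear_on tau L h ->
  (forall x, L x -> exists2 m, M0 m & g m = h x) ->
  exists h' : A -> M, [/\ semilinear_on tau L h', forall x, L x -> M0 (h' x)
    & forall x, L x -> g (h' x) = h x].

Lemma semilinear_on0 (A B : nzRingType) (tau : {rmorphism A -> B})
    (M : lmodType B) (L : A -> Prop) (h : A -> M) :
  left_ideal L -> semilinear_on tau L h -> h 0 = 0.
Proof.
case=> L0 _ _ hL; apply: (addrI (h 0)); rewrite addr0.
by have := hL 1 0 0 L0 L0; rewrite mul1r addr0 rmorph1 scale1r.
Qed.

Variable A : nzRingType.
Implicit Types L I : A -> Prop.

Lemma left_idealB L x y : left_ideal L -> L x -> L y -> L (x - y).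
Proof.
by case=> _ LD LM Lx Ly; apply: LD => //; rewrite -mulN1r; apply: LM.
Qed.

Lemma left_idealMD L a x y : left_ideal L -> L x -> L y -> L (a * x + y).
Proof. by case=> _ LD LM Lx Ly; apply: LD => //; apply: LM. Qed.

Lemma lifts_setT : lifts (fun _ : A => True).
Proof.
move=> B tau M N g M0 h M00 M0Z hlin gh.
have [m M0m gm] := gh 1 I.
exists (fun x => tau x *: m); split.
- by move=> a x y _ _; rewrite rmorphD rmorphM scalerDl scalerA.
- by move=> x _; rewrite -[_ *: _]addr0; apply: M0Z.
move=> x _; rewrite linearZ gm /=.
have := hlin x 1 0 Logic.I Logic.I; rewrite mulr1 addr0 => ->.
by rewrite (@semilinear_on0 _ _ tau _ (fun=> True)) ?addr0.
Qed.

Lemma lifts_ext L L' : (forall x, L x <-> L' x) -> lifts L -> lifts L'.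
Proof.
move=> LL' Lp B tau M N g M0 h M00 M0Z hlin gh.
have [||h' [h1 h2 h3]] := Lp B tau M N g M0 h M00 M0Z.
- by move=> a x y /LL' ? /LL'; apply: hlin.
- by move=> x /LL'; apply: gh.
exists h'; split=> [a x y /LL' Lx /LL'|x /LL'|x /LL']; first exact: h1.
  exact: h2.
exact: h3.
Qed.

(** A problem over [L] extends to [L + I] by precomposing with the projection [pr] along [I]. *)
Lemma lifts_summand L I : left_ideal L -> left_ideal I ->
  (forall x, L x -> I x -> x = 0) ->
  lifts (fun x => exists y z, [/\ L y, I z & x = y + z]) -> lifts L.
Proof.
move=> Lid Iid LI0; set S := (fun x => _) =>
  Sp B tau M N g M0 h M00 M0Z hlin gh.
have [L0 _ _] := Lid; have [I0 _ _] := Iid.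
have [pr prP] : exists pr : A -> A, forall x, S x -> L (pr x) /\ I (x - pr x).
  suff : forall x, exists y,
    S x -> L y /\ I (x - y) by move=> /boolp.choice[s sP]; exists s.
  move=> x; have [[y [z [Ly Iz ->]]]|nS] := boolp.EM (S x).
    by exists y => _; rewrite addrAC subrr add0r.
  by exists 0 => /nS.
have prD x y : L y -> I (x - y) -> pr x = y.
  move=> Ly Ixy; have [|Lp Ip] := prP x.
    by exists y, (x - y); rewrite addrCA subrr addr0.
  apply/eqP; rewrite -subr_eq0; apply/eqP; apply: LI0; first exact: left_idealB.
  suff -> : pr x - y = (x - y) - (x - pr x) by apply: left_idealB.
  by rewrite opprB [RHS]addrC addrA subrK.
have prM a x y : S x -> S y -> pr (a * x + y) = a * pr x + pr y.
  move=> /prP[Lx Ix] /prP[Ly Iy]; apply: prD; first exact: left_idealMD.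
  by rewrite opprD addrACA -mulrBr; apply: left_idealMD.
have [||h' [h1 h2 h3]] := Sp B tau M N g M0 (h \o pr) M00 M0Z.
- by move=> a x y Sx Sy /=; rewrite prM // hlin //;
    [case: (prP _ Sx)|case: (prP _ Sy)].
- by move=> x Sx; apply: gh; case: (prP _ Sx).
have LS x : L x -> S x by move=> Lx; exists x, 0; rewrite addr0.
exists h'; split=> [a x y /LS Lx /LS|x /LS|x Lx]; first exact: h1.
  exact: h2.
by rewrite h3 /= ?(prD x x) ?subrr //; apply: LS.
Qed.

(** Passes from predicates on [A] to bundled modules over [C]: the image of the embedding [i] is
    pulled back along [phi] to a left ideal of [A], and the lift is semilinear over [phi]. *)
Lemma lifts_left_hereditary (C : nzRingType) (phi : {rmorphism A -> C}) :
  bijective phi -> (forall L, left_ideal L -> lifts L) -> left_hereditary C.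
Proof.
move=> [psi phiK psiK] liftsA I i inj_i M N g h gsurj.
pose L x := exists u, i u = phi x.
have LA : left_ideal L.
  split; first by exists 0; rewrite linear0 rmorph0.
    by move=> x y [u ux] [v vy]; exists (u + v);
      rewrite linearD /= ux vy rmorphD.
  by move=> a x [u ux]; exists (phi a *: u); rewrite linearZ /= ux rmorphM.
have [e eP] : exists e : A -> I, forall x, L x -> i (e x) = phi x.
  suff : forall x, exists u, L x -> i u = phi x by move=> /boolp.choice[s sP];
    exists s.
  move=> x; have [[u ux]|nL] := boolp.EM (L x); first by exists u.
  by exists 0 => /nL.
have eD a x y : L x -> L y -> e (a * x + y) = phi a *: e x + e y.
  move=> Lx Ly; apply: inj_i; rewrite eP; last exact: left_idealMD.
  by rewrite linearD linearZ /= !eP // rmorphD rmorphM.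
have [||||h' [h1 h2 h3]] :=
    liftsA L LA C phi M N g (fun=> True) (h \o e).
- by [].
- by [].
- by move=> a x y Lx Ly /=; rewrite eD // linearD linearZ.
- by move=> x Lx; have [m] := gsurj (h (e x)); exists m.
have Li u : L (psi (i u)) by exists u; rewrite psiK.
pose f u := h' (psi (i u)).
have flin : linear f.
  move=> c u v; rewrite /f -{2}[c]psiK -h1 //; congr h'.
  by apply: (can_inj phiK); rewrite psiK rmorphD rmorphM !psiK linearD linearZ.
pose fL := GRing.isLinear.Build C I M *:%R f flin.
exists (HB.pack_for {linear I -> M} f fL) => x /=.
rewrite h3 //=; congr (h _).
by apply: inj_i; rewrite eP // psiK.
Qed.

Section NormalElement.
Variable p : A.
Hypothesis pI : forall x y, p * x = p * y -> x = y.
Hypothesis Ip : forall x y, x * p = y * p -> x = y.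
Hypothesis pA : forall a, exists b, p * a = b * p.
Hypothesis Ap : forall a, exists b, a * p = p * b.

(** Left multiplication by [p] identifies [L] with [p L] up to the automorphism [nu] given by
    [p a = nu(a) p], so a lifting problem over [p L] becomes one over [L] with [tau] twisted by
    [nu]. *)
Lemma lifts_mull L : left_ideal L -> lifts L ->
  lifts (fun x => exists2 y, L y & x = p * y).
Proof.
move=> Lid Lp B tau M N g M0 h M00 M0Z hlin gh.
have [nu nuP] := boolp.choice pA; have [nu' nu'P] := boolp.choice Ap.
have nuK a : nu (nu' a) = a by apply: Ip; rewrite -nuP nu'P.
have nuA : zmod_morphism nu.
  by move=> x y; apply: Ip; rewrite mulrBl -!nuP mulrBr.
have nuM : monoid_morphism nu.
  split=> [|x y]; apply: Ip; first by rewrite -nuP mul1r mulr1.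
  by rewrite -nuP -mulrA -nuP mulrA nuP !mulrA.
pose nuR := HB.pack_for {rmorphism A -> A} nu
  (GRing.isZmodMorphism.Build _ _ nu nuA)
  (GRing.isMonoidMorphism.Build _ _ nu nuM).
pose tau' : {rmorphism A -> B} := tau \o nuR.
have [||h' [h1 h2 h3]] := Lp B tau' M N g M0 (fun x => h (p * x)) M00 M0Z.
- move=> a x y Lx Ly /=; rewrite mulrDr mulrA nuP -mulrA hlin //.
    by exists x.
  by exists y.
- by move=> x Lx; apply: gh; exists x.
have [q qP] : exists q : A -> A, forall y, q (p * y) = y.
  suff /boolp.choice[q qP] : forall x, exists y, forall y',
    x = p * y' -> y' = y.
    by exists q => y; apply/esym/qP.
  move=> x; have [[y ->]|ny] := boolp.EM (exists y, x = p * y).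
    by exists y => y' /pI.
  by exists 0 => y' e; case: ny; exists y'.
exists (h' \o q); split.
- move=> a _ _ [x Lx ->] [y Ly ->] /=.
  by rewrite mulrA nu'P -mulrA -mulrDr !qP h1 //= nuK.
- by move=> _ [x Lx ->] /=; rewrite qP; apply: h2.
- by move=> _ [x Lx ->] /=; rewrite qP h3.
Qed.

Lemma left_ideal_mull L : left_ideal L ->
  left_ideal (fun x => exists2 y, L y & x = p * y).
Proof.
case=> L0 LD LM; split; first by exists 0; rewrite ?mulr0.
  by move=> _ _ [x Lx ->] [y Ly ->]; exists (x + y); rewrite ?mulrDr //;
    apply: LD.
move=> a _ [x Lx ->]; have [b eb] := Ap a.
by exists (b * x); rewrite ?mulrA ?eb //; apply: LM.
Qed.

Hypothesis ss_modp : forall I, left_ideal I ->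
  (forall x, (exists b, x = p * b) -> I x) ->
  exists J : A -> Prop, [/\ left_ideal J,
    forall x, I x -> J x -> exists b, x = p * b
    & forall x, exists y z, [/\ I y, J z & x = y + z]].

(* If L + L'' = L' and L cap L'' = p L', then the resulting exact sequence    *)
(* 0 -> p L' -> L (+) L'' -> L' -> 0 splits, and L is a summand of            *)
(* p L' (+) L'.                                                               *)
Lemma lifts_between L L' : left_ideal L -> left_ideal L' ->
  (forall x, L x -> L' x) -> (forall x, L' x -> L (p * x)) ->
  lifts L' -> lifts L.
Proof.
move=> Lid L'id LL' pL'L L'p.
have pL'id := left_ideal_mull L'id.
have [|||M [Mid CM ML' LM LML']] :=
  act_closed_complement ss_modp (act := *%R) (@mulrDr A) (@mulrDl A) (@mul1r A)
    (fun a b v => esym (mulrA a b v)) pL'id Lid L'id.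
- by move=> _ [x Lx ->]; apply: pL'L.
- exact: LL'.
- move=> _ v [b ->] L'v; exists (b * v); rewrite ?mulrA //.
  by have [_ _] := L'id; apply.
(* Lifting the identity of [L'] through the sum map from [L (+) M] gives a section [s]. *)
have [||||s [s1 s2 s3]] := L'p A idfun (A^o * A^o)%type A^o
  (fst \+ snd) (fun u => L u.1 /\ M u.2) id.
- by split; [case: Lid|case: Mid].
- move=> b [x1 x2] [y1 y2] /= [? ?] [? ?].
  by split; apply: left_idealMD.
- by [].
- by move=> x /LML'[y [z [Ly Mz ->]]]; exists (y, z).
have pL'x x : L x -> exists2 y, L' y & x - (s x).1 = p * y.
  move=> Lx; have L'x := LL' _ Lx; have [Lx1 Mx2] := s2 _ L'x.
  apply: LM; first exact: left_idealB.
  suff -> : x - (s x).1 = (s x).2 by [].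
  by rewrite -{1}(s3 _ L'x) /= addrAC subrr add0r.
have pL'p := lifts_mull L'id L'p.
move=> B tau W N g M0 h M00 M0Z hlin gh.
have [||h1 [h11 h12 h13]] := L'p B tau W N g M0 (fun x => h (s x).1) M00 M0Z.
- move=> a x y L'x L'y; rewrite s1 //= hlin //; first by case: (s2 _ L'x).
  by case: (s2 _ L'y).
- by move=> x L'x; apply: gh; case: (s2 _ L'x).
have [||h2 [h21 h22 h23]] := pL'p B tau W N g M0 h M00 M0Z.
- by move=> a _ _ [x Lx ->] [y Ly ->]; apply: hlin; apply: pL'L.
- by move=> _ [x Lx ->]; apply: gh; apply: pL'L.
(* [x] is the sum of [x - (s x).1], in [p L'], and [(s x).1]; [h2] lifts the first summand and [h1]
   the second. *)
exists (fun x => h2 (x - (s x).1) + h1 x); split.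
- move=> a x y Lx Ly; rewrite s1 ?h11 /=; try exact: LL'.
  rewrite opprD addrACA -mulrBr h21; try exact: pL'x.
  by rewrite scalerDr addrACA.
- move=> x Lx; rewrite -[h2 _]scale1r; apply: M0Z; first exact/h22/pL'x.
  exact/h12/LL'.
- move=> x Lx; rewrite linearD h23 ?h13; [|exact: LL'|exact: pL'x].
  have [y L'y ey] := pL'x _ Lx.
  rewrite -[h (x - _)]scale1r -(rmorph1 tau) -hlin ?mul1r ?subrK //.
    by rewrite ey; apply: pL'L.
  by have [] := s2 _ (LL' _ Lx).
Qed.

(** The ideals [E k = S + A p^k], with [S = L + I], descend from [A] to [S], as [p^N] lies in [S].
    Since [p E_k <= E_(k+1) <= E_k], [lifts_between] carries the lifting property down to [S], of
    which [L] is a summand. *)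
Lemma lifts_left_ideal :
  (forall L, left_ideal L -> exists I N, [/\ left_ideal I,
     forall x, L x -> I x -> x = 0
     & exists y z, [/\ L y, I z & p ^+ N = y + z]]) ->
  forall L, left_ideal L -> lifts L.
Proof.
move=> compl L Lid; have [I [N [Iid LI0 [y0 [z0 [Ly0 Iz0 ep]]]]]] :=
  compl L Lid.
apply: (lifts_summand Lid Iid LI0).
have [L0 LD LM] := Lid; have [I0 ID IM] := Iid.
set S := (fun x => _).
have Sid : left_ideal S.
  split; first by exists 0, 0; rewrite addr0.
    move=> _ _ [y [z [Ly Iz ->]]] [y' [z' [Ly' Iz' ->]]].
    by exists (y + y'), (z + z'); rewrite addrACA; split;
      [exact: LD|exact: ID|].
  move=> a _ [y [z [Ly Iz ->]]].
  by exists (a * y), (a * z); rewrite mulrDr; split; [exact: LM|exact: IM|].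
pose E k x := exists s a, S s /\ x = s + a * p ^+ k.
have [S0 SD SM] := Sid.
have Eid k : left_ideal (E k).
  split; first by exists 0, 0; rewrite mul0r addr0.
    move=> _ _ [s [a [Ss ->]]] [s' [a' [Ss' ->]]].
    by exists (s + s'), (a + a'); rewrite mulrDl addrACA; split=> //; apply: SD.
  move=> b _ [s [a [Ss ->]]].
  by exists (b * s), (b * a); rewrite mulrDr mulrA; split=> //; apply: SM.
apply: (@lifts_ext (E N)) => [x|].
  split=> [[s [a [Ss ->]]]|Sx]; last by exists x, 0; rewrite mul0r addr0.
  by apply: SD => //; apply: SM; exists y0, z0.
elim: N {ep} => [|k IHk].
  apply: (@lifts_ext (fun=> True)) lifts_setT => x; split=> // _.
  by exists 0, x; rewrite mulr1 add0r.
apply: (lifts_between (Eid _) (Eid k)) IHk.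
  move=> _ [s [a [Ss ->]]]; exists s, (a * p); split=> //.
  by rewrite exprS mulrA.
move=> _ [s [a [Ss ->]]]; have [b eb] := pA a.
exists (p * s), b; split; first exact: SM.
by rewrite mulrDr mulrA eb exprS mulrA.
Qed.

End NormalElement.
End Lifting.

(** * Averaging in crossed products *)

(** Dedekind's shortening: when [c i] and [c j] are nonzero, the relation at [x y] minus [chi j y]
    times the relation at [x] loses the term [j] and, for suitable [y], keeps the term [i]. *)
Lemma dedekind_independence (I : finType) (S : idomainType)
    (chi : I -> {rmorphism S -> S}) :
  (forall i j, chi i =1 chi j -> i = j) ->
  forall c : I -> S, (forall x, \sum_i c i * chi i x = 0) -> forall i, c i = 0.
Proof.
move=> chi_inj c; have [n] := ubnP #|[pred i | c i != 0]|.
elim: n c => // n IHn c /ltnSE le_n c0 i; apply/eqP/negPn/negP => ci.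
have [/existsP[j /andP[ij cj]]|] := boolP [exists j, (i != j) && (c j != 0)].
  have [y yP] : exists y, chi i y != chi j y.
    apply: boolp.contrapT => ny; case/eqP: ij; apply: chi_inj => y.
    by apply/eqP/negPn/negP => nyy; apply: ny; exists y.
  suff /(_ i)/eqP : forall l, c l * (chi l y - chi j y) = 0.
    by rewrite mulf_eq0 (negPf ci) subr_eq0 (negPf yP).
  apply: IHn.
    apply: leq_trans le_n; apply: proper_card; apply/properP; split.
      by apply/subsetP => l; rewrite !inE mulf_eq0 negb_or => /andP[].
    by exists j; rewrite !inE // subrr mulr0 eqxx.
  move=> x; have := c0 (x * y); have := c0 x.
  move=> /(congr1 ( *%R (chi j y))); rewrite mulr0 mulr_sumr => e1 e2.
  transitivity (\sum_l c l * chi l (x * y) - \sum_l chi j y * (c l * chi l x)).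
    2: by rewrite e1 e2 subr0.
  rewrite -sumrB; apply: eq_bigr => l _.
  rewrite rmorphM mulrBr mulrBl; congr (_ - _); last by rewrite mulrAC mulrC.
  by rewrite -!mulrA; congr (_ * _); rewrite mulrC.
rewrite negb_exists => /forallP nj.
have := c0 1; rewrite (bigD1 i) //= big1 => [|l li].
  by rewrite rmorph1 mulr1 addr0; apply/eqP.
by have := nj l; rewrite eq_sym li negbK => /eqP ->; rewrite mul0r.
Qed.

(** * Uniformizers and factorization in a discrete valuation ring *)

Section Uniformizer.
Variable S : dvrType.

Lemma uniformizer_exists : exists pi : S,
  [/\ pi != 0, pi \isn't a GRing.unit
    & forall x, x \isn't a GRing.unit -> exists y, x = y * pi].
Proof.
have [|pi piP] := @dvr_principal S (fun x => x \isn't a GRing.unit).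
  split; first by rewrite unitr0.
    exact: dvr_local.
  by move=> a x; rewrite unitrM negb_and => ->; rewrite orbT.
exists pi; split; last by move=> x /piP.
  have [x x0 /piP[b xE]] := @dvr_nonfield S.
  by apply: contraNneq x0 => pi0; rewrite xE pi0 mulr0.
by apply/piP; exists 1; rewrite mul1r.
Qed.

Definition uniformizer : S := projT1 (boolp.cid uniformizer_exists).
Local Notation pi := uniformizer.

Lemma uniformizer_neq0 : pi != 0.
Proof. by have [] := projT2 (boolp.cid uniformizer_exists). Qed.

Lemma uniformizer_nonunit : pi \isn't a GRing.unit.
Proof. by have [] := projT2 (boolp.cid uniformizer_exists). Qed.

Lemma nonunitP (x : S) : x \isn't a GRing.unit <-> exists y, x = y * pi.
Proof.
split=> [|[y ->]]; first by have [_ _] :=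
  projT2 (boolp.cid uniformizer_exists); apply.
by rewrite unitrM negb_and uniformizer_nonunit orbT.
Qed.

(** Krull's intersection argument: the ideal of all such [x] has a generator [c = c' p], and [c'] is
    again in the ideal, so [c = b c p]; a nonzero [c] would make [p] a unit. *)
Lemma divisible_by_powers_eq0 (p x : S) : p \isn't a GRing.unit ->
  (forall n, exists y, x = y * p ^+ n) -> x = 0.
Proof.
move=> pN xn.
have [|c cP] := @dvr_principal S (fun x => forall n, exists y, x = y * p ^+ n).
  split; first by exists 0; rewrite mul0r.
    by move=> u v un vn n; have [[y ->] [z ->]] := (un n, vn n);
      exists (y + z); rewrite mulrDl.
  by move=> a u un n; have [y ->] := un n; exists (a * y); rewrite mulrA.
have cn : forall n, exists y, c = y * p ^+ n by apply/cP; exists 1;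
  rewrite mul1r.
suff c0 : c = 0 by have [b ->] := (cP x).1 xn; rewrite c0 mulr0.
apply/eqP/negPn/negP => c0.
have [c' c'E] := cn 1%N; rewrite expr1 in c'E.
have p0 : p != 0 by apply: contraNneq c0 => p0; rewrite c'E p0 mulr0.
have [|b bE] := (cP c').1.
  move=> n; have [y yE] := cn n.+1; exists y; apply: (mulIf p0).
  by rewrite -c'E yE exprSr mulrA.
case/negP: pN; apply/unitrPr; exists b; apply: (mulIf c0).
by rewrite mul1r -mulrA -bE mulrC -c'E.
Qed.

Lemma dvr_factor (x : S) : x != 0 ->
  exists u n, u \is a GRing.unit /\ x = u * pi ^+ n.
Proof.
move=> x0; have [n nP] : exists n, ~ exists y, x = y * pi ^+ n.
  apply/boolp.existsNP => xn; case/eqP: x0.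
  exact: (divisible_by_powers_eq0 uniformizer_nonunit).
elim: n nP => [[]|n IHn nP]; first by exists x; rewrite mulr1.
have [[y yE]|/IHn//] := boolp.EM (exists y, x = y * pi ^+ n).
exists y, n; split=> //; apply/negPn/negP => /nonunitP[z zE].
by apply: nP; exists z; rewrite exprS mulrA -zE.
Qed.
End Uniformizer.

Lemma fraction_clear (R : idomainType) (x : {fraction R}) :
  exists d n : R, d != 0 /\ tofrac d * x = tofrac n.
Proof.
exists (generic_quotient.repr x).2, (generic_quotient.repr x).1.
split; first exact: denom_ratioP.
rewrite -{2}[x]generic_quotient.reprK.
set r := generic_quotient.repr x.
have d0 : r.2 != 0 by apply: denom_ratioP.
apply/eqP; rewrite -[_ * _]/(FracField.mul _ _) !generic_quotient.piE /=.
rewrite /FracField.equivf /FracField.mulf.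
by rewrite !numden_Ratio ?oner_neq0 ?mul1r ?mulr1.
Qed.

Section CrossedLemmas.
Variables (gT : finGroupType) (A : comUnitRingType) (a : ring_action gT A).
Variable f : cocycle2 a.
Implicit Types (x y : crossed f) (g h : gT).

Lemma ractK g : cancel (a g) (a g^-1%g).
Proof. by move=> x; rewrite -ractM mulVg ract1. Qed.

Lemma ractKV g : cancel (a g^-1%g) (a g).
Proof. by move=> x; rewrite -ractM mulgV ract1. Qed.

Lemma crossedME x y k :
  (x * y) k = \sum_g x g * a g (y (g^-1 * k)%g) * f g (g^-1 * k)%g.
Proof. by rewrite ffunE. Qed.

Lemma crUD s t g : crU f (s + t) g = crU f s g + crU f t g.
Proof. by apply/ffunP => k; rewrite !ffunE; case: eqP; rewrite ?addr0. Qed.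

Lemma crU0 g : crU f 0 g = 0.
Proof. by apply/ffunP => k; rewrite !ffunE if_same. Qed.

Lemma crU_mulE s g x k :
  (crU f s g * x) k = s * a g (x (g^-1 * k)%g) * f g (g^-1 * k)%g.
Proof.
rewrite crossedME (bigD1 g) //= big1 => [|h /negPf hg].
  by rewrite ffunE eqxx addr0.
by rewrite ffunE hg !mul0r.
Qed.

Lemma crU1_mulE s x k : (crU f s 1%g * x) k = s * x k.
Proof. by rewrite crU_mulE invg1 mul1g ract1 coc1g mulr1. Qed.

Lemma mul_crU1E s x k : (x * crU f s 1%g) k = x k * a k s.
Proof.
rewrite crossedME (bigD1 k) //= big1 => [|h /negPf hk].
  by rewrite mulVg ffunE eqxx cocg1 addr0 mulr1.
by rewrite ffunE -eq_mulVg1 hk rmorph0 mulr0 mul0r.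
Qed.

Lemma crU1M s t : crU f s 1%g * crU f t 1%g = crU f (s * t) 1%g.
Proof. by rewrite crUM ract1 cocg1 mulr1 mulg1. Qed.

Lemma crU1X s n : crU f s 1%g ^+ n = crU f (s ^+ n) 1%g.
Proof. by elim: n => [//|n IHn]; rewrite exprS IHn crU1M -exprS. Qed.

Lemma crU_split s g : crU f s g = crU f s 1%g * crU f 1 g.
Proof. by rewrite crUM mul1g coc1g rmorph1 !mulr1. Qed.

Lemma crU_rinv s g : s \is a GRing.unit ->
  exists2 t, t \is a GRing.unit & crU f s g * crU f t g^-1%g = 1.
Proof.
move=> sU; exists (a g^-1%g (s * f g g^-1%g)^-1).
  by rewrite rmorph_unit // unitrV unitrM sU coc_unit.
rewrite crUM mulgV ractKV mulrAC divrr //.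
by rewrite unitrM sU coc_unit.
Qed.

Lemma crU_inv s g : s \is a GRing.unit ->
  exists t, [/\ t \is a GRing.unit, crU f s g * crU f t g^-1%g = 1
    & crU f t g^-1%g * crU f s g = 1].
Proof.
move=> sU; have [t tU st] := crU_rinv g sU; exists t; split=> //.
have [s' s'U ts'] := crU_rinv g^-1%g tU.
suff -> : crU f s g = crU f s' g^-1^-1%g by [].
by rewrite -[LHS]mulr1 -ts' mulrA st mul1r.
Qed.

End CrossedLemmas.

Section Averaging.
Variables (gT : finGroupType) (A : idomainType) (a : ring_action gT A).
Variables (f : cocycle2 a) (H : {group gT}).
Hypothesis ker_a : forall g, g \in H <-> a g =1 id.
Local Notation T := (crossed f).

Fact ker_norm g : g \in ('N(H))%g.
Proof.
apply/normP/setP => h; rewrite mem_conjg; apply/idP/idP => /ker_a ah.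
  apply/ker_a => x; have := ah (a g x).
  by rewrite conjgE invgK !ractM ractK => /(can_inj (ractK a g)).
by apply/ker_a => x; rewrite conjgE invgK !ractM ah ractKV.
Qed.

Lemma coset_eq_ker g h : coset H g = coset H h -> (h^-1 * g)%g \in H.
Proof.
move=> egh; apply: coset_idr; rewrite ?ker_norm //.
rewrite coset_morphM ?ker_norm // egh -coset_morphM ?ker_norm //.
by rewrite mulVg coset_id ?group1.
Qed.

Variables (p0 : T -> T).
Hypothesis p0D : forall x y, p0 (x + y) = p0 x + p0 y.
Hypothesis p0H : forall s h x, h \in H -> p0 (crU f s h * x) = crU f s h * p0 x.

(** [v'] is meant to be the inverse of [v], so this is the conjugate by [v] of [p0] followed by
    multiplication by [y]. *)
Definition conj_map (v v' : T) (y : A) (w : T) : T :=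
  v * crU f y 1%g * p0 (v' * w).

(** Changing the representative of a coset inserts a monomial supported in [H]; it passes through
    [p0] by [p0H], and through the scalar [y] because [H] acts trivially. *)
Lemma conj_mapE s t s' t' g g' y w :
  s \is a GRing.unit -> s' \is a GRing.unit -> coset H g = coset H g' ->
  crU f s g * crU f t g^-1%g = 1 -> crU f t g^-1%g * crU f s g = 1 ->
  crU f s' g' * crU f t' g'^-1%g = 1 -> crU f t' g'^-1%g * crU f s' g' = 1 ->
  conj_map (crU f s g) (crU f t g^-1%g) y w
  = conj_map (crU f s' g') (crU f t' g'^-1%g) y w.
Proof.
move=> sU s'U egg' e1 e2 e3 e4.
have hH := coset_eq_ker egg'.
set v := crU f s g in e1 e2 *; set v' := crU f t _ in e1 e2 *.
set u := crU f s' g' in e3 e4 *; set u' := crU f t' _ in e3 e4 *.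
have [c cE] : exists c, u' * v = crU f c (g'^-1 * g)%g by rewrite crUM; eexists.
have p0c x : p0 (u' * v * x) = u' * v * p0 x by rewrite cE p0H.
have comm : u' * v * crU f y 1%g = crU f y 1%g * (u' * v).
  rewrite cE; apply/ffunP => k; rewrite crU1_mulE mul_crU1E !ffunE.
  case: eqP => [->|_]; last by rewrite mul0r mulr0.
  by have /ker_a -> := hH; rewrite mulrC.
rewrite /conj_map -[v]mul1r -e3 -!mulrA; congr (_ * _); rewrite !mulrA comm.
rewrite -!mulrA [u' * (_ * _)]mulrA -p0c; congr (_ * p0 _).
by rewrite !mulrA -(mulrA u') e1 mulr1.
Qed.

Definition unitinv (g : gT) : A := projT1 (boolp.cid (crU_inv f g (unitr1 A))).

Lemma unitinvP g : crU f 1 g * crU f (unitinv g) g^-1%g = 1 /\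
  crU f (unitinv g) g^-1%g * crU f 1 g = 1.
Proof. by have [] := projT2 (boolp.cid (crU_inv f g (unitr1 A))). Qed.

Definition average (y : A) (w : T) : T :=
  \sum_(q : coset_of H)
     conj_map (crU f 1 (repr q)) (crU f (unitinv (repr q)) (repr q)^-1%g) y w.

Lemma averageD y x z : average y (x + z) = average y x + average y z.
Proof.
rewrite /average -big_split; apply: eq_bigr => q _.
by rewrite /conj_map mulrDr p0D mulrDr.
Qed.

Lemma repr_mulg g (q : coset_of H) :
  coset H (repr (coset H g * q)%g) = coset H (g * repr q)%g.
Proof. by rewrite coset_reprK coset_morphM ?ker_norm // coset_reprK. Qed.

(** Left multiplication by [g] permutes the cosets of [H], and [conj_mapE] absorbs the change of
    representatives. *)
Lemma average_crU y s g x : s \is a GRing.unit ->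
  average y (crU f s g * x) = crU f s g * average y x.
Proof.
move=> sU; have [t [tU st ts]] := crU_inv f g sU.
rewrite /average mulr_sumr (reindex_inj (mulgI (coset H g))) /=.
apply: eq_bigr => q _; have [e1 e2] := unitinvP (repr q).
set d := s * a g 1 * f g (repr q).
have dU : d \is a GRing.unit by rewrite !unitrM sU rmorph1 unitr1 coc_unit.
have [c [cU dc cd]] := crU_inv f (g * repr q) dU.
have [e3 e4] := unitinvP (repr (coset H g * q)%g).
rewrite (conj_mapE y _ (unitr1 A) dU (repr_mulg g q) e3 e4 dc cd).
have dE : crU f d (g * repr q)%g = crU f s g * crU f 1 (repr q) by rewrite crUM.
have cE : crU f c (g * repr q)^-1%g =
    crU f (unitinv (repr q)) (repr q)^-1%g * crU f t g^-1%g.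
  rewrite -[LHS]mulr1 -[in LHS]st -[in LHS](mulr1 (crU f s g)) -[in LHS]e1.
  by rewrite -!mulrA [crU f s g * (_ * _)]mulrA -dE !mulrA cd mul1r.
by rewrite /conj_map dE cE -!mulrA [crU f t _ * (_ * _)]mulrA ts mul1r.
Qed.

(** Scalars are treated separately since [s] may be a nonunit: it crosses the inverse of each [U_g],
    commutes with [p0], and crosses [U_g] back to [s]. *)
Lemma averageZ y s x : average y (crU f s 1%g * x) = crU f s 1%g * average y x.
Proof.
rewrite /average mulr_sumr; apply: eq_bigr => q _; rewrite /conj_map.
set g := repr q; have [e1 e2] := unitinvP g.
have -> : crU f (unitinv g) g^-1%g * (crU f s 1%g * x) =
  crU f (a g^-1%g s) 1%g * (crU f (unitinv g) g^-1%g * x).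
  rewrite !mulrA; congr (_ * x).
  by apply/ffunP => k; rewrite crU1_mulE mul_crU1E !ffunE; case: eqP => [->|_];
    rewrite ?mul0r ?mulr0 // mulrC.
rewrite p0H ?group1 // !mulrA; congr (_ * _).
rewrite -mulrA crU1M; apply/ffunP => k.
rewrite !mul_crU1E crU1_mulE !ffunE.
case: eqP => [->|_]; last by rewrite !(mulr0, mul0r).
by rewrite !(mul1r, mulr1) rmorphM ractKV mulrC.
Qed.

Lemma averageM y z x : average y (z * x) = z * average y x.
Proof.
have a0 : average y 0 = 0.
  by apply: (addrI (average y 0)); rewrite -averageD !addr0.
rewrite [z]cr_sumU !mulr_suml (big_morph (average y) (averageD y) a0).
apply: eq_bigr => g _; rewrite crU_split -!mulrA averageZ.
by rewrite average_crU ?unitr1.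
Qed.

Variables (I : T -> Prop) (D : A).
Hypotheses (Iid : left_ideal I) (p0I : forall x, I (p0 x)) (D0 : D != 0).
Hypothesis p0D_I : forall x, I x -> p0 x = crU f D 1%g * x.

Lemma average_in y x : I (average y x).
Proof.
have [I0 ID IM] := Iid; rewrite /average.
by elim/big_rec: _ => // q z _ Iz; apply: ID => //; apply: IM.
Qed.

(** Since [p0] is multiplication by [D] on [I], the average acts there through the trace of [y D]
    over the cosets. *)
Lemma average_on y x : I x ->
  average y x = crU f (\sum_(q : coset_of H) a (repr q) (y * D)) 1%g * x.
Proof.
move=> Ix; have [I0 ID IM] := Iid; rewrite /average.
rewrite (big_morph (fun s => crU f s 1%g) (fun u v =>
  crUD f u v 1%g) (crU0 f 1%g)).
rewrite mulr_suml; apply: eq_bigr => q _; rewrite /conj_map.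
rewrite p0D_I; last exact: IM.
have [e1 e2] := unitinvP (repr q).
rewrite !mulrA -(mulrA (crU f 1 _)) crU1M.
have -> : crU f 1 (repr q) * crU f (y * D) 1%g =
   crU f (a (repr q) (y * D)) 1%g * crU f 1 (repr q).
  apply/ffunP => k; rewrite crU1_mulE mul_crU1E !ffunE.
  by case: eqP => [->|_]; rewrite ?mul0r ?mulr0 // mulrC.
by rewrite -(mulrA (crU f _ 1%g)) e1 mulr1.
Qed.

(** Distinct cosets act differently, so Dedekind independence supplies a [y] for which the trace [r]
    of [y D] is nonzero. The average composed with itself is [r] times the average, and its kernel
    is a complement up to the factor [r]. *)
Lemma average_complement : exists (r : A) (J : T -> Prop), [/\ r != 0,
  left_ideal J, forall x, I x -> J x -> x = 0
  & forall x, exists y z, [/\ I y, J z & crU f r 1%g * x = y + z]].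
Proof.
have [y ry] : exists y, \sum_(q : coset_of H) a (repr q) (y * D) != 0.
  apply: boolp.contrapT => ny.
  (* If every trace vanished, the coefficients [a (repr q) D] would all be zero, and hence [D]
     too. *)
  case/eqP: D0; apply: (can_inj (ractK a (repr (1%g : coset_of H)))).
  rewrite rmorph0; apply: (@dedekind_independence (coset_of H) A
    (fun q => a (repr q)) _ (fun q => a (repr q) D) _ 1%g) => [q q' eqq'|x].
    rewrite -[q]coset_reprK -[q']coset_reprK.
    have : ((repr q')^-1 * repr q)%g \in H.
      by apply/ker_a => x; rewrite ractM eqq' ractK.
    move=> hH; rewrite -[repr q](mulKVg (repr q')) coset_morphM ?ker_norm //.
    by rewrite [coset H (_ * _)%g]coset_id ?mulg1.
  apply/eqP/negPn/negP => nx; apply: ny; exists x.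
  by under eq_bigr => q _ do rewrite rmorphM mulrC.
set r := \sum_q _ in ry.
have p_on x : I x -> average y x = crU f r 1%g * x by apply: average_on.
exists r, (fun x => average y x = 0); split=> //.
- split; first by apply: (addrI (average y 0)); rewrite -averageD !addr0.
    by move=> u v u0 v0; rewrite averageD u0 v0 addr0.
  by move=> u v v0; rewrite averageM v0 mulr0.
- move=> x Ix; rewrite p_on // => /ffunP rx0; apply/ffunP => k.
  by have := rx0 k; rewrite crU1_mulE ffunE => /eqP;
    rewrite mulf_eq0 (negPf ry) => /eqP ->; rewrite ?ffunE.
move=> x; exists (average y x), (crU f r 1%g * x - average y x).
split; [exact: average_in | | by rewrite addrC subrK].
have aN u : average y (- u) = - average y u.
  by rewrite -mulN1r averageM mulN1r.
rewrite averageD aN averageM [average y (average y x)]p_on ?subrr //.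
exact: average_in.
Qed.

End Averaging.

Lemma crU_graded (gT : finGroupType) (A : comUnitRingType)
    (a : ring_action gT A) (f : cocycle2 a) (H : {group gT}) s h :
  h \in H -> crU f s h \in @graded_by _ _ _ f H.
Proof.
move=> hH; apply/graded_byP => g gH; rewrite ffunE.
by case: eqP gH => // ->; rewrite hH.
Qed.

(** Semisimplicity of the subring graded by [H] gives a projection onto [I] that is linear over this
    subring. Averaging it, with [D = 1], makes it linear over the whole crossed product up to a
    nonzero [r], which is invertible in a field. *)
Lemma crossed_semisimple (gT : finGroupType) (A : fieldType)
    (a : ring_action gT A) (f : cocycle2 a) (H : {group gT}) :
  (forall g, g \in H <-> a g =1 id) ->
  semisimple_ring (subcrossed f H) -> semisimple_ring (crossed f).
Proof.
move=> ker_a ss I Iid.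
pose B := subcrossed f H; pose K (x : B) := x = 0.
have ssK (J : B -> Prop) : left_ideal J -> (forall x, K x -> J x) ->
    exists J' : B -> Prop, [/\ left_ideal J', forall x, J x -> J' x -> K x
    & forall x, exists y z, [/\ J y, J' z & x = y + z]].
  by move=> Jid _; have [J' [? ? ?]] := ss J Jid; exists J'.
pose act (b : B) (x : crossed f) := val b * x.
have actDr b u v : act b (u + v) = act b u + act b v by rewrite /act mulrDr.
have actDl b c v : act (b + c) v = act b v + act c v by rewrite /act mulrDl.
have act1 v : act 1 v = v by rewrite /act mul1r.
have actM b c v : act (b * c) v = act b (act c v) by rewrite /act mulrA.
have [I0 ID IM] := Iid.
have [||||||M [Mid _ _ IM0 IMT]] :=
  act_closed_complement ssK actDr actDl act1 actM
  (C := fun x => x = 0) (L := I) (L' := fun=> True).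
- split=> // [x y -> ->|b x ->]; rewrite ?addr0 //; exact: mulr0.
- by split=> // b x Ix; apply: IM.
- by [].
- by move=> x ->.
- by [].
- by move=> b v -> _; rewrite /act mul0r.
have MB := act_closedB actDl act1 Mid; have [M0 MD MM] := Mid.
have /boolp.choice[p0 p0P] : forall x, exists y, I y /\ M (x - y).
  move=> x; have [y [z [Iy Mz ->]]] := IMT x Logic.I.
  by exists y; rewrite addrAC subrr add0r.
have p0_uniq x y : I y -> M (x - y) -> p0 x = y.
  move=> Iy Mxy; have [Ip Mp] := p0P x; apply/eqP; rewrite -subr_eq0; apply/eqP.
  apply: IM0; first exact: left_idealB.
  have -> : p0 x - y = (x - y) - (x - p0 x) by rewrite opprB [RHS]addrC addrA
    subrK.
  exact: MB.
have [|s h x hH||||r [J [r0 Jid IJ0 IJT]]] :=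
  @average_complement _ _ _ f _ ker_a p0 _ _ I 1 Iid.
- move=> x y; have [Ix Mx] := p0P x; have [Iy My] := p0P y.
  by apply: p0_uniq; [exact: ID|rewrite opprD addrACA; apply: MD].
- have [Ix Mx] := p0P x; apply: p0_uniq; first exact: IM.
  by rewrite -mulrBr; apply: (MM (SubCrossed (crU_graded f s hH))).
- by move=> x; have [] := p0P x.
- exact: oner_neq0.
- by move=> x Ix; rewrite mul1r; apply: p0_uniq; rewrite ?subrr.
exists J; split=> // x.
have [y [z [Iy Jz e]]] := IJT (crU f r^-1 1%g * x); exists y, z; split=> //.
by rewrite -e mulrA crU1M divff // mul1r.
Qed.

(** A family in [L] of maximal rank spans, as adjoining one more vector cannot raise the rank. *)
Lemma finite_spanning_family (F : fieldType) n (X : Type) (emb : X -> 'rV[F]_n)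
    (L : X -> Prop) : exists d (e : 'I_d -> X), (forall j, L (e j)) /\
  forall x, L x -> (emb x <= \matrix_j emb (e j))%MS.
Proof.
pose Q r := exists d (e : 'I_d -> X), (forall j, L (e j)) /\
  \rank (\matrix_j emb (e j)) = r.
have Q0 : exists r, boolp.asbool (Q r).
  exists 0%N; apply/boolp.asboolP.
  exists 0%N, (fun j : 'I_0 => match notF (ltn_ord j) with end).
  by split=> [[]//|]; apply/eqP; rewrite -leqn0 rank_leq_row.
have Qn r : boolp.asbool (Q r) -> (r <= n)%N.
  by move=> /boolp.asboolP[d [e [_ <-]]]; apply: rank_leq_col.
case: (ex_maxnP Q0 Qn) => r /boolp.asboolP[d [e [Le rE]]] rmax.
set E := \matrix_j emb (e j) in rE.
exists d, e; split=> // x Lx.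
pose e' (j : 'I_(1 + d)) := match split j with inl _ => x | inr j => e j end.
have E'E : \matrix_j emb (e' j) = col_mx (emb x) E.
  apply/row_matrixP => i; rewrite rowK /e'; case: (split_ordP i) => j ->.
    by rewrite rowKu; apply/rowP => l; rewrite [j]ord1 !mxE.
  by rewrite rowKd rowK.
have : (\rank (emb x + E)%MS <= r)%N.
  apply: rmax; apply/boolp.asboolP; exists (1 + d)%N, e'; split.
    by move=> j; rewrite /e'; case: (split j).
  by rewrite E'E addsmxE.
have := mxrank_leqif_sup (addsmxSr (emb x) E); rewrite rE => le_r lr.
have /esym := eq_leqif le_r; rewrite eqn_leq lr le_r => sub.
by apply: submx_trans (addsmxSl _ _) sub.
Qed.

Section AlmostProjection.
Variables (S : idomainType) (gT : finGroupType) (a : ring_action gT S).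
Variables (f : cocycle2 a).

(** Over the fraction field, [pinvmx E] followed by [E] projects onto the span of [L]. A common
    denominator [D] of [pinvmx E] makes the coefficients on the family [e] integral, so the values
    stay in [L]. *)
Lemma left_ideal_almost_projection (L : crossed f -> Prop) : left_ideal L ->
  exists (D : S) (p0 : crossed f -> crossed f), [/\ D != 0,
    forall x y, p0 (x + y) = p0 x + p0 y,
    forall s x, p0 (crU f s 1%g * x) = crU f s 1%g * p0 x,
    forall x, L (p0 x) & forall x, L x -> p0 x = crU f D 1%g * x].
Proof.
move=> Lid; have [L0 LD LM] := Lid.
pose F := {fraction S}; pose n := #|gT|.
pose emb (x : crossed f) : 'rV[F]_n := \row_i tofrac (x (enum_val i)).
have embI x y : emb x = emb y -> x = y.
  move=> /rowP exy; apply/ffunP => g.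
  have := exy (enum_rank g); rewrite !mxE enum_rankK => /eqP.
  by rewrite tofrac_eq => /eqP.
have embD x y : emb (x + y) = emb x + emb y.
  by apply/rowP => i; rewrite !mxE ffunE tofracD.
have embZ s x : emb (crU f s 1%g * x) = tofrac s *: emb x.
  by apply/rowP => i; rewrite !mxE crU1_mulE tofracM.
have emb0 : emb 0 = 0 by apply/rowP => i; rewrite !mxE ffunE tofrac0.
have [d [e [Le LsubE]]] := finite_spanning_family emb L.
set E := \matrix_j emb (e j) in LsubE.
have [D [N [D0 NE]]] : exists (D : S) (N : 'M[S]_(n, d)), D != 0 /\
    tofrac D *: pinvmx E = map_mx (@tofrac S) N.
  suff [D [N [D0 NP]]] : exists (D : S) (N : 'I_n * 'I_d -> S), D != 0 /\
     forall ij, tofrac D * pinvmx E ij.1 ij.2 = tofrac (N ij).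
    exists D, (\matrix_(i, j) N (i, j)); split=> //.
    by apply/matrixP => i j; have := NP (i, j); rewrite !mxE.
  have /boolp.choice[dd ddP] := fun ij : 'I_n * 'I_d =>
    fraction_clear (pinvmx E ij.1 ij.2).
  exists (\prod_ij dd ij).
  have /boolp.choice[N NP] : forall ij : 'I_n * 'I_d, exists m,
    tofrac (\prod_ij dd ij)
      * pinvmx E ij.1 ij.2 = tofrac m.
    move=> ij; have [m [_ em]] := ddP ij;
      exists (m * \prod_(kl | kl != ij) dd kl).
    by rewrite (bigD1 ij) //= !tofracM -em mulrAC.
  exists N; split=> //; apply/prodf_neq0 => ij _; by have [m []] := ddP ij.
pose c (x : crossed f) j := \sum_i x (enum_val i) * N i j.
pose p0 x := \sum_j crU f (c x j) 1%g * e j.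
have embp x : emb (p0 x) = tofrac D *: (emb x *m pinvmx E *m E).
  rewrite /p0 (big_morph emb embD emb0) scalemxAl scalemxAr NE mulmx_sum_row.
  apply: eq_bigr => j _; rewrite embZ rowK; congr (_ *: _).
  rewrite mxE /c rmorph_sum; apply: eq_bigr => i _.
  by rewrite !mxE rmorphM.
exists D, p0; split=> //.
- by move=> x y; apply: embI; rewrite embD !embp embD !mulmxDl scalerDr.
- move=> s x; apply: embI; rewrite embZ !embp embZ -!scalemxAl.
  by rewrite !scalerA mulrC.
- by move=> x; rewrite /p0; elim/big_rec: _ => // j y _; apply: LD; apply: LM.
- move=> x Lx; apply: embI; rewrite embp embZ mulmxKpV //; exact: LsubE.
Qed.

Lemma crossed_almost_complement (L : crossed f -> Prop) :
  faithful_action a -> left_ideal L ->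
  exists (r : S) (J : crossed f -> Prop), [/\ r != 0,
    left_ideal J, forall x, L x -> J x -> x = 0
    & forall x, exists y z, [/\ L y, J z & crU f r 1%g * x = y + z]].
Proof.
move=> a_faithful Lid.
have [D [p0 [D0 p0D p0S p0L p0_L]]] := left_ideal_almost_projection Lid.
apply: (@average_complement _ _ _ _ 1%G _ p0 _ _ L D) => // [g|s h x].
  by rewrite inE; split=> [/eqP -> | /a_faithful ->] //; apply: ract1.
by rewrite inE => /eqP ->.
Qed.
End AlmostProjection.

(** * Reduction of the crossed product modulo a uniformizer *)

Section DVRCrossed.
Variables (S : dvrType) (gT : finGroupType) (a : ring_action gT S).
Hypothesis a_faithful : faithful_action a.

Section Red.
Variable f : cocycle2 a.
Local Notation pi := (uniformizer S).

Definition red (x : crossed f) : crossed (res_cocycle f) := [ffun g =>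
  res (x g)].

Fact red_is_zmod_morphism : zmod_morphism red.
Proof. by move=> x y; apply/ffunP => g; rewrite !ffunE rmorphB. Qed.
Fact red_is_monoid_morphism : monoid_morphism red.
Proof.
split=> [|x y]; apply/ffunP => g.
  by rewrite !ffunE; case: eqP; rewrite ?rmorph1 ?rmorph0.
rewrite ffunE !crossedME rmorph_sum; apply: eq_bigr => h _.
by rewrite !ffunE !rmorphM /= res_act_funE.
Qed.
HB.instance Definition _ :=
  GRing.isZmodMorphism.Build _ _ red red_is_zmod_morphism.
HB.instance Definition _ :=
  GRing.isMonoidMorphism.Build _ _ red red_is_monoid_morphism.

Lemma red_crU s g : red (crU f s g) = crU (res_cocycle f) (res s) g.
Proof. by apply/ffunP => h; rewrite !ffunE; case: eqP; rewrite ?rmorph0. Qed.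

Lemma red_surj y : exists x, red x = y.
Proof.
exists [ffun g => res_repr (y g)].
by apply/ffunP => g; rewrite !ffunE res_reprK.
Qed.

Lemma red_eq0 x : red x = 0 <-> exists y, x = crU f pi 1%g * y.
Proof.
split=> [x0|[y ->]].
  have /boolp.choice[y yP] : forall g, exists s, x g = s * pi.
    move=> g; apply/nonunitP; rewrite -res_eq0.
    by have := congr1 (fun z : crossed _ => z g) x0; rewrite !ffunE => ->.
  by exists [ffun g => y g]; apply/ffunP => g; rewrite crU1_mulE ffunE yP mulrC.
rewrite rmorphM /= red_crU; have /eqP -> : res pi == 0.
  by rewrite res_eq0 uniformizer_nonunit.
by rewrite crU0 mul0r.
Qed.

Lemma ract_uniformizer g : exists2 u, u \is a GRing.unit & a g pi = u * pi.
Proof.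
have /nonunitP[u uE] : a g pi \isn't a GRing.unit.
  by rewrite ract_unit uniformizer_nonunit.
have /nonunitP[v vE] : a g^-1%g pi \isn't a GRing.unit.
  by rewrite ract_unit uniformizer_nonunit.
exists u => //; apply/unitrPr; exists (a g v).
have := ractKV a g pi; rewrite vE rmorphM uE mulrA => e.
by apply: (mulIf (uniformizer_neq0 S)); rewrite mul1r -[RHS]e [u * _]mulrC.
Qed.

Lemma crU_pi_lmul x y : crU f pi 1%g * x = crU f pi 1%g * y -> x = y.
Proof.
move=> /ffunP e; apply/ffunP => g; apply: (mulfI (uniformizer_neq0 S)).
by have := e g; rewrite !crU1_mulE.
Qed.

Lemma crU_pi_rmul x y : x * crU f pi 1%g = y * crU f pi 1%g -> x = y.
Proof.
move=> /ffunP e; apply/ffunP => g.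
apply: (mulIf (_ : a g pi != 0));
  first by apply: contraNneq (uniformizer_neq0 S) => e0;
  rewrite -[pi](ractK a g) e0 rmorph0.
by have := e g; rewrite !mul_crU1E.
Qed.

Lemma crU_pi_swapl x : exists y, crU f pi 1%g * x = y * crU f pi 1%g.
Proof.
have /boolp.choice[u uP] : forall g, exists u,
  u \is a GRing.unit /\ a g pi = u * pi.
  by move=> g; have [u] := ract_uniformizer g; exists u.
exists [ffun g => x g / u g]; apply/ffunP => g.
have [uU _] := uP g.
by rewrite crU1_mulE mul_crU1E ffunE (uP g).2 mulrA divrK // mulrC.
Qed.

Lemma crU_pi_swapr x : exists y, x * crU f pi 1%g = crU f pi 1%g * y.
Proof.
have /boolp.choice[u uP] : forall g, exists u,
  u \is a GRing.unit /\ a g pi = u * pi.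
  by move=> g; have [u] := ract_uniformizer g; exists u.
exists [ffun g => x g * u g]; apply/ffunP => g.
by rewrite crU1_mulE mul_crU1E ffunE (uP g).2 [RHS]mulrC mulrA.
Qed.

Lemma inertiaP g : g \in inertia a <-> res_action a g =1 id.
Proof. by rewrite inE; split => /boolp.asboolP. Qed.

Lemma crossed_lifts : semisimple_ring (res_crossed f (inertia a)) ->
  forall L : crossed f -> Prop, left_ideal L -> lifts L.
Proof.
move=> ssI; have ss := crossed_semisimple inertiaP ssI.
apply: (lifts_left_ideal crU_pi_lmul crU_pi_rmul crU_pi_swapl crU_pi_swapr).
- move=> I Iid KI; pose I' y := exists2 x, I x & red x = y.
  have [I0 ID IM] := Iid.
  have [|J' [J'id IJ' sIJ']] := ss I'.
    split; first by exists 0; rewrite ?rmorph0.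
      by move=> _ _ [x Ix <-] [y Iy <-]; exists (x + y); rewrite ?rmorphD //;
        apply: ID.
    move=> b _ [x Ix <-]; have [c <-] := red_surj b.
    by exists (c * x); rewrite ?rmorphM //; apply: IM.
  have [J'0 J'D J'M] := J'id.
  exists (fun x => J' (red x)); split.
  + split=> [|x y|b x]; first by rewrite rmorph0.
      by rewrite rmorphD; apply: J'D.
    by rewrite rmorphM; apply: J'M.
  + by move=> x Ix J'x; apply/red_eq0/IJ' => //; exists x.
  + move=> x; have [_ [z [[y Iy <-] J'z e]]] := sIJ' (red x).
    exists y, (x - y); rewrite addrCA subrr addr0; split=> //.
    by rewrite rmorphB /= e addrAC subrr add0r.
move=> L Lid; have [r [J [r0 Jid LJ0 LJT]]] :=
  crossed_almost_complement a_faithful Lid.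
(* The factor [r] is a unit times [pi^N]; dividing by the unit decomposes [pi^N] along [L] and
   [J]. *)
have [u [N [uU rE]]] := dvr_factor r0.
have [y [z [Ly Jz e]]] := LJT (crU f 1 1%g).
exists J, N; split=> //; exists (crU f u^-1 1%g * y), (crU f u^-1 1%g * z).
split; [by case: Lid => _ _; apply|by case: Jid => _ _; apply|].
by rewrite -mulrDr -e mulr1 crU1M rE mulKr // crU1X.
Qed.

End Red.
End DVRCrossed.

(** * The opposite crossed product *)

Section OppositeCocycle.
Variables (gT : finGroupType) (A : comUnitRingType) (a : ring_action gT A).

Lemma cocycle2_ext (f f' : cocycle2 a) : (forall g h, f g h = f' g h) -> f = f'.
Proof.
case: f f' => [c u l r e] [c' u' l' r' e'] /= cc'.
have {cc'}E : c = c' by apply/boolp.funext => g; apply/boolp.funext => h.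
by subst c'; congr Cocycle2; apply: boolp.Prop_irrelevance.
Qed.

Variable f : cocycle2 a.

(** In the opposite ring the basis element of [g] is the [U] of the inverse of [g]; the action of
    [g * h] appears when the scalar is moved across the product. *)
Definition opp_coc g h := a (g * h)%g (f h^-1%g g^-1%g).

Fact opp_coc_unit g h : opp_coc g h \is a GRing.unit.
Proof. by rewrite rmorph_unit // coc_unit. Qed.
Fact opp_coc1g g : opp_coc 1%g g = 1.
Proof. by rewrite /opp_coc invg1 cocg1 rmorph1. Qed.
Fact opp_cocg1 g : opp_coc g 1%g = 1.
Proof. by rewrite /opp_coc invg1 coc1g rmorph1. Qed.
Fact opp_cocA g h k :
  opp_coc g h * opp_coc (g * h)%g k = a g (opp_coc h k) * opp_coc g (h * k)%g.
Proof.
rewrite /opp_coc -!ractM !invMg (mulgA g h k).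
by rewrite -(rmorphM (a (g * h * k)%g)) cocA rmorphM -ractM mulgK.
Qed.

Definition opp_cocycle : cocycle2 a :=
  Cocycle2 opp_coc_unit opp_coc1g opp_cocg1 opp_cocA.

Definition crossed_opp (x : crossed f) : crossed opp_cocycle :=
  [ffun g => a g (x g^-1%g)].
Definition crossed_opp_inv (x : crossed opp_cocycle) : crossed f :=
  [ffun g => a g (x g^-1%g)].

Lemma crossed_oppK : cancel crossed_opp crossed_opp_inv.
Proof. by move=> x; apply/ffunP => g; rewrite !ffunE invgK ractKV. Qed.

Lemma crossed_opp_invK : cancel crossed_opp_inv crossed_opp.
Proof. by move=> x; apply/ffunP => g; rewrite !ffunE invgK ractKV. Qed.

Lemma crossed_oppB x y : crossed_opp (x - y) = crossed_opp x - crossed_opp y.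
Proof. by apply/ffunP => g; rewrite !ffunE rmorphB. Qed.

Lemma crossed_opp1 : crossed_opp 1 = 1.
Proof.
by apply/ffunP => g; rewrite !ffunE invg_eq1; case: eqP;
  rewrite ?rmorph1 ?rmorph0.
Qed.

Lemma crossed_oppM x y : crossed_opp (x * y) = crossed_opp y * crossed_opp x.
Proof.
apply/ffunP => k; rewrite ffunE !crossedME rmorph_sum.
rewrite [RHS](reindex_inj (mulgI k)) /=; apply: eq_bigr => g _.
have -> : ((k * g)^-1 * k)%g = g^-1%g by rewrite invMg -mulgA mulVg mulg1.
rewrite !ffunE !rmorphM /= /opp_coc invgK -!ractM mulgK !invMg.
by congr (_ * _); rewrite mulrC.
Qed.

End OppositeCocycle.

(** * Hereditarity from a commutative semisimple inertial algebra *)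

Section Sufficiency.

(** The anti-isomorphism turns left ideals into right ideals, which are again left ideals by
    commutativity. *)
Lemma semisimple_opp (gT : finGroupType) (A : comUnitRingType)
    (a : ring_action gT A) (f : cocycle2 a) (H : {group gT}) :
  (forall x y : subcrossed f H, x * y = y * x) ->
  semisimple_ring (subcrossed f H) ->
  semisimple_ring (subcrossed (opp_cocycle f) H).
Proof.
move=> comm ss I [I0 ID IM].
have graded_opp (x : crossed f) : x \in @graded_by _ _ _ f H ->
    crossed_opp x \in @graded_by _ _ _ (opp_cocycle f) H.
  move=> /graded_byP xH; apply/graded_byP => g gH.
  by rewrite ffunE xH ?rmorph0 // groupV.
have graded_inv (x : crossed (opp_cocycle f)) :
  x \in @graded_by _ _ _ (opp_cocycle f) H ->
    crossed_opp_inv x \in @graded_by _ _ _ f H.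
  move=> /graded_byP xH; apply/graded_byP => g gH.
  by rewrite ffunE xH ?rmorph0 // groupV.
pose k (x : subcrossed f H) := SubCrossed (graded_opp _ (valP x)).
pose k' (x : subcrossed (opp_cocycle f) H) :=
  SubCrossed (graded_inv _ (valP x)).
have kK : cancel k k' by move=> x; apply: val_inj; apply: crossed_oppK.
have k'K : cancel k' k by move=> x; apply: val_inj; apply: crossed_opp_invK.
have kM x y : k (x * y) = k y * k x by apply: val_inj; apply: crossed_oppM.
have kB x y : k (x - y) = k x - k y by apply: val_inj; apply: crossed_oppB.
have k0 : k 0 = 0 by rewrite -[X in k X](subrr 0) kB subrr.
have kD x y : k (x + y) = k x + k y.
  by rewrite -[in LHS](opprK y) -[- y]sub0r !kB k0 sub0r opprK.
have k'D x y : k' (x + y) = k' x + k' y by apply: (can_inj kK); rewrite kD !k'K.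
have k'M x y : k' (x * y) = k' y * k' x by apply: (can_inj kK); rewrite kM !k'K.
have [|J [[J0 JD JM] IJ sIJ]] := ss (fun x => I (k x)).
  split=> [|x y|b x]; rewrite ?k0 ?kD //; first exact: ID.
  by rewrite comm kM; apply: IM.
exists (fun x => J (k' x)); split.
- split=> [|x y|b x]; first by rewrite -k0 kK.
    by rewrite k'D; apply: JD.
  by rewrite k'M comm; apply: JM.
- move=> x Ix Jx; rewrite -[x]k'K (IJ (k' x)) ?k'K //.
- move=> x; have [y [z [Iy Jz e]]] := sIJ (k' x).
  by exists (k y), (k z); rewrite kK -kD -e k'K.
Qed.

Variables (S : dvrType) (gT : finGroupType) (a : ring_action gT S).
Variable f : cocycle2 a.

Lemma res_opp_cocycle : res_cocycle (opp_cocycle f) =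
  opp_cocycle (res_cocycle f).
Proof. by apply: cocycle2_ext => g h /=;
  rewrite /opp_coc /res_coc /= res_act_funE. Qed.

Fact crossed_opp_inv_zmod : zmod_morphism
  (@crossed_opp_inv _ _ _ f : crossed (opp_cocycle f) -> (crossed f)^c).
Proof. by move=> x y; apply/ffunP => g; rewrite !ffunE rmorphB. Qed.

Fact crossed_opp_inv_monoid : monoid_morphism
  (@crossed_opp_inv _ _ _ f : crossed (opp_cocycle f) -> (crossed f)^c).
Proof.
split=> [|x y]; apply: (can_inj (@crossed_oppK _ _ _ f)).
  by rewrite crossed_opp_invK [RHS]crossed_opp1.
by rewrite crossed_opp_invK [RHS]crossed_oppM !crossed_opp_invK.
Qed.

Theorem crossed_hereditary : faithful_action a ->
  (forall x y : res_crossed f (inertia a), x * y = y * x) ->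
  semisimple_ring (res_crossed f (inertia a)) -> hereditary (crossed f).
Proof.
move=> a_faithful comm ss; split.
  apply: (lifts_left_hereditary (phi := idfun)); first by exists id.
  exact: crossed_lifts.
pose phi := HB.pack_for {rmorphism crossed (opp_cocycle f) -> (crossed f)^c}
  (@crossed_opp_inv _ _ _ f)
  (GRing.isZmodMorphism.Build _ _ _ crossed_opp_inv_zmod)
  (GRing.isMonoidMorphism.Build _ _ _ crossed_opp_inv_monoid).
apply: (@lifts_left_hereditary _ _ phi).
  by exists (@crossed_opp _ _ _ f);
    [apply: crossed_opp_invK|apply: crossed_oppK].
apply: crossed_lifts => //; rewrite res_opp_cocycle.
exact: semisimple_opp.
Qed.

End Sufficiency.

(** * Ramification of the wild inertia group *)

Section TotalRamification.
Variables (S : dvrType) (gT : finGroupType) (a : ring_action gT S).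
Hypothesis a_faithful : faithful_action a.
Hypothesis res_full : forall u : residue S, res_fixed a u.
Local Notation pi := (uniformizer S).

Definition fixed (c : S) : Prop := forall g, a g c = c.

Lemma fixed_divl b c : b != 0 -> fixed b -> fixed (b * c) -> fixed c.
Proof.
by move=> b0 bF bcF g; apply: (mulfI b0); rewrite -{1}(bF g) -rmorphM bcF.
Qed.

Lemma res_action_trivial g : res_action a g =1 id.
Proof. by move=> u; have [r rF <-] := res_full u;
  rewrite /= res_act_funE rF. Qed.

(** A [pi]-adic expansion to order [j]; its digits can be taken fixed because fixed elements
    represent every residue. *)
Lemma horner_expansion j s : exists (r : {poly S}) (t : S),
  [/\ (size r <= j)%N, forall i, fixed r`_i & s = r.[pi] + pi ^+ j * t].
Proof.
elim: j => [|j [r [t [rj rF ->]]]].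
  by exists 0, s; split=> [|i g|];
    rewrite ?size_poly0 ?coef0 ?rmorph0 ?horner0 ?mul1r ?add0r.
have [r0 r0F r0E] := res_full (res t).
have /nonunitP[t' t'E] : t - r0 \isn't a GRing.unit.
  by rewrite -res_eq0 rmorphB /= r0E subrr.
exists (r + r0 *: 'X^j), t'; split.
- apply: leq_trans (size_polyD _ _) _; rewrite geq_max (leq_trans rj) //=.
  by apply: leq_trans (size_scale_leq _ _) _; rewrite size_polyXn.
- move=> i g; rewrite coefD coefZ coefXn rmorphD rmorphM rF r0F.
  by case: eqP; rewrite ?rmorph1 ?rmorph0.
have -> : t = r0 + pi * t' by rewrite mulrC -t'E addrC subrK.
by rewrite hornerD hornerZ hornerXn mulrDr addrA mulrA -exprSr [r0 * _]mulrC.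
Qed.

Lemma fixed_poly_horner g (r : {poly S}) x : (forall i, fixed r`_i) ->
  a g r.[x] = r.[a g x].
Proof.
move=> rF; rewrite -horner_map; congr _.[_].
by apply/polyP => i; rewrite coef_map /= rF.
Qed.

(** The least positive valuation [e] of a fixed element divides all the others, and the norm of [pi]
    has valuation [#|gT|], so it suffices to exclude [e < #|gT|]. Otherwise [pi] would be
    approximately a root of monic polynomials of degree [e] with fixed coefficients, although it has
    [#|gT|] distinct conjugates. *)
Lemma card_dvd_valuation u m :
  u \is a GRing.unit -> fixed (u * pi ^+ m) -> (#|gT| %| m)%N.
Proof.
pose V e := (0 < e)%N /\ exists2 u, u \is a GRing.unit & fixed (u * pi ^+ e).
have Vn : V #|gT|.
  split; first by apply/card_gt0P; exists 1%g.
  have /boolp.choice[w wP] : forall g, exists w,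
    w \is a GRing.unit /\ a g pi = w * pi.
    by move=> g; have [w] := ract_uniformizer a g; exists w.
  exists (\prod_g w g); first by apply: rpred_prod => g _; case: (wP g).
  have -> : (\prod_g w g) * pi ^+ #|gT| = \prod_g a g pi.
    have -> : pi ^+ #|gT| = \prod_(g : gT) pi by rewrite prodr_const.
    by rewrite -big_split; apply: eq_bigr => g _; rewrite (wP g).2.
  move=> g; rewrite rmorph_prod [RHS](reindex_inj (mulgI g)).
  by apply: eq_bigr => h _; rewrite -ractM.
have exV : exists e, boolp.asbool (V e) by exists #|gT|; apply/boolp.asboolP.
case: (ex_minnP exV) => e /boolp.asboolP[e0 [v vU rhoF]] emin.
set rho := v * pi ^+ e in rhoF.
have pi0 := uniformizer_neq0 S.
have rho0 : rho != 0 by rewrite mulf_neq0 ?expf_neq0 //;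
  apply: contraTneq vU => ->; rewrite unitr0.
have e_dvd k w : w \is a GRing.unit -> fixed (w * pi ^+ k) -> (e %| k)%N.
  have [N] := ubnP k; elim: N k w => // N IHN [|k] w /ltnSE le_k wU wF;
    first by rewrite dvdn0.
  have le_ek : (e <= k.+1)%N.
    by apply: emin; apply/boolp.asboolP; split=> //; exists w.
  rewrite -(subnK le_ek) dvdn_addl ?dvdnn //.
  apply: (IHN _ (w / v)).
  - by apply: leq_trans le_k; rewrite ltn_subrL e0.
  - by rewrite unitrM wU unitrV.
  apply: (fixed_divl rho0 rhoF).
  suff -> : rho * (w / v * pi ^+ (k.+1 - e)) = w * pi ^+ k.+1 by [].
  by rewrite /rho mulrACA -exprD subnKC // mulrC [v * _]mulrC divrK // mulrC.
suff -> : #|gT| = e by apply: e_dvd.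
apply/eqP; rewrite eq_sym eqn_leq emin; last exact/boolp.asboolP.
rewrite leqNgt /=; apply/negP => lt_en.
have rhoN : rho \isn't a GRing.unit.
  by rewrite unitrM unitrX_pos // negb_and uniformizer_nonunit orbT.
(* Modulo [rho^N] every element is a polynomial in [pi] of degree below [e] with fixed coefficients:
   at each stage the remainder's factor [pi^e] is traded for [rho], up to a unit. *)
have approx N s : exists (r : {poly S}) (t : S),
    [/\ (size r <= e)%N, forall i, fixed r`_i & s = r.[pi] + t * rho ^+ N].
  elim: N => [|N [r [t [re rF ->]]]].
    by exists 0, s; split=> [|i g|];
      rewrite ?size_poly0 ?coef0 ?rmorph0 ?horner0 ?mulr1 ?add0r.
  have [r' [t' [re' rF' ->]]] := horner_expansion e t.
  exists (r + rho ^+ N *: r'), (v^-1 * t'); split.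
  - apply: leq_trans (size_polyD _ _) _; rewrite geq_max re /=.
    exact: leq_trans (size_scale_leq _ _) re'.
  - by move=> i g; rewrite coefD coefZ rmorphD rmorphM rF rF' rmorphXn rhoF.
  rewrite hornerD hornerZ -addrA mulrDl [r'.[_] * _]mulrC; congr (_ + (_ + _)).
  rewrite exprS /rho -/rho mulrA; congr (_ * _).
  by rewrite mulrCA -!mulrA mulVKr // mulrC.
(* An element fixing [pi] fixes all the approximating polynomials, so it moves [s] by a multiple of
   every power of [rho]. *)
have inj_pi g : a g pi = pi -> g = 1%g.
  move=> gpi; apply: a_faithful => s; apply/eqP; rewrite -subr_eq0; apply/eqP.
  apply: (divisible_by_powers_eq0 rhoN) => N.
  have [r [t [_ rF {1 2}->]]] := approx N s.
  exists (a g t - t).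
  rewrite rmorphD rmorphM rmorphXn rhoF fixed_poly_horner // gpi.
  by rewrite opprD addrACA subrr add0r mulrBl.
pose n := #|gT|; pose xs : 'rV[S]_n := \row_j a (enum_val j) pi.
suff : \det (Vandermonde n xs) = 0.
  apply/eqP; rewrite det_Vandermonde; apply/prodf_neq0 => i _.
  apply/prodf_neq0 => j lt_ij; rewrite !mxE subr_eq0; apply/eqP => eij.
  have : ((enum_val i)^-1 * enum_val j)%g = 1%g.
    by apply: inj_pi; rewrite ractM eij ractK.
  move=> /eqP; rewrite -eq_mulVg1 => /eqP/enum_val_inj e'.
  by move: lt_ij; rewrite e' ltnn.
apply: (divisible_by_powers_eq0 rhoN) => N.
have [r [t [re rF eE]]] := approx N (pi ^+ e).
pose h := 'X^e - r.
(* All conjugates of [pi] are roots of [h] modulo [rho^N]. *)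
have hV : (\row_(i < n) h`_i) *m Vandermonde n xs
    = rho ^+ N *: \row_j a (enum_val j) t.
  apply/rowP => j; rewrite !mxE.
  have -> : rho ^+ N * a (enum_val j) t = h.[a (enum_val j) pi].
    rewrite hornerD hornerN hornerXn -fixed_poly_horner // -rmorphXn eE.
    rewrite rmorphD rmorphM addrAC subrr add0r mulrC rmorphXn.
    by rewrite rhoF.
  have hn : (size h <= n)%N.
    apply: leq_trans (size_polyD _ _) _;
      rewrite size_polyN size_polyXn geq_max lt_en.
    exact: leq_trans re (ltnW lt_en).
  by rewrite (horner_coef_wide _ hn); apply: eq_bigr => i _; rewrite !mxE.
(* After multiplication by the adjugate, the entry at the leading coefficient [1] of [h] shows that
   [rho^N] divides the determinant. *)
have := congr1 (mulmxr (\adj (Vandermonde n xs))) hV => /=.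
rewrite -mulmxA mul_mx_adj mul_mx_scalar -scalemxAl =>
  /rowP/(_ (Ordinal lt_en)).
rewrite !mxE /= coefB coefXn eqxx [r`__]nth_default // subr0 mulr1 => ->.
by eexists; rewrite mulrC.
Qed.

End TotalRamification.

(** * Residues of elements fixed by a wild subgroup *)

Lemma separable_root_in_image (F k : fieldType) (v : {rmorphism F -> k})
    (u : k) (q : nat) (c : F) (g0 : {poly F}) :
  [pchar k].-nat q -> v c = u ^+ q -> separable_poly (map_poly v g0) ->
  root (map_poly v g0) u -> exists x, u = v x.
Proof.
move=> qp uq; set g := map_poly v g0 => gsep gu.
have q0 : (0 < q)%N by case: q qp {uq}.
(* Over [k] this polynomial becomes [(X - u)^q], whose gcd with the separable [g] is [X - u] up to a
   constant. The gcd can be computed over [F], so its root comes from [F]. *)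
pose h0 : {poly F} := 'X^q - c%:P.
have hE0 : map_poly v h0 = ('X - u%:P) ^+ q.
  have qpX : [pchar {poly k}].-nat q by rewrite (eq_pnat _ (pchar_poly k)).
  rewrite rmorphB /= map_polyXn map_polyC /= exprDn_pchar // uq.
  by rewrite exprNn_pchar // -polyC_exp.
pose d0 := gcdp g0 h0.
have dE : map_poly v d0 = gcdp g (('X - u%:P) ^+ q) by rewrite gcdp_map hE0.
have : gcdp g (('X - u%:P) ^+ q) %| ('X - u%:P) ^+ q by apply: dvdp_gcdr.
case/dvdp_exp_XsubCP => m _ dm.
have m1 : m = 1%N.
  have Xd : 'X - u%:P %| gcdp g (('X - u%:P) ^+ q).
    by rewrite dvdp_gcd dvdp_XsubCl gu -(prednK q0) exprS dvdp_mulIl.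
  case: m dm => [|[|m]] // dm.
    move: Xd; rewrite (eqp_dvdr _ dm) expr0 dvdp1 size_XsubC.
    by [].
  have : ('X - u%:P) ^+ m.+2 %| g by rewrite -(eqp_dvdl _ dm) dvdp_gcdl.
  rewrite 2!exprS mulrA => /dvdpP[w gw].
  have : root (gcdp g g^`()) u.
    rewrite root_gcd gu /= gw derivM !derivM rootE !hornerE.
    by rewrite subrr /= !(mul0r, mulr0, addr0).
  have : coprimep g g^`() by move: gsep; rewrite separable_poly.unlock.
  by move=> /eqP s1; rewrite -dvdp_XsubCl => /dvdp_leq;
    rewrite -size_poly_eq0 s1 size_XsubC; move/(_ isT).
move: dm; rewrite m1 expr1 -dE => dm.
have du : root (map_poly v d0) u by rewrite (eqp_root dm) root_XsubC.
have sd : size d0 = 2%N by rewrite -(size_map_poly v) (eqp_size dm) size_XsubC.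
have d1 : d0`_1 != 0.
  by have := lead_coef_eq0 d0; rewrite lead_coefE sd /= => ->;
    rewrite -size_poly_eq0 sd.
exists (- d0`_0 / d0`_1).
rewrite fmorph_div rmorphN; apply/(canRL (mulfK _));
  first by rewrite fmorph_eq0.
move: du; rewrite rootE (@horner_coef_wide _ 2) ?size_map_poly ?sd //.
rewrite !big_ord_recl big_ord0 !coef_map /= expr0 expr1 mulr1 addr0.
by rewrite addr_eq0 => /eqP ->; rewrite opprK mulrC.
Qed.

Section SubField.
Variables (k : fieldType) (E : divringClosed k).

Record subfield_of := SubFieldOf { sfval : k; _ : sfval \in E }.
HB.instance Definition _ := [isSub for sfval].
HB.instance Definition _ := [Choice of subfield_of by <:].
HB.instance Definition _ := [SubChoice_isSubUnitRing of subfield_of by <:].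
HB.instance Definition _ := [SubNzRing_isSubComNzRing of subfield_of by <:].
HB.instance Definition _ :=
  [SubComUnitRing_isSubIntegralDomain of subfield_of by <:].
HB.instance Definition _ := [SubIntegralDomain_isSubField of subfield_of by <:].

Lemma separable_root_in_subfield (u : k) (q : nat) (g : {poly k}) :
  [pchar k].-nat q -> u ^+ q \in E ->
  (forall i, g`_i \in E) -> separable_poly g -> root g u -> u \in E.
Proof.
move=> qp uqE gE gsep gu.
pose g0 : {poly subfield_of} := \poly_(i < size g) SubFieldOf (gE i).
pose v : {rmorphism subfield_of -> k} := \val.
have gE0 : map_poly v g0 = g.
  apply/polyP => i; rewrite coef_map coef_poly.
  by case: ltnP => // le_gi; rewrite nth_default.
have [|||x ->] := @separable_root_in_image _ _ v u q (SubFieldOf uqE) g0 qp.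
- by [].
- by rewrite gE0.
- by rewrite gE0.
exact: valP.
Qed.
End SubField.

Section ResidueOfFixed.
Variables (S : dvrType) (gT : finGroupType) (a : ring_action gT S).
Hypothesis a_sep : residually_separable a.
Variable P : {group gT}.
Hypotheses (PI : P \subset inertia a) (Pp : [pchar residue S].-nat #|P|).

Definition fixed_res : {pred residue S} := fun u =>
  boolp.asbool (exists2 r : S, (forall g, g \in P -> a g r = r) & res r = u).

Fact fixed_res_divring : divring_closed fixed_res.
Proof.
split=> [|u v|u v].
- by apply/boolp.asboolP; exists 1; rewrite ?rmorph1 // => g _; rewrite rmorph1.
- move=> /boolp.asboolP[x xF <-] /boolp.asboolP[y yF <-]; apply/boolp.asboolP.
  by exists (x - y); rewrite ?rmorphB // => g gP; rewrite rmorphB xF ?yF.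
move=> /boolp.asboolP[x xF <-] /boolp.asboolP[y yF <-]; apply/boolp.asboolP.
have [yU|yN] := boolP (y \is a GRing.unit).
  exists (x / y); last by rewrite rmorph_div.
  by move=> g gP; rewrite rmorph_div ?xF ?yF.
have /eqP -> : res y == 0 by rewrite res_eq0.
by exists 0; rewrite ?invr0 ?mulr0 ?rmorph0 // => g _; rewrite rmorph0.
Qed.
HB.instance Definition _ :=
  GRing.isDivringClosed.Build _ fixed_res fixed_res_divring.

(** As [P] acts trivially on residues, [u ^+ #|P|] is the residue of the norm of a representative of
    [u]. Since [u] is also a root of a separable polynomial over [fixed_res], it lies in
    [fixed_res]. *)
Lemma residue_of_fixed u :
  exists2 r : S, (forall g, g \in P -> a g r = r) & res r = u.
Proof.
apply/boolp.asboolP; change (u \in fixed_res).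
have [q [qF qmon qu qmin] qsep] := a_sep u.
apply: (separable_root_in_subfield (E := fixed_res) Pp _ _ qsep qu).
  apply/boolp.asboolP; exists (\prod_(g in P) a g (res_repr u)).
    move=> h hP; rewrite rmorph_prod [RHS](reindex_inj (mulgI h)) /=.
    by apply: eq_big => g; rewrite ?groupMl // -ractM.
  have -> : u ^+ #|P| = \prod_(g in P) u by rewrite prodr_const.
  rewrite (rmorph_prod (@res S)); apply: eq_bigr => g gP /=.
  by have /inertiaP/(_ u) := subsetP PI _ gP.
move=> i; have [r rF rE] := qF i; by apply/boolp.asboolP; exists r.
Qed.

End ResidueOfFixed.

(** * Twisted group algebras of p-groups *)

Section PGroupRepresentation.
Variables (F : fieldType) (gT : finGroupType) (G : {group gT}).
Hypothesis Gp : [pchar F].-nat #|G|.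

(** In characteristic zero the hypothesis on [#|G|] makes [G] trivial and everything is fixed;
    otherwise this is the fixed point theorem for p-groups in characteristic [p]. *)
Lemma rfix_pchar_neq0 n (rG : mx_representation F G n) :
  (0 < n)%N -> rfix_mx rG G != 0.
Proof.
move=> n0; have [G1|nG1] := eqVneq (G : {set gT}) 1%g.
  have : (1%:M <= rfix_mx rG G)%MS.
    by apply/rfix_mxP => x xG; have /set1P -> : x \in (1%g : {set gT});
      rewrite -?G1 // repr_mx1 mulmx1.
  apply: contraTneq => ->; rewrite submx0 -mxrank_eq0 mxrank1.
  by rewrite -lt0n.
have /pdivP[p p_pr pG] : (1 < #|G|)%N by rewrite cardG_gt1.
have pF : p \in [pchar F] by apply: (pnatPpi Gp);
  rewrite mem_primes p_pr cardG_gt0.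
apply: (rfix_pgroup_pchar pF) => //.
by rewrite /pgroup -(eq_pnat _ (pcharf_eq pF)).
Qed.

(** Unless [U] is everything, a nonzero fixed vector of the quotient by [U] is pulled back and added
    to [U]. *)
Lemma fixed_extension n (rG : mx_representation F G n) (U : 'M[F]_n) :
  mxmodule rG U -> exists U' : 'M[F]_n, [/\ mxmodule rG U',
    forall g, g \in G -> (U' *m (rG g - 1%:M) <= U)%MS
    & (minn n (\rank U).+1 <= \rank U')%N].
Proof.
move=> modU; have [fullU|nfull] := boolP (row_full U).
  exists U; split=> // [g _|]; first exact: submx_full.
  by move/eqnP: fullU => ->; apply: geq_minl.
have cU : (0 < \rank (cokermx U))%N.
  by rewrite mxrank_coker subn_gt0 ltn_neqAle rank_leq_col andbT.
have := rfix_pchar_neq0 (factmod_repr modU) cU.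
set W := rfix_mx _ _; rewrite -nz_row_eq0; set w := nz_row W => w0.
have wW : (w <= W)%MS by apply: nz_row_sub.
pose v := val_factmod w; pose U' := (U + v)%MS.
have vU g : g \in G -> (v *m (rG g - 1%:M) <= U)%MS.
  move=> gG; rewrite -in_factmod_eq0 mulmxBr mulmx1 linearB /=.
  rewrite (in_factmodJ modU) // val_factmodK subr_eq0.
  by move/rfix_mxP: wW => /(_ g gG) ->.
have UU g : g \in G -> (U *m (rG g - 1%:M) <= U)%MS.
  move=> gG; rewrite mulmxBr mulmx1 addmx_sub ?eqmx_opp //.
  by have /mxmoduleP := modU; apply.
have U'U g : g \in G -> (U' *m (rG g - 1%:M) <= U)%MS.
  by move=> gG; rewrite addsmxMr addsmx_sub UU ?vU.
exists U'; split=> //.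
  apply/mxmoduleP => g gG; rewrite -[rG g](subrK 1%:M) mulmxDr mulmx1.
  by rewrite addmx_sub // (submx_trans (U'U g gG)) // addsmxSl.
apply: leq_trans (geq_minr _ _) _; rewrite ltnNge; apply/negP => le_r.
have := mxrank_leqif_sup (addsmxSl U v); rewrite -/U' => eqr.
have : (U' <= U)%MS.
  by rewrite -(eq_leqif eqr) eqn_leq le_r (eqr : _ <= _)%N.
rewrite addsmx_sub => /andP[_]; rewrite -in_factmod_eq0 val_factmodK.
by rewrite (negPf w0).
Qed.

(** Iterating [fixed_extension] from [0] raises the rank at each step until it is full, so [n] steps
    suffice. *)
Lemma unipotent_filtration n (rG : mx_representation F G n) :
  exists U : nat -> 'M[F]_n, [/\ U 0%N = 0, row_full (U n)
    & forall i g, g \in G -> (U i.+1 *m (rG g - 1%:M) <= U i)%MS].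
Proof.
have next_ex : forall U : 'M[F]_n, exists U' : 'M[F]_n, mxmodule rG U ->
    [/\ mxmodule rG U',
    forall g, g \in G -> (U' *m (rG g - 1%:M) <= U)%MS
    & (minn n (\rank U).+1 <= \rank U')%N].
  move=> U; have [mU|] := boolP (mxmodule rG U); last by exists 0.
  by have [U'] := fixed_extension mU; exists U'.
have [nxt nxtP] := boolp.choice next_ex.
pose U i := iter i nxt 0.
have Umod i : mxmodule rG (U i).
  elim: i => [|i IHi]; first exact: mxmodule0.
  by have [] := nxtP _ IHi.
have Ur i : (minn n i <= \rank (U i))%N.
  elim: i => [|i IHi]; first by rewrite minn0.
  have [_ _] := nxtP _ (Umod i); apply: leq_trans.
  by rewrite leq_min geq_minl /=; move: IHi;
    rewrite !geq_min ltnS => /orP[/leqW ->|->]; rewrite ?orbT.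
exists U; split=> //.
  by rewrite -col_leq_rank; move: (Ur n); rewrite minnn.
by move=> i g gG; have [_ h _] := nxtP _ (Umod i); apply: h.
Qed.
End PGroupRepresentation.

Section TwistedPGroup.
Variables (k : fieldType) (gT : finGroupType) (b : ring_action gT k).
Hypothesis b_triv : forall g, b g =1 id.
Hypothesis qp : [pchar k].-nat #|gT|.
Variable f : cocycle2 b.
Local Notation q := #|gT|.
Implicit Types x y : crossed f.

(** A cochain with coboundary [f^q], where [q] is the order of the group. *)
Definition coc_trace g : k := \prod_h f g h.

Lemma coc_trace_neq0 g : coc_trace g != 0.
Proof. by apply/prodf_neq0 => h _; rewrite -unitfE coc_unit. Qed.

(** The cocycle identity multiplied over its third variable, the action being trivial. *)
Lemma coc_traceM g h : f g h ^+ q * coc_trace (g * h)%g =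
  coc_trace g * coc_trace h.
Proof.
have -> : f g h ^+ q = \prod_(l : gT) f g h by rewrite prodr_const.
rewrite [in RHS]mulrC -big_split [X in _ * X](reindex_inj (mulgI h))
  -big_split /=.
by apply: eq_bigr => l _; rewrite cocA b_triv.
Qed.

(* Raising the coefficients to the power #|G| turns f into a coboundary.      *)
Section FrobeniusTwist.
Variables (R : algType k) (rho : gT -> R).
Hypotheses (rho1 : rho 1%g = 1) (rhoM : forall g h,
  rho (g * h)%g = rho g * rho h).

Definition frobenius_twist x : R := \sum_g (x g ^+ q * coc_trace g) *: rho g.

Lemma frobenius_twistB : zmod_morphism frobenius_twist.
Proof.
move=> x y; rewrite -sumrB; apply: eq_bigr => g _.
by rewrite !ffunE exprDn_pchar // exprNn_pchar // -scalerBl mulrBl.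
Qed.

Lemma frobenius_twist_crU s g : frobenius_twist (crU f s g) =
  (s ^+ q * coc_trace g) *: rho g.
Proof.
rewrite /frobenius_twist (bigD1 g) //= ffunE eqxx big1 ?addr0 // => h /negPf hg.
rewrite ffunE hg expr0n; have -> : (q == 0)%N = false.
  by apply/negbTE; rewrite -lt0n; apply/card_gt0P; exists 1%g.
by rewrite mul0r scale0r.
Qed.

Lemma frobenius_twistM : monoid_morphism frobenius_twist.
Proof.
pose ftR := HB.pack_for {additive crossed f -> R} frobenius_twist
  (GRing.isZmodMorphism.Build _ _ _ frobenius_twistB).
have ftE : frobenius_twist = ftR by [].
split=> [|x y].
  rewrite -[1]/(crU f 1 1%g) frobenius_twist_crU expr1n mul1r rho1.
  by rewrite /coc_trace big1 ?scale1r // => h _; rewrite coc1g.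
rewrite [x]cr_sumU [y]cr_sumU mulr_suml ftE !raddf_sum mulr_suml.
apply: eq_bigr => g _; rewrite !mulr_sumr raddf_sum; apply: eq_bigr => h _.
rewrite -ftE crUM !frobenius_twist_crU b_triv rhoM !exprMn.
rewrite -scalerAl -scalerAr scalerA; congr (_ *: _).
by rewrite -!mulrA coc_traceM; rewrite !mulrA; congr (_ * _); rewrite mulrAC.
Qed.
End FrobeniusTwist.

(** [eps] is the Frobenius twist of the trivial representation. The filtration [V] is pulled back
    from the unipotent filtration of the regular representation, whose faithfulness gives [V 0 = 0];
    so the kernel of [eps] is nilpotent. *)
Lemma twisted_pgroup_augmentation :
  exists (eps : {rmorphism crossed f -> k}) (N : nat) (V : nat -> crossed f ->
    Prop),
  [/\ forall s, eps (crU f s 1%g) = s ^+ q,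
      forall x, V N x, forall x, V 0%N x -> x = 0,
      forall i, V i 0 /\ forall x y, V i x -> V i y -> V i (x + y)
    & forall i x y, V i.+1 x -> eps y = 0 -> V i (x * y)].
Proof.
pose one (g : gT) : k^o := 1.
have oneM g h : one (g * h)%g = one g * one h by rewrite mulr1.
pose epsK := HB.pack_for {rmorphism crossed f -> k^o} (frobenius_twist one)
  (GRing.isZmodMorphism.Build _ _ _ (@frobenius_twistB k^o one))
  (GRing.isMonoidMorphism.Build _ _ _ (@frobenius_twistM k^o one erefl oneM)).
pose eps : {rmorphism crossed f -> k} := epsK.
have epsE x : eps x = \sum_g x g ^+ q * coc_trace g.
  by apply: eq_bigr => g _; rewrite /one; apply: mulr1.
pose G := [set: gT]%G.
have Gp : [pchar k].-nat #|G| by rewrite cardsT.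
(* The successor form makes the square matrices of this size a ring. *)
have [n nG] : exists n, #|G| = n.+1 by exists #|G|.-1;
  rewrite prednK ?cardG_gt0.
have [rG rGinj] : exists rG : mx_representation k G n.+1,
    forall c : gT -> k, \sum_g c g *: rG g = 0 -> forall g, c g = 0.
  rewrite -nG; exists (regular_repr k G) => c c0 g.
  have := congr1 (fun M : 'M_#|G| =>
    M (gring_index G 1%g) (gring_index G g)) c0.
  rewrite summxE mxE (bigD1 g) //= big1 ?addr0 => [|h hg].
    rewrite !mxE gring_indexK ?group1 // mul1g !eqxx /= mulr1; exact.
  rewrite !mxE gring_indexK ?group1 // mul1g eqxx /=.
  case: eqP => [/(congr1 (@enum_val _ _))|_]; last by rewrite mulr0.
  by rewrite !gring_indexK ?inE // => gh; rewrite gh eqxx in hg.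
have rG1 : rG 1%g = 1 by rewrite repr_mx1.
have rGM g h : rG (g * h)%g = rG g * rG h by rewrite repr_mxM ?inE.
pose Th := HB.pack_for {rmorphism crossed f -> 'M[k]_n.+1} (frobenius_twist rG)
  (GRing.isZmodMorphism.Build _ _ _ (@frobenius_twistB _ rG))
  (GRing.isMonoidMorphism.Build _ _ _ (@frobenius_twistM _ rG rG1 rGM)).
have [U [U0 Un Ustep]] := unipotent_filtration Gp rG.
exists eps, n.+1, (fun i x => (Th x <= U i)%MS); split.
- move=> s; rewrite epsE (bigD1 1%g) //= ffunE eqxx big1 ?addr0.
    by rewrite /coc_trace big1 ?mulr1 // => h _; rewrite coc1g.
  move=> g /negPf g1; rewrite ffunE g1 expr0n; have -> : (q == 0)%N = false.
    by apply/negbTE; rewrite -lt0n; apply/card_gt0P; exists 1%g.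
  by rewrite mul0r.
- by move=> x; apply: submx_full.
- move=> x; rewrite U0 submx0 => /eqP /rGinj x0; apply/ffunP => g.
  have /eqP := x0 g; rewrite mulf_eq0 (negPf (coc_trace_neq0 g)) orbF.
  by rewrite expf_eq0 => /andP[_ /eqP ->]; rewrite ffunE.
- move=> i; split=> [|x y xU yU]; first by rewrite rmorph0 sub0mx.
  by rewrite rmorphD addmx_sub.
move=> i x y xU y0; rewrite rmorphM; apply: submx_trans (submxMr _ xU) _.
(* As [eps y = 0], each [rG g] may be replaced by [rG g - 1], which lowers the filtration. *)
have -> : Th y = \sum_g (y g ^+ q * coc_trace g) *: (rG g - 1%:M).
  under eq_bigr => g _ do rewrite scalerBr.
  by rewrite sumrB -scaler_suml -epsE y0 scale0r subr0.
rewrite mulmx_sumr; apply: summx_sub => g _.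
by rewrite -scalemxAr scalemx_sub // Ustep ?inE.
Qed.

End TwistedPGroup.

(** * The augmentation ideal of a wild crossed product *)

Lemma Cayley_Hamilton_iter (R : comNzRingType) n (M : 'M[R]_n) (v : nat ->
  'rV[R]_n) :
  (forall i, v i.+1 = v i *m M) -> \sum_(i < n.+1) (char_poly M)`_i *: v i = 0.
Proof.
case: n M v => [|n] M v vM; first by apply/rowP => -[].
have vE i : v i = v 0%N *m (M ^+ i).
  elim: i => [|i IHi]; first by rewrite expr0 mulmx1.
  by rewrite vM IHi exprSr mulmxA.
have := Cayley_Hamilton M; rewrite /horner_mx /horner_morph.
rewrite (@horner_coef_wide _ n.+2); last first.
  by apply: leq_trans (size_poly _ _) _; rewrite size_char_poly.
move=> /(congr1 (mulmx (v 0%N))); rewrite mulmx0 => e;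
  rewrite -[RHS]e mulmx_sumr.
apply: eq_bigr => i _; rewrite coef_map /= vE.
by rewrite scalemxAr -mul_scalar_mx.
Qed.

Lemma char_poly_conj (R : idomainType) n (M M' E : 'M[R]_n) :
  \det E != 0 -> M' *m E = E *m M -> char_poly M' = char_poly M.
Proof.
move=> E0 EM; rewrite /char_poly;
  apply: (mulIf (_ : \det (map_mx polyC E) != 0)).
  by rewrite det_map_mx polyC_eq0.
rewrite -det_mulmx [RHS]mulrC -det_mulmx /char_poly_mx mulmxBl mulmxBr.
by rewrite -!map_mxM EM scalar_mxC.
Qed.

Lemma geometric_sum (R : nzRingType) (x : R) N :
  (\sum_(i < N) x ^+ i) * (1 - x) = 1 - x ^+ N.
Proof.
elim: N => [|N IHN]; first by rewrite big_ord0 mul0r subrr.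
by rewrite big_ord_recr /= mulrDl IHN mulrBr mulr1 -exprSr addrA subrK.
Qed.

(** * Matrices and characteristic polynomials of right multiplications *)

Section RightMultiplication.
Variables (S : idomainType) (gT : finGroupType) (a : ring_action gT S).
Variable f : cocycle2 a.
Local Notation n := #|gT|.
Implicit Types x y : crossed f.

Definition coords x : 'rV[S]_n := \row_i x (enum_val i).
Definition of_coords (v : 'rV[S]_n) : crossed f := [ffun g =>
  v 0 (enum_rank g)].
Definition rmul_mx x : 'M[S]_n := \matrix_i coords (crU f 1 (enum_val i) * x).

Lemma coordsK : cancel coords of_coords.
Proof. by move=> x; apply/ffunP => g; rewrite ffunE mxE enum_rankK. Qed.

Lemma of_coordsK : cancel of_coords coords.
Proof. by move=> v; apply/rowP => i; rewrite mxE ffunE enum_valK. Qed.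

Lemma coords_is_zmod_morphism : zmod_morphism coords.
Proof. by move=> x y; apply/rowP => i; rewrite !mxE !ffunE. Qed.
HB.instance Definition _ :=
  GRing.isZmodMorphism.Build _ _ coords coords_is_zmod_morphism.

Lemma coords_crU1 s x : coords (crU f s 1%g * x) = s *: coords x.
Proof. by apply/rowP => i; rewrite !mxE crU1_mulE. Qed.

Lemma coordsM y x : coords (y * x) = coords y *m rmul_mx x.
Proof.
rewrite mulmx_sum_row [y in LHS]cr_sumU mulr_suml raddf_sum.
rewrite (reindex (@enum_val gT predT)) /=; last first.
  by exists enum_rank => g _; rewrite ?enum_valK ?enum_rankK.
by apply: eq_bigr => i _; rewrite rowK crU_split -mulrA coords_crU1 mxE.
Qed.

Lemma rmul_mxM x y : rmul_mx (x * y) = rmul_mx x *m rmul_mx y.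
Proof. by apply/row_matrixP => i; rewrite rowK mulrA coordsM row_mul rowK. Qed.

Lemma left_inverse_det x : \det (rmul_mx x) \is a GRing.unit -> exists y,
  y * x = 1.
Proof.
move=> xU; exists (of_coords (coords 1 *m invmx (rmul_mx x))).
by apply: (can_inj coordsK); rewrite coordsM of_coordsK mulmxKV ?unitmxE.
Qed.

Lemma rmul_det_rreg x y : \det (rmul_mx x) != 0 -> y * x = 0 -> y = 0.
Proof.
move=> x0 /(congr1 coords); rewrite coordsM raddf0.
move=> /(congr1 (mulmxr (\adj (rmul_mx x)))) /=.
rewrite -mulmxA mul_mx_adj mul_mx_scalar mul0mx => /rowP y0.
apply: (can_inj coordsK); rewrite raddf0; apply/rowP => i.
by apply/eqP; have /eqP := y0 i; rewrite !mxE mulf_eq0 (negPf x0).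
Qed.

Lemma rmul_det_neq0M x y : \det (rmul_mx (x * y)) != 0 ->
  \det (rmul_mx x) != 0 /\ \det (rmul_mx y) != 0.
Proof. by rewrite rmul_mxM det_mulmx mulf_eq0 negb_or => /andP. Qed.

Lemma rmul_charpoly x :
  \sum_(i < n.+1) crU f (char_poly (rmul_mx x))`_i 1%g * x ^+ i = 0.
Proof.
apply: (can_inj coordsK); rewrite raddf0 raddf_sum /=.
under eq_bigr => i _ do rewrite coords_crU1.
apply: (@Cayley_Hamilton_iter _ _ (rmul_mx x) (fun i => coords (x ^+ i))) => i.
by rewrite exprSr coordsM.
Qed.

(** Left multiplication by [U_g] is semilinear and commutes with right multiplication by [x], so [E]
    conjugates the matrix of [x] to its image under [a g]. *)
Lemma rmul_charpoly_fixed x i : forall g,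
  a g (char_poly (rmul_mx x))`_i = (char_poly (rmul_mx x))`_i.
Proof.
move=> g.
pose E : 'M[S]_n := \matrix_i coords (crU f 1 g * crU f 1 (enum_val i)).
have semi y : coords (crU f 1 g * y) = map_mx (a g) (coords y) *m E.
  rewrite mulmx_sum_row [y in LHS]cr_sumU mulr_sumr raddf_sum.
  rewrite (reindex (@enum_val gT predT)) /=; last first.
    by exists enum_rank => h _; rewrite ?enum_valK ?enum_rankK.
  apply: eq_bigr => j _; rewrite rowK -coords_crU1 !mxE; congr coords.
  by rewrite !crUM mul1g ract1 coc1g !(mulr1, mul1r, rmorph1).
have detE : \det E != 0.
  have [t [tU st ts]] := crU_inv f g (unitr1 S).
  pose Y : 'M[S]_n := \matrix_i map_mx (a g) (coords (crU f t g^-1%g * crU f 1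
    (enum_val i))).
  have YE : Y *m E = 1%:M.
    apply/row_matrixP => j; rewrite row_mul rowK -semi mulrA st mul1r.
    apply/rowP => l; rewrite !mxE ffunE (inj_eq enum_val_inj) eq_sym.
    by case: eqP.
  have := congr1 determinant YE; rewrite det_mulmx det1 => e.
  by apply: contraTneq (oner_neq0 S) => E0; rewrite -e E0 mulr0 eqxx.
rewrite -coef_map map_char_poly.
suff /(char_poly_conj detE) -> : map_mx (a g) (rmul_mx x) *m E =
  E *m rmul_mx x by [].
apply/row_matrixP => j; rewrite !row_mul -map_row !rowK -semi mulrA.
by rewrite coordsM.
Qed.

End RightMultiplication.

(** * Units and the augmentation ideal in a wild crossed product *)

Section LocalAnalysis.
Variables (S : dvrType) (gT : finGroupType) (a : ring_action gT S).
Hypothesis a_faithful : faithful_action a.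
Hypothesis res_full : forall u : residue S, res_fixed a u.
Variable f : cocycle2 a.
Local Notation T := (crossed f).
Local Notation n := #|gT|.
Local Notation pi := (uniformizer S).
Local Notation p := (crU f pi 1%g).

(** Modulo [pi] the matrix is the identity; this makes every [1 - p t] left invertible. *)
Lemma rmul_det_1B t : \det (rmul_mx (1 - p * t)) \is a GRing.unit.
Proof.
rewrite -[_ \is a _]negbK -res_eq0.
have -> : res (\det (rmul_mx (1 - p * t))) =
  \det (map_mx (@res S) (rmul_mx (1 - p * t))).
  by rewrite det_map_mx.
suff -> : map_mx (@res S) (rmul_mx (1 - p * t)) =
  1%:M by rewrite det1 oner_neq0.
apply/matrixP => i j; rewrite !mxE mulrBr mulr1 mulrA.
have [s ->] := crU_pi_swapr (f := f) (crU f 1 (enum_val i)).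
rewrite -mulrA ffunE [X in _ + X]ffunE crU1_mulE ffunE rmorphB rmorphM /=.
have /eqP -> : res pi == 0 by rewrite res_eq0 uniformizer_nonunit.
rewrite mul0r subr0 (inj_eq enum_val_inj) eq_sym.
by case: eqP; rewrite ?rmorph1 ?rmorph0.
Qed.

Variables (eps : {rmorphism crossed (res_cocycle f) -> residue S}) (N : nat).
Variable V : nat -> crossed (res_cocycle f) -> Prop.
Hypothesis epsE : forall s, eps (crU (res_cocycle f) s 1%g) = s ^+ n.
Hypothesis V_top : forall x, V N x.
Hypothesis V_bot : forall x, V 0%N x -> x = 0.
Hypothesis V0 : forall i, V i 0.
Hypothesis VD : forall i x y, V i x -> V i y -> V i (x + y).
Hypothesis VM : forall i x y, V i.+1 x -> eps y = 0 -> V i (x * y).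

Local Notation E x := (eps (red x)).

Lemma aug_pi_mul x : E (p * x) = 0.
Proof.
have /red_eq0 -> : exists y, p * x = p * y by exists x.
exact: rmorph0.
Qed.

Lemma aug_nilp x : E x = 0 -> exists t, x ^+ N = p * t.
Proof.
move=> x0; apply/red_eq0/V_bot.
suff : forall j, (j <= N)%N -> V (N - j) (red (x ^+ j)).
  by move=> /(_ N (leqnn N)); rewrite subnn.
elim=> [|j IHj] lt_j; first by rewrite subn0.
by rewrite exprSr rmorphM; apply: VM => //; rewrite subnSK //; apply/IHj/ltnW.
Qed.

(** On scalars [eps] is the [n]-th power, so [z^n] divided by a suitable scalar has augmentation
    [1]. It then differs from [1] by an element nilpotent modulo [p], and a geometric series inverts
    it on the left, up to a factor [1 - p t]. *)
Lemma aug_unit x : E x != 0 -> exists y, y * x = 1 /\ x * y = 1.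
Proof.
have n0 : (0 < n)%N by apply/card_gt0P; exists 1%g.
have linv z : E z != 0 -> exists y, y * z = 1.
  move=> z0; pose s := res_repr (E z).
  have sE : res s = E z by apply: res_reprK.
  have sU : s \is a GRing.unit by rewrite -[_ \is a _]negbK -res_eq0 sE.
  pose z' := crU f s^-1 1%g * z ^+ n.
  have z'1 : E (1 - z') = 0.
    rewrite !rmorphB !rmorph1 rmorphM rmorphM /= red_crU epsE !rmorphXn /= -sE.
    by rewrite -exprMn -rmorphM mulVr // rmorph1 expr1n subrr.
  have [t tE] := aug_nilp z'1.
  have [y yE] := left_inverse_det (rmul_det_1B t).
  exists (y * (\sum_(i < N) (1 - z') ^+ i) * crU f s^-1 1%g * z ^+ n.-1).
  rewrite -!mulrA -exprSr prednK // -/z'.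
  rewrite -[RHS]yE; congr (_ * _).
  by rewrite -{2}[z'](subKr 1) geometric_sum tE.
move=> x0; have [y yx] := linv x x0.
have y0 : E y != 0.
  apply: contraTneq (oner_neq0 (residue S)) => y0.
  by rewrite -(rmorph1 eps) -(rmorph1 (@red _ _ _ f)) -yx !rmorphM /= y0 mul0r
    eqxx.
have [z zy] := linv y y0; exists y; split=> //.
by have -> : x = z by rewrite -[x]mul1r -zy -mulrA yx mulr1.
Qed.


Lemma aug_mulr x y : E x = 0 -> E (x * y) = 0.
Proof. by move=> x0; rewrite !rmorphM /= x0 mul0r. Qed.

Lemma aug_mull x y : E y = 0 -> E (x * y) = 0.
Proof. by move=> y0; rewrite !rmorphM /= y0 mulr0. Qed.

Lemma rmul_det_pi : \det (rmul_mx p) != 0.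
Proof.
have -> : rmul_mx p = diag_mx (\row_i a (enum_val i) pi).
  apply/matrixP => i j; rewrite !mxE mul_crU1E ffunE (inj_eq enum_val_inj)
    eq_sym.
  by case: eqP => [->|_]; rewrite ?mul1r ?mul0r ?mulr1n ?mulr0n.
rewrite det_diag; apply/prodf_neq0 => i _; rewrite mxE.
by apply: contraNneq (uniformizer_neq0 S) => e0;
  rewrite -[pi](ractK a (enum_val i)) e0 rmorph0.
Qed.

Section PrincipalAugmentation.
Variable w : T.
Hypotheses (w0 : E w = 0) (wJ : forall x, E x = 0 -> exists y, x = y * w).
Hypothesis w_det : \det (rmul_mx w) != 0.

Lemma w_rreg x i : x * w ^+ i = 0 -> x = 0.
Proof.
elim: i x => [|i IHi] x; first by rewrite mulr1.
by rewrite exprS mulrA => /IHi; apply: rmul_det_rreg.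
Qed.

Lemma aug_1 : E 1 = 1. Proof. by rewrite !rmorph1. Qed.

(** [w t'] lies in the augmentation ideal, hence is [t1 w]. If [t1] were in that ideal, inverting
    [t'] would put [w] among the left multiples of [w^2], and cancelling [w] would put [1] in the
    ideal. *)
Lemma w_swap t i : E t != 0 -> exists2 t', E t' != 0 & w ^+ i * t = t' * w ^+ i.
Proof.
move=> t0; elim: i => [|i [t' t'0 IHi]]; first by exists t;
  rewrite ?mulr1 ?mul1r.
have [t1 t1E] : exists t1, w * t' = t1 * w by apply/wJ/aug_mulr.
exists t1; last by rewrite exprS -mulrA IHi mulrA t1E -mulrA.
apply/eqP => /wJ[t2 t2E].
have [v [_ tv]] := aug_unit t'0.
have [t3 t3E] : exists t3, w * v = t3 * w by apply/wJ/aug_mulr.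
have [t4 t4E] : exists t4, w * t3 = t4 * w by apply/wJ/aug_mulr.
have : (1 - t2 * t4 * w) * w ^+ 1 = 0.
  rewrite expr1 mulrBl mul1r -{1}[w]mulr1 -tv [w * (_ * _)]mulrA t1E t2E.
  by rewrite -!mulrA t3E (mulrA w t3) t4E -!mulrA subrr.
move=> /w_rreg/eqP; rewrite subr_eq0 => /eqP e1.
have : E 1 = 0 by rewrite e1; apply: aug_mull.
by rewrite aug_1; apply/eqP; apply: oner_neq0.
Qed.

(** The term of least exponent dominates: after cancelling its power of [w], the sum has nonzero
    augmentation. *)
Lemma w_unit_sum (I : finType) (P : pred I) (t : I -> T) (d : I -> nat) i0 :
  P i0 -> (forall i, P i -> E (t i) != 0) ->
  (forall i j, P i -> P j -> d i = d j -> i = j) ->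
  \sum_(i | P i) t i * w ^+ d i = 0 -> False.
Proof.
move=> Pi0 tU d_inj; case: (arg_minnP d Pi0) => i Pi imin.
rewrite (bigD1 i) //=.
have -> : \sum_(j | P j && (j != i)) t j * w ^+ d j =
  (\sum_(j | P j && (j != i)) t j * w ^+ (d j - d i)) * w ^+ d i.
  rewrite mulr_suml; apply: eq_bigr => j /andP[Pj _].
  by rewrite -mulrA -exprD subnK // imin.
rewrite -mulrDl => /w_rreg /(congr1 (fun x => E x)).
rewrite !rmorphD /= !rmorph_sum big1 /= => [|j /andP[Pj ji]].
  by rewrite addr0 !rmorph0 => /eqP; rewrite (negPf (tU _ Pi)).
have lt_ij : (d i < d j)%N.
  rewrite ltn_neqAle imin // andbT; apply: contraNneq ji => dij.
  by apply/eqP/d_inj.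
by apply: aug_mull; rewrite -(prednK (_ :
  0 < d j - d i)%N) ?subn_gt0 // exprS; apply: aug_mulr.
Qed.

(* w is a root of a monic polynomial of degree n = #|gT| with coefficients    *)
(* fixed by the group. If pi = t w^m with m > 1 then the terms of this        *)
(* relation have pairwise distinct w-adic valuations, as the valuations of    *)
(* fixed elements are multiples of n m.                                       *)
Lemma principal_augmentation x : E x = 0 -> exists y, x = p * y.
Proof.
have p0 : E p = 0 by have := aug_pi_mul 1; rewrite mulr1.
have [t0 t0E] := aug_nilp w0.
(* The exponent [m] is chosen maximal; it is at most [N] because [w^N] is already a multiple of [p].
   Maximality then makes the cofactor [t] a unit. *)
pose Q m := boolp.asbool (exists s, p = s * w ^+ m).
have Q1 : exists m, Q m.
  by exists 1%N; apply/boolp.asboolP; have [s ->] := wJ p0; exists s;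
    rewrite expr1.
have QN m : Q m -> (m <= N)%N.
  move=> /boolp.asboolP[s sE]; rewrite leqNgt; apply/negP => lt_Nm.
  have [s' s'E] := crU_pi_swapr (f := f) s.
  have : p * (s' * (t0 * w ^+ (m - N))) = p * 1.
    rewrite mulrA -s'E mulr1 -mulrA (mulrA p) -t0E -exprD subnKC;
      first by rewrite -sE.
    exact: ltnW.
  move=> /crU_pi_lmul e1; have : E 1 = 0.
    rewrite -e1; do 2!apply: aug_mull.
    by rewrite -(prednK (_ : 0 < m - N)%N) ?subn_gt0 // exprS; apply: aug_mulr.
  by rewrite aug_1; apply/eqP; apply: oner_neq0.
case: (ex_maxnP Q1 QN) => m /boolp.asboolP[t tE] mmax.
have m_gt0 : (0 < m)%N.
  by apply: mmax; apply/boolp.asboolP; have [s ->] := wJ p0; exists s;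
    rewrite expr1.
have tU : E t != 0.
  apply/eqP => /wJ[s sE]; have : (m.+1 <= m)%N.
    by apply: mmax; apply/boolp.asboolP; exists s; rewrite exprS mulrA -sE.
  by rewrite ltnn.
have [m1|m1] := eqVneq m 1%N.
  have [v [vt _]] := aug_unit tU.
  have wE : w = v * p by rewrite tE m1 expr1 mulrA vt mul1r.
  move=> x0; have [y ->] := wJ x0; have [z zE] := crU_pi_swapr (f := f) (y * v).
  by exists z; rewrite -zE -mulrA -wE.
have {m1 m_gt0} m2 : (1 < m)%N by rewrite ltn_neqAle eq_sym m1.
have pX e : exists2 te, E te != 0 & p ^+ e = te * w ^+ (m * e).
  elim: e => [|e [te te0 IHe]]; first by exists 1;
    rewrite ?muln0 ?mulr1 ?aug_1 ?oner_neq0.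
  have [t' t'0 t'E] := w_swap (m * e) tU.
  exists (te * t'); first by rewrite !rmorphM /= mulf_neq0.
  by rewrite exprSr IHe {1}tE -mulrA (mulrA _ t) t'E -!mulrA -exprD mulnS addnC.
pose chi := char_poly (rmul_mx w).
(* A fixed [c] is a unit times [pi^e] with [n] dividing [e], so its [w]-adic valuation is a multiple
   of [n m]. *)
have fixP c : c != 0 -> (forall g, a g c = c) -> exists te : T * nat,
    E te.1 != 0 /\ crU f c 1%g = te.1 * w ^+ (n * m * te.2).
  move=> c0 cF; have [u [e [uU cE]]] := dvr_factor c0.
  have /dvdnP[d dE] : (n %| e)%N.
    by apply: (card_dvd_valuation a_faithful res_full uU); rewrite -cE.
  have [te te0 pe] := pX e; exists (crU f u 1%g * te, d) => /=; split.
    rewrite !rmorphM /= mulf_neq0 // red_crU epsE expf_neq0 //.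
    by rewrite res_eq0 uU.
  by rewrite cE -crU1M -crU1X pe mulrA dE; congr (_ * _ ^+ _);
    rewrite mulnCA mulnC [(m * n)%N]mulnC.
have chiP (i : 'I_n.+1) : exists te : T * nat, chi`_i != 0 ->
    E te.1 != 0 /\ crU f chi`_i 1%g = te.1 * w ^+ (n * m * te.2).
  have [c0|c0] := eqVneq chi`_i 0; first by exists (0, 0%N).
  have [te teP] := fixP _ c0 (rmul_charpoly_fixed w i); by exists te.
have [te teP] := boolp.choice chiP.
exfalso.
have chin : chi`_n != 0.
  have /eqP := char_poly_monic (rmul_mx w);
    rewrite lead_coefE size_char_poly /= => ->.
  exact: oner_neq0.
have n0 : (0 < n)%N by apply/card_gt0P; exists 1%g.
apply: (@w_unit_sum _ (fun i : 'I_n.+1 => chi`_i != 0) (fun i => (te i).1)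
  (fun i => n * m * (te i).2 + i)%N ord_max) => //.
- by move=> i /teP[].
(* The exponents are congruent to [i] modulo [n m], and [i <= n < n m] since [m > 1]. *)
- move=> i j _ _ /(congr1 (modn^~ (n * m)%N));
    rewrite ![(n * m * _)%N]mulnC !modnMDl.
  have lt_nm (l : 'I_n.+1) : (l < n * m)%N.
    apply: leq_ltn_trans (_ : n < _)%N; first by rewrite -ltnS.
    by rewrite -{1}[n]muln1 ltn_pmul2l.
  by rewrite !modn_small // => /ord_inj.
rewrite -[RHS](rmul_charpoly w) [RHS](bigID (fun i : 'I_n.+1 =>
  chi`_i != 0)) /=.
rewrite [X in _ = _ + X]big1 ?addr0 => [|i /negPn/eqP ->];
  last by rewrite crU0 mul0r.
by apply: eq_bigr => i ci; have [_ ->] := teP i ci; rewrite exprD mulrA.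
Qed.
End PrincipalAugmentation.

(* Either the trace ideal of the augmentation ideal J lies in J, in which     *)
(* case J = J^2 is zero modulo pi, or J is a principal left ideal.            *)
Lemma projective_augmentation (I : finType) (phi : I -> T -> T) (xs : I -> T) :
  (forall i, E (xs i) = 0) ->
  (forall i b x y, E x = 0 -> E y = 0 -> phi i (b * x + y) =
    b * phi i x + phi i y) ->
  (forall x, E x = 0 -> x = \sum_i phi i x * xs i) ->
  forall x, E x = 0 -> red x = 0.
Proof.
move=> xs0 philin dual x x0.
have [trJ|] := boolp.EM (forall i y, E y = 0 -> E (phi i y) = 0).
  (* Each expansion [y = \sum_i phi i y * xs i] has both factors in the augmentation ideal, so every
     round gains one step of the filtration. *)
  apply: V_bot; suff /(_ N (leqnn N)) : forall j, (j <= N)%N ->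
      forall y, E y = 0 -> V (N - j) (red y) by rewrite subnn; apply.
  elim=> [|j IHj] lt_j y y0; first by rewrite subn0.
  rewrite (dual y y0) rmorph_sum; elim/big_rec: _ => // i z _ Vz.
  apply: VD => //; rewrite rmorphM; apply: VM; last exact: xs0.
  by rewrite subnSK //; apply: IHj (ltnW lt_j) _ (trJ i y y0).
move=> /boolp.existsNP[i /boolp.existsNP[y /boolp.not_implyP[y0 /eqP phiy]]].
have [t [ty _]] := aug_unit phiy.
have phiM b z : E z = 0 -> phi i (b * z) = b * phi i z.
  move=> z0; have e0 : E 0 = 0 by rewrite !rmorph0.
  have phi0 : phi i 0 = 0.
    have := philin i 1 0 0 e0 e0; rewrite !mul1r addr0 => e.
    by apply: (addrI (phi i 0)); rewrite -e addr0.
  by have := philin i b z 0 z0 e0; rewrite !addr0 phi0 addr0.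
(* Scaling by the inverse of the unit [phi i y] normalizes [phi i w] to [1]. *)
pose w := t * y.
have w0 : E w = 0 by apply: aug_mull.
have phiw : phi i w = 1 by rewrite phiM.
have p0 : E p = 0 by have := aug_pi_mul 1; rewrite mulr1.
have [w' w'E] := crU_pi_swapl (f := f) w.
have det_phip : \det (rmul_mx (phi i p)) != 0.
  have : p = w' * phi i p by rewrite -phiM // -w'E phiM // phiw mulr1.
  by move=> e; have := rmul_det_pi; rewrite {1}e => /rmul_det_neq0M[].
(* The difference [d] is killed by [phi i]. Writing [p d = d' p] gives [d' * phi i p = 0], where
   [phi i p] can be cancelled, so [p d] and [d] vanish. *)
have Jw z : E z = 0 -> z = phi i z * w.
  move=> z0; apply/eqP; rewrite -subr_eq0; apply/eqP.
  set d := z - _; have d0 : E d = 0.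
    by rewrite !rmorphB /= z0 (aug_mull (phi i z) w0) subr0.
  have phid : phi i d = 0.
    have -> : d = - phi i z * w + z by rewrite /d mulNr addrC.
    by rewrite philin // phiw mulr1 addNr.
  have [d' d'E] := crU_pi_swapl (f := f) d.
  have /(rmul_det_rreg det_phip) d'0 : d' * phi i p = 0.
    by rewrite -phiM // -d'E phiM // phid mulr0.
  by apply: (crU_pi_lmul (f := f)); rewrite d'E d'0 mul0r mulr0.
have w_det : \det (rmul_mx w) != 0.
  by have := rmul_det_pi; rewrite (Jw p p0) => /rmul_det_neq0M[].
apply/red_eq0; apply: (principal_augmentation w0 _ w_det) => // z z0.
by exists (phi i z); apply: Jw.
Qed.

End LocalAnalysis.

(** * Restriction to the wild inertia group *)

Section LeftIdealModule.
Variables (A : nzRingType) (L : A -> Prop) (Lid : left_ideal L).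

(** The predicate carries the proof that [L] is a left ideal so that the submodule instance can be
    attached to it. *)
Definition left_ideal_pred (_ : left_ideal L) : {pred A^o} := fun x =>
  boolp.asbool (L x).

Fact left_ideal_submod_closed : submod_closed (left_ideal_pred Lid).
Proof.
split=> [|c x y]; first by apply/boolp.asboolP; case: Lid.
move=> /boolp.asboolP Lx /boolp.asboolP Ly; apply/boolp.asboolP.
exact: left_idealMD.
Qed.

HB.instance Definition _ := GRing.isSubmodClosed.Build A A^o
  (left_ideal_pred Lid) left_ideal_submod_closed.

Record left_ideal_mod := LeftIdealMod {
  lival : A^o;
  _ : lival \in left_ideal_pred Lid
}.
HB.instance Definition _ := [isSub for lival].
HB.instance Definition _ := [Choice of left_ideal_mod by <:].
HB.instance Definition _ := [SubChoice_isSubLmodule of left_ideal_mod by <:].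

(** The dual basis lemma: projectivity splits the surjection from the free module on the generators
    [xs], and [phi] collects the coordinates of the splitting. *)
Lemma left_hereditary_dual_basis (I : finType) (xs : I -> A) :
  left_hereditary A -> (forall i, L (xs i)) ->
  (forall x, L x -> exists c : I -> A, x = \sum_i c i * xs i) ->
  exists phi : I -> A -> A,
    (forall i b x y, L x -> L y -> phi i (b * x + y) = b * phi i x + phi i y) /\
    (forall x, L x -> x = \sum_i phi i x * xs i).
Proof.
move=> hered Lxs gen.
have Lin x : L x -> x \in left_ideal_pred Lid by move=> Lx; apply/boolp.asboolP.
pose g (m : {ffun I -> A^o}) : left_ideal_mod :=
  \sum_i m i *: LeftIdealMod (Lin _ (Lxs i)).
have glin : linear g.
  move=> c u v; rewrite /g scaler_sumr -big_split; apply: eq_bigr => i _.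
  by rewrite !ffunE scalerDl scalerA.
pose gL := HB.pack_for {linear {ffun I -> A^o} -> left_ideal_mod} g
  (GRing.isLinear.Build _ _ _ _ g glin).
pose v : {linear left_ideal_mod -> A^o} := \val.
have gE m : v (g m) = \sum_i m i * xs i.
  by rewrite /g linear_sum; apply: eq_bigr => i _; rewrite linearZ.
have [|h' h'P] := hered left_ideal_mod v val_inj _ _ gL idfun.
  move=> y; have [|c cE] := gen (v y); first by apply/boolp.asboolP;
    exact: (valP y).
  exists [ffun i => c i]; apply: val_inj;
    rewrite -[LHS]/(v (g _)) gE -[RHS]/(v y) cE.
  by apply: eq_bigr => i _; rewrite ffunE.
(* The coordinates are extended by [0] outside [L]. *)
pose phi i x := match boolp.pselect (L x) with
  | left Lx => h' (LeftIdealMod (Lin x Lx)) i | right _ => 0 end.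
have phiE i x (Lx : L x) : phi i x = h' (LeftIdealMod (Lin x Lx)) i.
  rewrite /phi; case: boolp.pselect => // Lx'; congr (h' _ i); exact: val_inj.
exists phi; split=> [i b x y Lx Ly|x Lx].
  have Lxy : L (b * x + y) by apply: left_idealMD.
  rewrite !(phiE _ _ Lxy) (phiE _ _ Lx) (phiE _ _ Ly).
  have -> : LeftIdealMod (Lin _ Lxy) =
    b *: LeftIdealMod (Lin _ Lx) + LeftIdealMod (Lin _ Ly).
    exact: val_inj.
  by rewrite linearP !ffunE.
have e : v (g (h' (LeftIdealMod (Lin x Lx)))) = v (LeftIdealMod (Lin x Lx)).
  by rewrite -[g _]/(gL _) h'P.
rewrite gE in e; rewrite -[LHS]/(v (LeftIdealMod (Lin x Lx))) -e.
by apply: eq_bigr => i _; rewrite (phiE _ _ Lx).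
Qed.

End LeftIdealModule.

Section Restriction.
Variables (gT : finGroupType) (A : comUnitRingType) (a : ring_action gT A).
Variables (f : cocycle2 a) (P : {group gT}).
Variables (a' : ring_action (subg_of P) A) (f' : cocycle2 a').
Hypothesis a'E : forall g, a' g =1 a (sgval g).
Hypothesis f'E : forall g h, f' g h = f (sgval g) (sgval h).

Definition restr (x : crossed f) : crossed f' := [ffun g => x (sgval g)].
Definition extend (y : crossed f') : crossed f :=
  [ffun g => if g \in P then y (subg P g) else 0].

Lemma extendK : cancel extend restr.
Proof. by move=> y; apply/ffunP => g; rewrite !ffunE subgP sgvalK. Qed.

Lemma restrK (x : crossed f) : x \in @graded_by _ _ _ f P ->
  extend (restr x) = x.
Proof.
move=> /graded_byP xP; apply/ffunP => g; rewrite !ffunE.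
by case: ifPn => [gP|/xP //]; rewrite subgK.
Qed.

Lemma extend_graded y : extend y \in @graded_by _ _ _ f P.
Proof. by apply/graded_byP => g /negPf gP; rewrite ffunE gP. Qed.

Lemma sum_subg (F : gT -> A) : (forall g, g \notin P -> F g = 0) ->
  \sum_g F g = \sum_(h : subg_of P) F (sgval h).
Proof.
move=> F0; rewrite (bigID (mem P)) /= [X in _ + X]big1 ?addr0; last exact: F0.
rewrite (reindex_onto sgval (subg P)) => [|g gP]; last exact: subgK.
by apply: eq_bigl => h; rewrite subgP sgvalK eqxx.
Qed.

Lemma restrB x y : restr (x - y) = restr x - restr y.
Proof. by apply/ffunP => g; rewrite !ffunE. Qed.

Lemma restrD x y : restr (x + y) = restr x + restr y.
Proof. by apply/ffunP => g; rewrite !ffunE. Qed.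

Lemma restr1 : restr 1 = 1.
Proof. by apply/ffunP => g; rewrite !ffunE -val_eqE. Qed.

Lemma restr_extendl b x : restr (extend b * x) = b * restr x.
Proof.
apply/ffunP => k; rewrite ffunE !crossedME sum_subg => [|g /negPf gP].
  by apply: eq_bigr => h _; rewrite !ffunE subgP sgvalK a'E f'E.
by rewrite ffunE gP !mul0r.
Qed.

Lemma restr_extendr x b : restr (x * extend b) = restr x * b.
Proof.
apply/ffunP => k; rewrite ffunE !crossedME sum_subg => [|g gP].
  apply: eq_bigr => h _; rewrite !ffunE a'E f'E.
  rewrite groupM ?groupV ?subgP //; congr (_ * a _ (b _) * _).
  by apply: val_inj; rewrite /= subgK // groupM ?groupV ?subgP.
by rewrite !ffunE groupMr ?subgP // groupV (negPf gP) rmorph0 mulr0 mul0r.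
Qed.

Lemma extendM x y : extend (x * y) = extend x * extend y.
Proof.
rewrite -[RHS]restrK ?restr_extendl ?extendK //.
by apply: rpredM; apply: extend_graded.
Qed.

Lemma extendD x y : extend (x + y) = extend x + extend y.
Proof.
by apply/ffunP => g; rewrite !ffunE; case: ifP; rewrite ?addr0 // ffunE.
Qed.

(** The left ideal generated by [J] in the larger ring has a dual basis on the same generators.
    Composing it with [restr], a bimodule projection onto the [P]-graded part, gives one for [J]. *)
Lemma left_hereditary_restrict (J : crossed f' -> Prop) (I : finType)
    (xs : I -> crossed f') :
  left_hereditary (crossed f) -> left_ideal J -> (forall i, J (xs i)) ->
  (forall x, J x -> exists c : I -> crossed f', x = \sum_i c i * xs i) ->
  exists phi : I -> crossed f' -> crossed f',
    (forall i b x y, J x -> J y -> phi i (b * x + y) = b * phi i x + phi i y) /\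
    (forall x, J x -> x = \sum_i phi i x * xs i).
Proof.
move=> hered Jid Jxs gen.
pose L y := exists c : I -> crossed f, y = \sum_i c i * extend (xs i).
have Lid : left_ideal L.
  split.
  - by exists (fun=> 0); rewrite big1 // => i _; rewrite mul0r.
  - move=> _ _ [c ->] [d ->]; exists (fun i => c i + d i).
    by rewrite -big_split; apply: eq_bigr => i _; rewrite mulrDl.
  - move=> b _ [c ->]; exists (fun i => b * c i).
    by rewrite mulr_sumr; apply: eq_bigr => i _; rewrite mulrA.
have e0 : extend 0 = 0 by apply/ffunP => g; rewrite !ffunE if_same.
have LJ x : J x -> L (extend x).
  move=> Jx; have [c ->] := gen x Jx; exists (fun i => extend (c i)).
  rewrite (big_morph extend extendD e0); apply: eq_bigr => i _; exact: extendM.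
have Lxs i : L (extend (xs i)) by apply: LJ.
have [|phi [philin dual]] := left_hereditary_dual_basis Lid hered Lxs.
  by move=> x [c]; exists c.
exists (fun i x => restr (phi i (extend x))); split=> [i b x y Jx Jy|x Jx].
  by rewrite extendD extendM philin ?restrD ?restr_extendl //; apply: LJ.
have r0 : restr 0 = 0 by apply/ffunP => g; rewrite !ffunE.
rewrite -{1}[x]extendK {1}[extend x](dual _ (LJ _ Jx)) (big_morph restr restrD
  r0).
by apply: eq_bigr => i _; rewrite restr_extendr.
Qed.

End Restriction.

Section SubAction.
Variables (gT : finGroupType) (A : comUnitRingType) (a : ring_action gT A).
Variable P : {group gT}.

Fact sub_ract1 : a (sgval (1%g : subg_of P)) =1 id.
Proof. exact: ract1. Qed.
Fact sub_ractM (g h : subg_of P) x :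
  a (sgval (g * h)%g) x = a (sgval g) (a (sgval h) x).
Proof. exact: ractM. Qed.
Definition sub_action : ring_action (subg_of P) A :=
  @RingAction _ A (fun g => a (sgval g)) sub_ract1 sub_ractM.

Variable f : cocycle2 a.
Fact sub_coc_unit (g h : subg_of P) : f (sgval g) (sgval h) \is a GRing.unit.
Proof. exact: coc_unit. Qed.
Fact sub_coc1g (g : subg_of P) : f (sgval (1%g : subg_of P)) (sgval g) = 1.
Proof. exact: coc1g. Qed.
Fact sub_cocg1 (g : subg_of P) : f (sgval g) (sgval (1%g : subg_of P)) = 1.
Proof. exact: cocg1. Qed.
Fact sub_cocA (g h l : subg_of P) :
  f (sgval g) (sgval h) * f (sgval (g * h)%g) (sgval l)
  = sub_action g (f (sgval h) (sgval l)) * f (sgval g) (sgval (h * l)%g).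
Proof. exact: cocA. Qed.
Definition sub_cocycle : cocycle2 sub_action :=
  Cocycle2 sub_coc_unit sub_coc1g sub_cocg1 sub_cocA.

End SubAction.

(** The reduction of [L] is a finite-dimensional space over the residue field; lifts of a spanning
    family, together with [pi] at index [ord0], generate [L]. *)
Lemma left_ideal_generators (S : dvrType) (gT : finGroupType)
    (a : ring_action gT S) (f : cocycle2 a) (L : crossed f -> Prop) :
  left_ideal L -> (forall x, L (crU f (uniformizer S) 1%g * x)) ->
  exists (I : finType) (xs : I -> crossed f), (forall i, L (xs i)) /\
    forall x, L x -> exists c : I -> crossed f, x = \sum_i c i * xs i.
Proof.
move=> Lid Lpi; have [L0 LD LM] := Lid.
set p := crU f _ _ in Lpi.
pose emb (x : crossed f) : 'rV[residue S]_#|gT| := coords (red x).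
have [d [e [Le Lspan]]] := finite_spanning_family emb L.
exists 'I_d.+1, (fun i => if unlift ord0 i is Some j then e j else p); split.
  by move=> i; case: unlift => [j|//]; have := Lpi 1; rewrite mulr1.
move=> x Lx; have /submxP[c cE] := Lspan x Lx.
pose y := \sum_j crU f (res_repr (c 0 j)) 1%g * e j.
have /red_eq0[z zE] : red (x - y) = 0.
  rewrite rmorphB rmorph_sum; apply/eqP; rewrite subr_eq0; apply/eqP.
  apply: (can_inj (@coordsK _ _ _ _));
    rewrite -[LHS]/(emb x) cE mulmx_sum_row raddf_sum.
  apply: eq_bigr => j _; rewrite rowK rmorphM /= red_crU res_reprK.
  by rewrite coords_crU1.
have [z' z'E] := crU_pi_swapl z.
exists (fun i => if unlift ord0 i is Some j then crU f (res_repr (c 0 j)) 1%g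
  else z').
rewrite big_ord_recl unlift_none -z'E -zE.
under eq_bigr => j _ do rewrite liftK.
by rewrite -/y subrK.
Qed.

Section WildPart.
Variables (S : dvrType) (gT : finGroupType) (a : ring_action gT S).
Hypotheses (a_faithful : faithful_action a) (a_sep : residually_separable a).
Variables (f : cocycle2 a) (P : {group gT}).
Hypotheses (PI : P \subset inertia a) (Pp : [pchar residue S].-nat #|P|).

(** The preimage [J] of the kernel of [eps] inherits a dual basis from the larger ring, so
    [projective_augmentation] shows that it reduces to zero. *)
Theorem augmentation_injective : left_hereditary (crossed f) ->
  exists eps : {rmorphism crossed (res_cocycle (sub_cocycle P f)) -> residue S},
    (forall s, eps (crU _ s 1%g) = s ^+ #|P|) /\ injective eps.
Proof.
move=> hered; pose a' := sub_action a P; pose f' := sub_cocycle P f.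
have faith' : faithful_action a'.
  by move=> g ag; apply: val_inj; apply: a_faithful.
have full' u : res_fixed a' u.
  have [r rF rE] := residue_of_fixed a_sep PI Pp u; exists r => // g.
  exact/rF/subgP.
have cP : #|{: subg_of P}| = #|P| by rewrite -cardsT -(card_isog (isog_subg P)).
have Pp' : [pchar residue S].-nat #|{: subg_of P}| by rewrite cP.
have [eps [N [V [epsE Vtop Vbot VD VM]]]] :=
  twisted_pgroup_augmentation (res_action_trivial full') Pp' (res_cocycle f').
exists eps; split; first by move=> s; rewrite epsE cP.
pose J x := eps (red (f := f') x) = 0.
have Jid : left_ideal J.
  split=> [|x y x0 y0|b x x0]; rewrite /J ?rmorph0 //.
    by rewrite !rmorphD /= x0 y0 addr0.
  by rewrite !rmorphM /= x0 mulr0.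
have [I [xs [Jxs gen]]] := left_ideal_generators Jid (aug_pi_mul eps).
have [phi [philin dual]] := left_hereditary_restrict (f' := f')
  (fun g x => erefl) (fun g h => erefl) hered Jid Jxs gen.
have V0 i : V i 0 by case: (VD i).
have VD' i : forall x y, V i x -> V i y -> V i (x + y) by case: (VD i).
have key := projective_augmentation faith' full' epsE Vtop Vbot V0 VD' VM Jxs
  philin dual.
apply: raddf_inj => z z0; have [x xE] := red_surj z.
by rewrite -xE; apply: key; rewrite xE.
Qed.

Lemma augmentation_injective_graded : left_hereditary (crossed f) ->
  exists eps : {rmorphism res_crossed f P -> residue S},
    (forall x s, val x = crU _ s 1%g -> eps x = s ^+ #|P|) /\ injective eps.
Proof.
move=> /augmentation_injective[eps [epsE eps_inj]].
pose r (x : res_crossed f P) := restr (res_cocycle (sub_cocycle P f)) (val x).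
have rB : zmod_morphism r by move=> x y; apply: restrB.
have rM : monoid_morphism r.
  split=> [|x y]; first exact: restr1.
  rewrite -[LHS]/(restr (res_cocycle (sub_cocycle P f)) (val x * val y)).
  rewrite -{1}[val x](restrK (res_cocycle (sub_cocycle P f)) (valP x)).
  exact: restr_extendl.
pose rR := HB.pack_for {rmorphism res_crossed f P ->
  crossed (res_cocycle (sub_cocycle P f))} r
  (GRing.isZmodMorphism.Build _ _ _ rB) (GRing.isMonoidMorphism.Build _ _ _ rM).
exists (eps \o rR); split=> [x s xE|].
  rewrite /= /r xE -epsE; congr (eps _); apply/ffunP => g.
  by rewrite !ffunE -val_eqE.
move=> x y /eps_inj rxy; apply: val_inj.
have ex (z : res_crossed f P) : val z =
  extend (res_cocycle f) (r z) by exact: esym (restrK _ (valP z)).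
by rewrite ex [RHS]ex -[r x]/(rR x) rxy.
Qed.

End WildPart.

(** * The inertial twisted group algebra *)

Section ScalarsField.
Variables (k : fieldType) (gT : finGroupType) (b : ring_action gT k).
Variables (f : cocycle2 b) (P : {group gT}).
Local Notation A := (subcrossed f P).

Definition sub_scalar (s : k) : A := SubCrossed (crU_graded f s (group1 P)).

Lemma sub_scalarD s t : sub_scalar (s + t) = sub_scalar s + sub_scalar t.
Proof. by apply: val_inj; apply: crUD. Qed.

Lemma sub_scalarM s t : sub_scalar (s * t) = sub_scalar s * sub_scalar t.
Proof. by apply: val_inj; rewrite /= -crU1M. Qed.

Lemma sub_scalar1 : sub_scalar 1 = 1.
Proof. exact: val_inj. Qed.

Lemma sub_scalar_inj : injective sub_scalar.
Proof. by move=> s t /(congr1 val)/ffunP/(_ 1%g); rewrite !ffunE eqxx. Qed.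

Definition frobenius_embedding (q : nat) (eps : A -> k) : Prop :=
  injective eps /\ forall s, eps (sub_scalar s) = s ^+ q.

(** An alias of the graded subring, indexed by the embedding that makes it a field. *)
Definition pgroup_field (q : nat) (eps : {rmorphism A -> k})
  (_ : frobenius_embedding q.+1 eps) : Type := A.

Variables (q : nat) (eps : {rmorphism A -> k}).
Hypothesis epsP : frobenius_embedding q.+1 eps.
Local Notation F := (pgroup_field epsP).

HB.instance Definition _ := GRing.NzRing.on F.

Fact pgroup_field_mulC : commutative (@GRing.mul F).
Proof. by move=> x y; apply: (proj1 epsP); rewrite !rmorphM mulrC. Qed.
HB.instance Definition _ :=
  GRing.PzRing_hasCommutativeMul.Build F pgroup_field_mulC.

Lemma pgroup_field_exp (x : A) : x ^+ q.+1 = sub_scalar (eps x).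
Proof. by apply: (proj1 epsP); rewrite (proj2 epsP) rmorphXn. Qed.

(** Read off from [x * x^q = eps x], a scalar; this is why the exponent has the form [q.+1]. *)
Definition pgroup_field_inv (x : F) : F := sub_scalar (eps x)^-1 * (x : A) ^+ q.

Fact pgroup_field_mulVf (x : F) : x != 0 -> pgroup_field_inv x * x = 1.
Proof.
move=> x0; rewrite /pgroup_field_inv -[LHS]mulrA.
have -> : (x : A) ^+ q * x =
  sub_scalar (eps x) by rewrite -exprSr pgroup_field_exp.
rewrite -sub_scalarM mulVf ?sub_scalar1 //.
by apply: contraNneq x0 => e0; apply/eqP/(proj1 epsP); rewrite e0 rmorph0.
Qed.

Fact pgroup_field_inv0 : pgroup_field_inv 0 = 0.
Proof.
apply: val_inj; rewrite /pgroup_field_inv rmorph0 invr0 /= crU0.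
exact: mul0r.
Qed.
HB.instance Definition _ := GRing.ComNzRing_isField.Build F
  pgroup_field_mulVf pgroup_field_inv0.

Definition pgroup_field_scale (s : k) (x : F) : F := sub_scalar s * (x : A).

Fact pgroup_field_scalerA s t v :
  pgroup_field_scale s (pgroup_field_scale t v) = pgroup_field_scale (s * t) v.
Proof. by rewrite /pgroup_field_scale sub_scalarM mulrA. Qed.
Fact pgroup_field_scale1r : left_id 1 pgroup_field_scale.
Proof. by move=> v; rewrite /pgroup_field_scale sub_scalar1 mul1r. Qed.
Fact pgroup_field_scalerDr : right_distributive pgroup_field_scale +%R.
Proof. by move=> s u v; apply: mulrDr. Qed.
Fact pgroup_field_scalerDl v : {morph pgroup_field_scale^~ v : s t / s + t}.
Proof. by move=> s t; rewrite /pgroup_field_scale sub_scalarD mulrDl. Qed.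
HB.instance Definition _ := GRing.Zmodule_isLmodule.Build k F
  pgroup_field_scalerA pgroup_field_scale1r pgroup_field_scalerDr
  pgroup_field_scalerDl.

Fact pgroup_field_scalerAl (s : k) (u v : F) : s *: (u * v) = (s *: u) * v.
Proof. exact: (@mulrA A). Qed.
HB.instance Definition _ :=
  GRing.Lmodule_isLalgebra.Build k F pgroup_field_scalerAl.
HB.instance Definition _ := GRing.Lalgebra_isComAlgebra.Build k F.

Fact pgroup_field_vect : Vector.axiom #|{: subg_of P}| F.
Proof.
exists (fun x : F => \row_i crval (x : A) (sgval (enum_val i)) : 'rV[k]_ _).
  by move=> s u v; apply/rowP => i; rewrite !mxE /= ffunE [X in X + _]crU1_mulE.
have gP (v : 'rV[k]_#|{: subg_of P}|) :
   [ffun g => if g \in P then v 0 (enum_rank (subg P g)) else 0] \in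
     @graded_by _ _ _ f P.
  by apply/graded_byP => g /negPf gP; rewrite ffunE gP.
exists (fun v => SubCrossed (gP v) : F) => [x|v].
  apply: val_inj; apply/ffunP => g; rewrite /= ffunE.
  case: ifPn => [gP'|gP']; first by rewrite mxE enum_rankK subgK.
  by apply/esym; have /graded_byP -> := valP (x : A).
by apply/rowP => i; rewrite mxE /= ffunE subgP sgvalK enum_valK.
Qed.
HB.instance Definition _ := Lmodule_hasFinDim.Build k F pgroup_field_vect.
End ScalarsField.

(** * Quotients of polynomial rings and cyclic twisted group algebras *)

Lemma separable_XnsubC (F : fieldType) n (c : F) :
  n%:R != 0 :> F -> c != 0 -> separable_poly ('X^n - c%:P).
Proof.
move=> n0 c0; rewrite separable_poly.unlock; apply/Bezout_eq1_coprimepP.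
(* For [g = X^n - c], the Bezout relation is [X g' / (n c) - g / c = 1]. *)
exists (- (c^-1)%:P, (n%:R * c)^-1 *: 'X) => /=.
case: n n0 => [|n] n0; first by rewrite eqxx in n0.
have -> : ((n.+1%:R * c)^-1 *: 'X) * ('X^(n.+1) - c%:P)^`() =
  (c^-1)%:P * 'X^(n.+1).
  rewrite derivB derivC subr0 derivXn -scaler_nat -scalerAl -scalerAr scalerA.
  by rewrite -exprS invfM -mulrA [c^-1 * _]mulrC mulrA mulVf // mul1r mul_polyC.
by rewrite mulNr mulrBr -polyCM mulVf // opprB subrK.
Qed.

Section PolynomialImage.
Variables (F : fieldType) (B : nzRingType) (Psi : {rmorphism {poly F} -> B}).

Lemma poly_image_comm : (forall b, exists p, Psi p = b) ->
  forall b c : B, b * c = c * b.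
Proof.
move=> surj b c; have [p <-] := surj b; have [q <-] := surj c.
by rewrite -!rmorphM mulrC.
Qed.

(** A left ideal pulls back to the multiples of a divisor [d] of [h = d' d]. Separability makes [d']
    and [d] coprime, so the image of [d'] generates a complement. *)
Lemma separable_quotient_semisimple (h : {poly F}) :
  (forall b, exists p, Psi p = b) -> Psi h = 0 -> separable_poly h ->
  semisimple_ring B.
Proof.
move=> surj h0 hsep I [I0 ID IM]; have comm := poly_image_comm surj.
have hN0 : h != 0 by apply: separable_poly_neq0.
pose K n := boolp.asbool (exists p : {poly F}, [/\ p != 0,
  size p = n & I (Psi p)]).
have exK : exists n, K n.
  by exists (size h); apply/boolp.asboolP; exists h; rewrite h0.
case: (ex_minnP exK) => n /boolp.asboolP[d [d0 dn Id]] nmin.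
have d_dvd q : I (Psi q) -> d %| q.
  move=> Iq; apply/modp_eq0P/eqP/negPn/negP => r0.
  have : (n <= size (q %% d)%R)%N.
    apply: nmin; apply/boolp.asboolP; exists (q %% d)%R; split=> //.
    have -> : (q %% d)%R = q - (q %/ d)%R * d.
      by rewrite {2}(divp_eq q d) addrAC subrr add0r.
    rewrite rmorphB rmorphM; apply: ID => //; rewrite -mulNr; exact: IM.
  by rewrite leqNgt -dn ltn_modp d0.
have /dvdpP[d' hE] : d %| h by apply: d_dvd; rewrite h0.
have /Bezout_eq1_coprimepP[[u v] /= uv] : coprimep d' d.
  by apply: separable_coprime hsep _; rewrite hE.
exists (fun b => exists c, b = c * Psi d'); split.
- split; first by exists 0; rewrite mul0r.
    by move=> _ _ [c ->] [c' ->]; exists (c + c'); rewrite mulrDl.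
  by move=> b _ [c ->]; exists (b * c); rewrite mulrA.
- move=> x Ix [c xE]; have [q qE] := surj x.
  have /dvdpP[r rE] : d %| q by apply: d_dvd; rewrite qE.
  have xd : Psi d * x = 0.
    by rewrite xE (comm c) mulrA -rmorphM mulrC -hE h0 mul0r.
  have xd' : Psi d' * x = 0.
    by rewrite -qE rE -rmorphM mulrCA -hE rmorphM h0 mulr0.
  by rewrite -[x]mul1r -(rmorph1 Psi) -uv rmorphD !rmorphM mulrDl -!mulrA xd
    xd' !mulr0 addr0.
- move=> x; exists (x * Psi v * Psi d), (x * Psi u * Psi d'); split.
  + exact: IM.
  + by eexists.
  by rewrite -!mulrA -mulrDr -!rmorphM -rmorphD addrC uv rmorph1 mulr1.
Qed.

Section Quotient.
Variables (h : {poly F}) (e : nat).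
Hypotheses (e_gt0 : (0 < e)%N) (h_monic : h \is monic) (h_size : size h = e.+1).
Hypothesis Psi_h : Psi h = 0.
Hypothesis Psi_surj : forall b, exists2 p : {poly F},
  (size p <= e)%N & Psi p = b.
Hypothesis Psi_inj : forall p : {poly F}, (size p <= e)%N -> Psi p = 0 -> p = 0.

(** [{poly %/ h}] reduces modulo [mk_monic h], which agrees with [h] when [h] is monic of positive
    degree. *)
Let mkh : mk_monic h = h.
Proof. by rewrite /mk_monic h_size ltnS e_gt0 h_monic. Qed.

Lemma eval_rmodp p : Psi (Pdiv.CommonRing.rmodp p (mk_monic h)) = Psi p.
Proof.
rewrite mkh [in RHS](Pdiv.RingMonic.rdivp_eq h_monic p) rmorphD rmorphM Psi_h.
by rewrite mulr0 add0r.
Qed.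

(** Serves both for the inertial algebra and for the cyclic twisted group algebra, which are then
    compared through the common quotient. *)
Lemma qpoly_iso : exists chi : {rmorphism {poly %/ h} -> B},
  bijective chi /\ forall p : {poly F}, chi (in_qpoly h p) = Psi p.
Proof.
pose chi (p : {poly %/ h}) := Psi (val p).
have chiB : zmod_morphism chi by move=> p q; rewrite -rmorphB.
have chiM : monoid_morphism chi.
  split=> [|p q]; first by rewrite /chi /= rmorph1.
  rewrite -[LHS]/(Psi (Pdiv.CommonRing.rmodp (val p * val q) (mk_monic h))).
  by rewrite eval_rmodp rmorphM.
exists (HB.pack_for {rmorphism {poly %/ h} -> B} chi
  (GRing.isZmodMorphism.Build _ _ _ chiB)
  (GRing.isMonoidMorphism.Build _ _ _ chiM)); split.
  have sz (p : {poly %/ h}) : (size (val p) <= e)%N.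
    by rewrite -ltnS; apply: leq_trans (size_mk_monic p) _; rewrite mkh h_size.
  have [inv invP] := boolp.choice (fun b =>
    let: ex_intro2 p sp pb := Psi_surj b in
    ex_intro (fun q : {poly F} => (size q <= e)%N /\ Psi q = b) p (conj sp pb)).
  have chi_in p : chi (in_qpoly h p) = Psi p by rewrite /chi /= eval_rmodp.
  exists (fun b => in_qpoly h (inv b)) => [p|b]; last first.
    by have [_ ib] := invP b; rewrite /= chi_in.
  have [si ib] := invP (chi p); apply: val_inj.
  rewrite /= Pdiv.CommonRing.rmodp_small; last by rewrite mkh h_size ltnS.
  apply/eqP; rewrite -subr_eq0; apply/eqP.
  apply: Psi_inj; last by rewrite rmorphB ib subrr.
  by apply: leq_trans (size_polyD _ _) _; rewrite size_polyN geq_max si sz.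
by move=> p; rewrite /= /chi /= eval_rmodp.
Qed.
End Quotient.
End PolynomialImage.

Section CyclicTwist.
Variables (F : comUnitRingType) (n : nat) (alpha : F) (alphaU :
  alpha \is a GRing.unit).
Local Notation T := (crossed (cyclic_cocycle n alphaU)).
Local Notation u := (crU (cyclic_cocycle n alphaU) 1 (inZp 1)).

Lemma cyclic_crUX i : (i < n.+1)%N -> u ^+ i = crU _ 1 (inZp i).
Proof.
elim: i => [_|i IHi lt_i].
  by rewrite expr0; congr (crU _ _ _); apply: val_inj; rewrite /= mod0n.
rewrite exprSr IHi ?(ltnW lt_i) // crUM /= !mul1r /cyclic_coc /=.
have n1 : (1 < n.+1)%N by apply: leq_trans lt_i.
rewrite (modn_small n1) (modn_small (ltnW lt_i)) addn1 lt_i.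
congr (crU _ _ _); apply: val_inj => /=.
by rewrite (modn_small n1) (modn_small (ltnW lt_i)) addn1.
Qed.

Lemma cyclic_scalar_zmod : zmod_morphism (fun x : F =>
  crU (cyclic_cocycle n alphaU) x 1%g : T).
Proof. by move=> x y; apply/ffunP => g; rewrite !ffunE; case: eqP;
  rewrite ?subr0. Qed.
Lemma cyclic_scalar_monoid : monoid_morphism (fun x : F =>
  crU (cyclic_cocycle n alphaU) x 1%g : T).
Proof. by split=> // x y; rewrite crU1M. Qed.
Definition cyclic_scalar : {rmorphism F -> T} :=
  HB.pack_for {rmorphism F -> T} (fun x : F =>
    crU (cyclic_cocycle n alphaU) x 1%g : T)
  (GRing.isZmodMorphism.Build _ _ _ cyclic_scalar_zmod)
  (GRing.isMonoidMorphism.Build _ _ _ cyclic_scalar_monoid).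

Lemma cyclic_scalar_comm : commr_rmorph cyclic_scalar u.
Proof.
move=> x; apply/ffunP => g; rewrite [RHS]crU1_mulE mul_crU1E.
by rewrite mulrC.
Qed.

Lemma cyclic_horner (p : {poly F}) (i : 'I_n.+1) : (size p <= n.+1)%N ->
  horner_morph cyclic_scalar_comm p i = p`_i.
Proof.
move=> sp; rewrite /horner_morph (@horner_coef_wide _ n.+1); last first.
  exact: leq_trans (size_poly _ _) sp.
transitivity ((\sum_(j < n.+1) crU (cyclic_cocycle n alphaU) p`_j j : T) i).
  congr (fun_of_fin _ i); apply: eq_bigr => j _.
  rewrite coef_map cyclic_crUX // [RHS]crU_split; congr (_ * crU _ _ _).
  by apply: val_inj; rewrite /= modn_small.
rewrite sum_ffunE (bigD1 i) //= big1 ?addr0 => [|j ji];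
  first by rewrite ffunE eqxx.
by rewrite ffunE eq_sym (negPf ji).
Qed.

End CyclicTwist.

Section HomogeneousPowers.
Variables (gT : finGroupType) (A : comUnitRingType) (a : ring_action gT A).
Variable f : cocycle2 a.

Lemma mul_crUE (x : crossed f) s g h :
  (x * crU f s g) (h * g)%g = x h * a h s * f h g.
Proof.
rewrite crossedME (bigD1 h) //= mulKg ffunE eqxx big1 ?addr0 // => l lh.
rewrite ffunE ifN ?rmorph0 ?mulr0 ?mul0r //.
apply: contra lh => /eqP e; apply/eqP; apply: (mulIg g).
by rewrite -[in LHS]e mulKVg.
Qed.

Lemma crU_exp g i : exists2 c, c \is a GRing.unit &
  crU f 1 g ^+ i = crU f c (g ^+ i)%g.
Proof.
elim: i => [|i [c cU IHi]]; first by exists 1; rewrite ?unitr1.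
exists (c * a (g ^+ i)%g 1 * f (g ^+ i)%g g).
  by rewrite !unitrM cU rmorph1 unitr1 coc_unit.
by rewrite exprSr IHi crUM expgSr.
Qed.

Lemma val_subcrossed_sum (H : {group gT}) n (F : 'I_n -> subcrossed f H) :
  val (\sum_(i < n) F i) = \sum_(i < n) val (F i).
Proof. exact: (big_morph (fun z : subcrossed f H => val z)). Qed.

(** [U_g U_h] and [U_h U_g] are nonzero multiples of [U_(gh)] and [U_(hg)], so their equality forces
    [gh = hg]. *)
Lemma crossed_comm_abelian (H : {group gT}) :
  (forall x y : subcrossed f H, x * y = y * x) -> abelian H.
Proof.
move=> comm; apply/centsP => g gH h hH.
have := comm (SubCrossed (crU_graded f 1 gH)) (SubCrossed (crU_graded f 1 hH)).
move=> /(congr1 val) /=; rewrite !crUM => /ffunP/(_ (g * h)%g).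
rewrite !ffunE eqxx; case: eqP => // _ /eqP.
by rewrite !rmorph1 !mul1r; have := coc_unit f g h; case: eqP => // ->;
  rewrite unitr0.
Qed.

End HomogeneousPowers.

(** * Structure of the inertial algebra over the wild field *)

Section Necessity.
Variables (S : dvrType) (gT : finGroupType) (a : ring_action gT S).
Hypotheses (a_faithful : faithful_action a) (a_sep : residually_separable a).
Variables (f : cocycle2 a) (P : {group gT}) (sigma0 : gT).
Hypotheses (sylP : ([pchar residue S].-Hall(inertia a) P)%g)
    (defGI : (P ><| <[sigma0]> = inertia a)%g).
Variables (alpha0 : residue S).
Hypotheses (alpha0U : alpha0 \is a GRing.unit)
    (alpha0E : crU (res_cocycle f) 1 sigma0 ^+ #[sigma0]%g
               = crU (res_cocycle f) alpha0 1%g).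
Local Notation k := (residue S).
Local Notation fb := (res_cocycle f).
Local Notation AP := (res_crossed f P).
Local Notation A := (res_crossed f (inertia a)).
Local Notation e := #[sigma0]%g.

Lemma sylP_sub : P \subset inertia a. Proof. exact: pHall_sub sylP. Qed.

Lemma sylP_nat : [pchar k].-nat #|P|. Proof. exact: pHall_pgroup sylP. Qed.

Lemma order_pnat : [pchar k]^'.-nat e.
Proof.
have /and3P[_ _] := sylP; rewrite -divgS ?sylP_sub // -(sdprod_card defGI).
by rewrite mulKn ?cardG_gt0.
Qed.

Lemma sigma0_inertia : sigma0 \in inertia a.
Proof.
by have [_ /subsetP sC _ _ _] := sdprod_context defGI; apply/sC/cycle_id.
Qed.

Lemma inertia_act g : g \in inertia a -> res_action a g =1 id.
Proof. by move/inertiaP. Qed.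

Lemma wild_inclusion_subproof (x : AP) :
  val x \in @graded_by _ _ _ fb (inertia a).
Proof.
apply/graded_byP => g gI; have /graded_byP -> := valP x => //.
by apply: contra gI; apply/subsetP/sylP_sub.
Qed.

Definition wild_inclusion (x : AP) : A :=
  SubCrossed (wild_inclusion_subproof x).

Fact wild_inclusionB : zmod_morphism wild_inclusion.
Proof. by move=> x y; apply: val_inj. Qed.
Fact wild_inclusionM : monoid_morphism wild_inclusion.
Proof. by split=> [|x y]; apply: val_inj. Qed.

Definition tame_gen : A := SubCrossed (crU_graded fb 1 sigma0_inertia).

Section Field.
Variables (q : nat) (eps : {rmorphism AP -> k}).
Hypothesis epsP : frobenius_embedding q.+1 eps.
Local Notation F := (pgroup_field epsP).

(* Conjugation by U_sigma0 is an automorphism of F over residue S, and F is   *)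
(* purely inseparable over residue S.                                         *)
Lemma tame_wild_comm (x : AP) : crU fb 1 sigma0 * val x =
  val x * crU fb 1 sigma0.
Proof.
have [t [tU st ts]] := crU_inv fb sigma0 (unitr1 k).
set u := crU fb 1 sigma0 in st ts *; set v := crU fb t _ in st ts.
have [_ _ _ /subsetP nPC _] := sdprod_context defGI.
have nP : sigma0 \in 'N(P)%g by apply/nPC/cycle_id.
have gr (y : AP) : u * val y * v \in @graded_by _ _ _ fb P.
  rewrite (cr_sumU (val y)) mulr_sumr mulr_suml; apply: rpred_sum => g _.
  have [gP|gP] := boolP (g \in P); last first.
    by have /graded_byP -> := valP y => //; rewrite crU0 mulr0 mul0r rpred0.
  rewrite !crUM; apply: crU_graded.
  have -> : (sigma0 * g * sigma0^-1 =
    g ^ sigma0^-1)%g by rewrite conjgE invgK mulgA.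
  by rewrite memJ_norm ?groupV.
pose c (y : AP) : AP := SubCrossed (gr y).
have cM y z : c (y * z) = c y * c z.
  apply: val_inj; rewrite /= -!mulrA; congr (_ * (_ * _)).
  by rewrite [v * (u * _)]mulrA ts mul1r.
have c1 : c 1 = 1 by apply: val_inj; rewrite /= mulr1.
have cX y n : c (y ^+ n) = c y ^+ n.
  by elim: n => [//|n IHn]; rewrite !exprS cM IHn.
have cS s : c (sub_scalar fb P s) = sub_scalar fb P s.
  apply: val_inj; rewrite /=.
  have -> : u * crU fb s 1%g = crU fb s 1%g * u.
    rewrite !crUM mul1g mulg1 coc1g cocg1 !mulr1 mul1r rmorph1 mulr1.
    by rewrite (inertia_act sigma0_inertia).
  by rewrite -mulrA st mulr1.
(* The power [x ^+ q.+1] is the scalar [eps x], which conjugation fixes; hence [eps (c x) = eps x],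
   and [eps] is injective. *)
have cx : c x = x.
  have := cX x q.+1; rewrite !(pgroup_field_exp epsP) cS => ex.
  by apply: (proj1 epsP); apply/esym/(sub_scalar_inj ex).
by rewrite -{2}cx /= -!mulrA ts mulr1.
Qed.

Definition pgroup_field_inclusion : {rmorphism F -> A} :=
  HB.pack_for {rmorphism F -> A} (wild_inclusion : F -> A)
    (GRing.isZmodMorphism.Build F A (wild_inclusion : F -> A) wild_inclusionB)
    (GRing.isMonoidMorphism.Build F A (wild_inclusion : F ->
      A) wild_inclusionM).

Lemma tame_gen_comm : commr_rmorph pgroup_field_inclusion tame_gen.
Proof. by move=> x; apply: val_inj; exact: (tame_wild_comm x). Qed.

Definition inertia_eval : {rmorphism {poly F} -> A} :=
  horner_morph tame_gen_comm.

Lemma inertia_evalX : inertia_eval 'X = tame_gen.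
Proof. exact: (horner_morphX tame_gen_comm). Qed.

Lemma inertia_evalC c : inertia_eval c%:P = pgroup_field_inclusion c.
Proof. exact: (horner_morphC tame_gen_comm). Qed.

Lemma val_tame_genX i : val (tame_gen ^+ i) = crU fb 1 sigma0 ^+ i.
Proof. by elim: i => [//|i IHi]; rewrite !exprS -IHi. Qed.

Definition tame_unit i : k := s2val (boolp.cid2 (crU_exp fb sigma0 i)).

Lemma tame_unit_unit i : tame_unit i \is a GRing.unit.
Proof. exact: s2valP (boolp.cid2 (crU_exp fb sigma0 i)). Qed.

Lemma tame_unitE i :
  crU fb 1 sigma0 ^+ i = crU fb (tame_unit i) (sigma0 ^+ i)%g.
Proof. exact: s2valP' (boolp.cid2 (crU_exp fb sigma0 i)). Qed.

(** Every inertia element is uniquely [h * sigma0 ^+ j] with [h] in [P] and [j < e], so only the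
    term of index [j] contributes. *)
Lemma inertia_eval_coef (p : {poly F}) j h : (size p <= e)%N -> (j < e)%N ->
  h \in P ->
  val (inertia_eval p) (h * sigma0 ^+ j)%g
  = val (p`_j : AP) h * tame_unit j * fb h (sigma0 ^+ j)%g.
Proof.
move=> sp lt_j hP.
have -> : val (inertia_eval p) =
  \sum_(i < e) val (p`_i : AP) * crU fb (tame_unit i) (sigma0 ^+ i)%g.
  rewrite -[inertia_eval p]/(map_poly pgroup_field_inclusion p).[tame_gen].
  rewrite (@horner_coef_wide _ e); last first.
    exact: leq_trans (size_poly _ _) sp.
  rewrite val_subcrossed_sum; apply: eq_bigr => i _.
  by rewrite coef_map -tame_unitE -val_tame_genX.
rewrite sum_ffunE (bigD1 (Ordinal lt_j)) //= big1 ?addr0 => [|i ij].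
  by rewrite mul_crUE (inertia_act (subsetP sylP_sub _ hP)).
have -> : (h * sigma0 ^+ j =
  (h * sigma0 ^+ j * sigma0 ^- i) * sigma0 ^+ i)%g by rewrite mulgKV.
rewrite mul_crUE; have /graded_byP -> := valP (p`_i : AP); rewrite ?mul0r //.
apply: contra ij => hP'; have [_ _ _ _ tiP] := sdprod_context defGI.
have : (sigma0 ^+ j * sigma0 ^- i)%g \in P :&: <[sigma0]>%g.
  apply/setIP; split; first by rewrite -(groupMl _ hP) mulgA.
  by rewrite groupM ?groupV ?mem_cycle.
rewrite tiP => /set1P/eqP; rewrite -eq_mulgV1 eq_expg_mod_order !modn_small //.
by rewrite -val_eqE eq_sym.
Qed.

Lemma inertia_eval_inj (p : {poly F}) : (size p <= e)%N -> inertia_eval p =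
  0 -> p = 0.
Proof.
move=> sp p0; apply/polyP => j; rewrite coef0.
have [le_j|lt_j] := leqP e j; first by rewrite nth_default // (leq_trans sp).
apply: val_inj; apply/ffunP => h; rewrite [RHS]ffunE.
have [hP|hP] := boolP (h \in P);
  last by have /graded_byP -> := valP (p`_j : AP).
have := inertia_eval_coef sp lt_j hP; rewrite p0 /= ffunE => /esym/eqP.
rewrite !mulf_eq0 -[fb h _ == 0]negbK -unitfE coc_unit orbF.
by rewrite -[tame_unit j == 0]negbK -unitfE tame_unit_unit orbF => /eqP.
Qed.

Lemma inertia_eval_surj (x : A) : exists2 p : {poly F},
  (size p <= e)%N & inertia_eval p = x.
Proof.
(* Obtained by solving the formula of [inertia_eval_coef] for the coefficients of the polynomial. *)
pose yf j : crossed fb := [ffun h => if h \in P then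
   val x (h * sigma0 ^+ j)%g / (tame_unit j * fb h (sigma0 ^+ j)%g) else 0].
have yP j : yf j \in @graded_by _ _ _ fb P.
  by apply/graded_byP => h /negPf hP; rewrite ffunE hP.
pose y j : F := SubCrossed (yP j).
exists (\poly_(j < e) y j); first exact: size_poly.
apply: val_inj; apply/ffunP => g.
have [gI|gI] := boolP (g \in inertia a); last first.
  have /graded_byP -> // := valP (inertia_eval (\poly_(j < e) y j)).
  by have /graded_byP -> := valP x.
have [_ _ PC _ _] := sdprod_context defGI.
have /mulsgP[h s hP /cyclePmin[j lt_j ->] ->] :
  g \in (P * <[sigma0]>)%g by rewrite PC.
rewrite (inertia_eval_coef (size_poly _ _) lt_j hP) coef_poly lt_j /= ffunE hP.
by rewrite -mulrA divrK // unitrM tame_unit_unit coc_unit.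
Qed.

Local Notation h := ('X^e - (alpha0%:A : F)%:P).

Lemma pgroup_field_scaleE s : (s%:A : F) = sub_scalar fb P s.
Proof. exact: mulr1. Qed.

Lemma inertia_eval_h : inertia_eval h = 0.
Proof.
rewrite rmorphB rmorphXn inertia_evalX inertia_evalC.
apply/eqP; rewrite subr_eq0; apply/eqP/val_inj; rewrite val_tame_genX alpha0E.
by rewrite pgroup_field_scaleE.
Qed.

Lemma alpha0A_neq0 : alpha0%:A != 0 :> F.
Proof. by rewrite -unitfE (rmorph_unit (in_alg F)). Qed.

Lemma order_neq0 : e%:R != 0 :> F.
Proof.
apply/negP => e0; have [p pF] := natf0_pchar (order_gt0 sigma0) e0.
have pk : p \in [pchar k] by rewrite -(pchar_lalg F).
have pe : (p %| e)%N by rewrite (dvdn_pcharf pF).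
have := pnatPpi order_pnat; move=> /(_ p);
  rewrite mem_primes order_gt0 pe (pcharf_prime pk).
by move=> /(_ isT); rewrite inE /= pk.
Qed.

Lemma inertia_semisimple : semisimple_ring A.
Proof.
apply: (@separable_quotient_semisimple _ _ inertia_eval h).
- by move=> x; have [p _ <-] := inertia_eval_surj x; exists p.
- exact: inertia_eval_h.
- exact: separable_XnsubC order_neq0 alpha0A_neq0.
Qed.

Lemma inertia_comm (x y : A) : x * y = y * x.
Proof.
by apply: (poly_image_comm (Psi := inertia_eval)) => z;
  have [p _ <-] := inertia_eval_surj z; exists p.
Qed.

Lemma pgroup_field_insep : q.+1 = #|P| -> purely_inseparable 1 {:F}.
Proof.
move=> qP; apply/allP => x _; apply/purely_inseparable_elementP_pchar.
exists #|P|; first by rewrite (eq_pnat _ (pchar_lalg F)) sylP_nat.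
have -> : x ^+ #|P| = (eps x)%:A.
  rewrite pgroup_field_scaleE -qP -(pgroup_field_exp epsP).
  by elim: q.+1 => [//|n IHn]; rewrite !exprS IHn.
by rewrite rpredZ ?mem1v.
Qed.

Section Twist.
Let alphaU := rmorph_unit (in_alg F) alpha0U.
Local Notation twist := (cyclic_twist e alphaU).

Let e_pred : e.-1.+1 = e. Proof. by rewrite prednK ?order_gt0. Qed.

Definition twist_eval : {rmorphism {poly F} -> crossed twist} :=
  horner_morph (cyclic_scalar_comm e.-1 alphaU).

Lemma twist_evalX : twist_eval 'X = crU twist 1 (inZp 1).
Proof. exact: (horner_morphX (cyclic_scalar_comm e.-1 alphaU)). Qed.

Lemma twist_evalC c : twist_eval c%:P = crU twist c 1%g.
Proof. exact: (horner_morphC (cyclic_scalar_comm e.-1 alphaU)). Qed.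

Lemma twist_eval_h : twist_eval h = 0.
Proof.
rewrite rmorphB rmorphXn twist_evalX twist_evalC.
apply/eqP; rewrite subr_eq0; apply/eqP.
apply: (etrans (congr1 (GRing.exp (crU twist 1 (inZp 1))) (esym e_pred))).
(* When [e = 1] the cyclic group is trivial; then [sigma0], [alpha0] and the generator are all
   [1]. *)
have [e1|e1] := posnP e.-1; last exact: cyclic_crU_exp.
have e1' : e = 1%N by rewrite -e_pred e1.
have s1 : sigma0 = 1%g by apply/eqP; rewrite -order_eq1 e1'.
have a1 : alpha0 = 1.
  move: alpha0E; rewrite e1' expr1 s1 => /ffunP/(_ 1%g).
  by rewrite !ffunE eqxx.
have -> : inZp 1 = 1%g :> 'I_e.-1.+1 by apply: val_inj; rewrite /= e1 modn1.
rewrite -[crU twist 1 1%g]/(1 : crossed twist) expr1n; congr (crU _ _ _).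
by rewrite a1 scale1r.
Qed.

(** Both algebras are quotients of the polynomials over [F] by [h]; the first isomorphism is [chi1]
    composed with the inverse of [chi0]. *)
Lemma twist_iso :
  (exists phi : {rmorphism crossed twist -> A},
     [/\ bijective phi,
         forall x, phi (crU twist x 1%g) = pgroup_field_inclusion x
       & phi (crU twist 1 (inZp 1)) = tame_gen]) /\
  (exists psi : {rmorphism {poly %/ h} -> crossed twist},
     [/\ bijective psi, forall x, psi (qpolyC _ x) = crU twist x 1%g
       & psi 'qX = crU twist 1 (inZp 1)]).
Proof.
have hmon := monicXnsubC (alpha0%:A : F) (order_gt0 sigma0).
have hsz := size_XnsubC (alpha0%:A : F) (order_gt0 sigma0).
have [chi1 [chi1_bij chi1E]] := qpoly_iso (order_gt0 sigma0) hmon hsz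
  inertia_eval_h inertia_eval_surj inertia_eval_inj.
have twist_coef (p : {poly F}) (i : 'I_e.-1.+1) : (size p <= e)%N ->
  twist_eval p i = p`_i.
  by move=> sp; apply: cyclic_horner; rewrite e_pred.
have twist_surj (t : crossed twist) : exists2 p : {poly F},
  (size p <= e)%N & twist_eval p = t.
  exists (\poly_(i < e) t (inZp i)); first exact: size_poly.
  apply/ffunP => i; have ie : (i < e)%N.
    by apply: leq_trans (ltn_ord i) _; rewrite e_pred.
  rewrite twist_coef ?size_poly // coef_poly ie.
  by congr (t _); apply: val_inj; rewrite /= modn_small.
have twist_inj (p : {poly F}) : (size p <= e)%N -> twist_eval p = 0 -> p = 0.
  move=> sp p0; apply/polyP => i; rewrite coef0.
  have [le_i|lt_i] := leqP e i; first by rewrite nth_default // (leq_trans sp).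
  rewrite -e_pred in lt_i; have := twist_coef p (Ordinal lt_i) sp.
  by rewrite p0 ffunE.
have [chi0 [chi0_bij chi0E]] := qpoly_iso (order_gt0 sigma0) hmon hsz
  twist_eval_h twist_surj twist_inj.
have qC x : qpolyC h x = in_qpoly h x%:P.
  apply: val_inj; rewrite /= Pdiv.CommonRing.rmodp_small //.
  exact: size_mk_monic (qpolyC h x).
split; last first.
  by exists chi0; split=> // [x|]; rewrite ?qC chi0E ?twist_evalC ?twist_evalX.
have [g chi0K gK] := chi0_bij.
have gB : zmod_morphism (chi1 \o g).
  by move=> x y /=; rewrite -rmorphB; congr (chi1 _); apply: (can_inj chi0K);
    rewrite rmorphB !gK.
have gM : monoid_morphism (chi1 \o g).
  split=> [|x y] /=.
    by rewrite -(rmorph1 chi0) chi0K rmorph1.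
  by rewrite -rmorphM; congr (chi1 _); apply: (can_inj chi0K);
    rewrite rmorphM !gK.
exists (HB.pack_for {rmorphism crossed twist -> A} (chi1 \o g)
  (GRing.isZmodMorphism.Build _ _ _ gB) (GRing.isMonoidMorphism.Build _ _ _
    gM)).
split=> [|x|].
- by apply: bij_comp chi1_bij _; exists chi0.
- by rewrite /= -twist_evalC -chi0E chi0K chi1E inertia_evalC.
- by rewrite /= -twist_evalX -chi0E chi0K chi1E inertia_evalX.
Qed.

End Twist.
End Field.
End Necessity.

(** * The equivalence and the direct product decomposition *)

Theorem corollary2p4 (S : dvrType) (gT : finGroupType) (a : ring_action gT S)
    (a_faithful : faithful_action a) (a_sep : residually_separable a)
    (f : cocycle2 a) (P : {group gT}) (sigma0 : gT)
    (sylP : ([pchar residue S].-Hall(inertia a) P)%g)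
    (defGI : (P ><| <[sigma0]> = inertia a)%g)
    (alpha0 : residue S) (alpha0U : alpha0 \is a GRing.unit)
    (alpha0E : crU (res_cocycle f) 1 sigma0 ^+ #[sigma0]%g
               = crU (res_cocycle f) alpha0 1%g) :
  (hereditary (crossed f) <->
   semisimple_ring (res_crossed f (inertia a)) /\
   exists (F : fieldExtType (residue S))
          (rho : {rmorphism F -> res_crossed f P}),
     let twist := cyclic_twist #[sigma0]%g (rmorph_unit (in_alg F) alpha0U) in
     [/\ bijective rho
           /\ (forall s, val (rho s%:A) = crU (res_cocycle f) s 1%g),
         purely_inseparable 1 {:F},
         [pchar residue S]^'.-nat #[sigma0]%g,
         exists phi : {rmorphism crossed twist -> res_crossed f (inertia a)},
           [/\ bijective phi,
               forall x, val (phi (crU twist x 1%g)) = val (rho x)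
             & val (phi (crU twist 1 (inZp 1))) = crU (res_cocycle f) 1 sigma0]
       & exists psi : {rmorphism
             {poly %/ 'X^#[sigma0]%g - (alpha0%:A)%:P} -> crossed twist},
           [/\ bijective psi,
               forall x, psi (qpolyC _ x) = crU twist x 1%g
             & psi 'qX = crU twist 1 (inZp 1)]])
  /\ (hereditary (crossed f) ->
      abelian (inertia a) /\ (P \x <[sigma0]> = inertia a)%g).
Proof.
have hered_field : hereditary (crossed f) ->
    exists eps : {rmorphism res_crossed f P -> residue S},
      frobenius_embedding #|P|.-1.+1 eps.
  move=> [hered _].
  have [eps [epsE eps_inj]] := augmentation_injective_graded a_faithful a_sep
    (sylP_sub sylP) (sylP_nat sylP) hered.
  by exists eps; split=> // s; rewrite prednK ?cardG_gt0 //; apply: epsE.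
split; last first.
  move=> /hered_field[eps epsP].
  have abI : abelian (inertia a).
    apply: (crossed_comm_abelian (f := res_cocycle f)).
    exact (inertia_comm sylP defGI epsP).
  (* As the inertia group is abelian, [sigma0] centralizes [P] and the semidirect product is
     direct. *)
  split=> //; rewrite dprodEsd //.
  have [_ sC _ _ _] := sdprod_context defGI.
  by rewrite (subset_trans sC) // (subset_trans abI) ?centS ?(sylP_sub sylP).
split=> [/hered_field[eps epsP]|[ss [F [rho [_ _ _ [phi [phi_bij _ _]] [psi
  [psi_bij _ _]]]]]]].
  split; first exact: (inertia_semisimple sylP defGI alpha0U alpha0E epsP).
  have idB : zmod_morphism (id : pgroup_field epsP -> res_crossed f P) by [].
  have idM : monoid_morphism (id : pgroup_field epsP -> res_crossed f P) by [].
  exists (pgroup_field epsP),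
    (HB.pack_for {rmorphism pgroup_field epsP -> res_crossed f P}
    (id : pgroup_field epsP -> res_crossed f P)
    (GRing.isZmodMorphism.Build _ _ _ idB) (GRing.isMonoidMorphism.Build _ _ _
      idM)).
  have [[phi [phi_bij phiC phiX]] psi_iso] :=
    twist_iso sylP defGI alpha0U alpha0E epsP.
  split=> //.
  - split=> [|s]; first by exists id.
    exact: (congr1 val (pgroup_field_scaleE epsP s)).
  - exact: (pgroup_field_insep sylP epsP (prednK (cardG_gt0 P))).
  - exact: order_pnat sylP defGI.
  - by exists phi; split=> // [x|]; rewrite ?phiC ?phiX.
(* Commutativity of the inertial algebra is transported from the polynomial quotient along [psi] and
   [phi]. *)
apply: crossed_hereditary => // x y.
have [g gK Kg] := bij_comp phi_bij psi_bij.
rewrite -[x]Kg -[y]Kg /= -!rmorphM; congr (phi (psi _)); exact: mulrC.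
Qed.
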